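(* In the setting below, fix $0\le k\le g$ with $N_k>1$. Let $F=\sum_{B\in\mathcal{B}}f_B\Phi^B$ be the $\Phi$-adic expansion of $F$, and for $i\in\mathbb{N}$ let $w_i:=\min\{\langle B,V\rangle : B\in\mathcal{B},\ b_k=i,\ f_B\neq0\}-v_k(F)$ (with $w_i=\infty$ if the set is empty). Then the Newton polygon of $H_k$ is the lower convex hull of the points $(i,w_i)$, $0\le i\le N_k$.
   Context: Setting. $\mathbb{K}$ perfect, $F\in\mathbb{K}[[x]][y]$ monic of degree $d$, $\mathrm{char}\,\mathbb{K}=0$ or $>d$. For $H=\sum h_i(x)y^i$ over a field, its Newton polygon is the lower convex hull of $\{(i,\mathrm{val}_x h_i)\}$, its principal Newton polygon the union of its edges of negative slope; the boundary polynomial w.r.t. a polygon is the sum of the terms $h_{ij}x^jy^i$ with $(i,j)$ on the polygon. $H$ is degenerated w.r.t. a polygon if the polygon is straight of slope $-m/q$ ($q>0$, $\gcd(q,m)=1$) and its boundary polynomial is $c\,(P(y^q/x^m)x^{\varepsilon m\deg P})^N$ with $c\ne0$, $P$ monic irreducible, $\varepsilon=1$ if $m\ge0$ and $0$ otherwise; $(q,m,P,N)$ is the edge data, $\ell=\deg P$. Procedure: $\mathbb{K}_0=\mathbb{K}$, $N_0=d$, $c_0=-a_{d-1}/d$ ($a_{d-1}$ the coefficient of $y^{d-1}$ in $F$), $\tau_0(x,y)=(x,y+c_0(x))$, $H_0=F\circ\tau_0$. For $k\ge0$: if $N_k=1$, or $H_k$ is not degenerated over $\mathbb{K}_k$ (w.r.t.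 its Newton polygon if $k=0$, its principal Newton polygon if $k\ge1$), stop and set $g=k$. Otherwise let $(q_{k+1},m_{k+1},P_{k+1},N_{k+1})$ be the edge data, $\ell_{k+1}=\deg P_{k+1}$, $\mathbb{K}_{k+1}=\mathbb{K}_k[Z_{k+1}]/(P_{k+1})$, $z_{k+1}$ the class of $Z_{k+1}$, $s_{k+1},t_{k+1}$ with $q_{k+1}s_{k+1}-m_{k+1}t_{k+1}=1$, $0\le t_{k+1}<q_{k+1}$, $\sigma_{k+1}(x,y)=(z_{k+1}^{t_{k+1}}x^{q_{k+1}},x^{m_{k+1}}(y+z_{k+1}^{s_{k+1}}))$; write $H_k\circ\sigma_{k+1}=x^aUG$ with $U(0,0)\ne0$ and $G$ Weierstrass of degree $N_{k+1}$; let $c_{k+1}=-(\text{coefficient of }y^{N_{k+1}-1}\text{ in }G)/N_{k+1}$, $\tau_{k+1}(x,y)=(x,y+c_{k+1}(x))$, $H_{k+1}=G\circ\tau_{k+1}$. Let $\pi_0=\tau_0$, $\pi_k=\pi_{k-1}\circ\sigma_k\circ\tau_k$; then $\pi_k(x,y)=(\mu_kx^{e_k},\alpha_kx^{r_k}y+S_k(x))$ with $e_k=q_1\cdots q_k$, $\mu_k,\alpha_k\in\mathbb{K}_k^\times$, $S_k\in\mathbb{K}_k[[x]]$; $f_k=\ell_1\cdots\ell_k$. For $0\le i\le g$, $\phi_i$ is the unique monic irreducible polynomial of $\mathbb{K}[[x]][y]$ with $\phi_i(\mu_ix^{e_i},S_i(x))=0$ (it has degree $e_if_i$), and $\phi_{-1}=x$.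 For $H\in\mathbb{K}[[x]][y]$, $v_k(H)$ is the $x$-adic valuation of $H(\pi_k(x,y))$. Fix $k$: $\Phi=(\phi_{-1},\dots,\phi_k)$, $\mathcal{B}=\{B=(b_{-1},\dots,b_k)\in\mathbb{N}^{k+2}: b_{i-1}<q_i\ell_i,\ i=1,\dots,k\}$, $\Phi^B=\prod\phi_i^{b_i}$; $F$ has a unique expansion $F=\sum_{B\in\mathcal{B}}f_B\Phi^B$ with $f_B\in\mathbb{K}$. $V=(v_k(\phi_{-1}),\dots,v_k(\phi_k))$ and $\langle\cdot,\cdot\rangle$ is the usual scalar product. *)

(* Defs.v *)
From HB Require Import structures.
From mathcomp Require Import all_boot all_order all_algebra all_field.
Set Implicit Arguments. Unset Strict Implicit. Unset Printing Implicit Defensive.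
Import Order.TTheory GRing.Theory Num.Theory.
Local Open Scope ring_scope.

(*   ser R  : h j = coefficient of x^j                                 *)
(*   bser R : H i j = coefficient of y^i x^j                           *)
(* An element of R[[x]][y] is a bser with finite y-support (polyY).    *)
Section Series.
Variable R : comNzRingType.

Definition ser := nat -> R.
Definition bser := nat -> nat -> R.

Definition bzero : bser := fun _ _ => 0.
Definition bone : bser := fun i j => ((i == 0%N) && (j == 0%N))%:R.
Definition badd (A B : bser) : bser := fun i j => A i j + B i j.
Definition bmul (A B : bser) : bser := fun i j =>
  \sum_(i1 < i.+1) \sum_(j1 < j.+1) A i1 j1 * B (i - i1)%N (j - j1)%N.
Definition bexp (A : bser) (n : nat) : bser := iter n (bmul A) bone.
Definition bXn (n : nat) : bser := fun i j => ((i == 0%N) && (j == n))%:R.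
Definition bY : bser := fun i j => ((i == 1%N) && (j == 0%N))%:R.
Definition ofser (h : ser) : bser := fun i j => if i == 0%N then h j else 0.
Definition bconst (c : R) : bser := fun i j => ((i == 0%N) && (j == 0%N))%:R * c.

Definition beq (A B : bser) : Prop := forall i j, A i j = B i j.

Definition ydeg_le (H : bser) (n : nat) : Prop := forall i, (n < i)%N -> forall j, H i j = 0.
Definition monicY (H : bser) (n : nat) : Prop := ydeg_le H n /\ forall j, H n j = (j == 0%N)%:R.
Definition polyY (H : bser) : Prop := exists n, ydeg_le H n.
Definition unitY (H : bser) : Prop := exists H', polyY H' /\ beq (bmul H H') bone.
Definition irredY (H : bser) : Prop :=
  polyY H /\ ~ beq H bzero /\ ~ unitY H /\
  forall A B, polyY A -> polyY B -> beq H (bmul A B) -> unitY A \/ unitY B.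

(* h(mu x^e) *)
Definition xsubst (h : ser) (mu : R) (e : nat) : ser := fun p =>
  if (e %| p)%N then h (p %/ e)%N * mu ^+ (p %/ e)%N else 0.
Definition bxsubst (H : bser) (mu : R) (e : nat) : bser := fun i => xsubst (H i) mu e.
(* H(x, Y) for H of y-degree <= n and Y a bivariate series *)
Definition ysubst (n : nat) (H : bser) (Y : bser) : bser :=
  \big[badd/bzero]_(i < n.+1) bmul (ofser (H i)) (bexp Y i).

Definition sord (h : ser) (v : nat) : Prop := h v != 0 /\ forall j, (j < v)%N -> h j = 0.
Definition bord (H : bser) (v : nat) : Prop :=
  (exists i, H i v != 0) /\ forall i j, (j < v)%N -> H i j = 0.
End Series.

Definition pt := (rat * rat)%type.

Definition conv (S : pt -> Prop) (p : pt) : Prop :=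
  exists l : seq (rat * pt),
    (forall w, w \in l -> S w.2 /\ 0 <= w.1) /\
    \sum_(w <- l) w.1 = 1 /\
    p = (\sum_(w <- l) w.1 * w.2.1, \sum_(w <- l) w.1 * w.2.2).

Definition lower_hull (S : pt -> Prop) (p : pt) : Prop :=
  conv S p /\ forall b, conv S (p.1, b) -> p.2 <= b.

Definition seg_pt (p1 p2 : pt) (l : rat) : pt :=
  ((1 - l) * p1.1 + l * p2.1, (1 - l) * p1.2 + l * p2.2).

Definition neg_edges (Pg : pt -> Prop) (p : pt) : Prop :=
  exists p1 p2, Pg p1 /\ Pg p2 /\ p1.1 < p2.1 /\ p2.2 < p1.2 /\
    (forall l, 0 <= l <= 1 -> Pg (seg_pt p1 p2 l)) /\
    exists2 l, 0 <= l <= 1 & p = seg_pt p1 p2 l.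

Section Newton.
Variable R : comNzRingType.
Definition NP_pts (H : bser R) (n : nat) (p : pt) : Prop :=
  exists i j, (i <= n)%N /\ sord (H i) j /\ p = (i%:Q, j%:Q).
Definition newton_polygon (H : bser R) (n : nat) : pt -> Prop := lower_hull (NP_pts H n).
Definition principal_newton_polygon (H : bser R) (n : nat) : pt -> Prop :=
  neg_edges (newton_polygon H n).
End Newton.

Section Degenerate.
Variables (K : fieldType) (L : fieldExtType K).

Definition straight (Pg : pt -> Prop) (q : nat) (m : int) : Prop :=
  exists p1 p2 : pt, p1.1 < p2.1 /\
    (forall p, Pg p <-> exists2 l, 0 <= l <= 1 & p = seg_pt p1 p2 l) /\
    (p2.2 - p1.2) * q%:Q = - (m%:~R) * (p2.1 - p1.1).

Definition irr_over (E : {subfield L}) (P : {poly L}) : Prop :=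
  (1 < size P)%N /\
  forall u v : {poly L}, u \is a polyOver E -> v \is a polyOver E -> P = u * v ->
    size u = 1%N \/ size v = 1%N.

(* the polynomial P(y^q/x^m) x^(eps m deg P), as a bivariate series
   (all exponents of x occurring are nonnegative integers) *)
Definition Pqm (P : {poly L}) (q : nat) (m : int) : bser L := fun i j =>
  let eps : int := if (0 <= m) then 1 else 0 in
  let ell : int := (size P).-1%:Z in
  \sum_(r < size P) if (i == q * r)%N && (j%:Z == eps * m * ell - m * r%:Z)
                    then P`_r else 0.

Definition degenerated (E : {subfield L}) (Pg : pt -> Prop) (H : bser L)
    (q : nat) (m : int) (P : {poly L}) (N : nat) : Prop :=
  (0 < q)%N /\ coprime q `|m| /\ straight Pg q m /\
  P \is a polyOver E /\ P \is monic /\ irr_over E P /\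
  exists2 c : L, c != 0 &
    forall i j : nat,
      (Pg (i%:Q, j%:Q) -> H i j = c * bexp (Pqm P q m) N i j) /\
      (~ Pg (i%:Q, j%:Q) -> 0 = c * bexp (Pqm P q m) N i j).

Fixpoint tower (z : nat -> L) (i : nat) : {subfield L} :=
  match i with 0 => 1%AS | i'.+1 => <<tower z i'; z i>>%AS end.

Definition inL (a : K) : L := a%:A.
Definition bmapL (H : bser K) : bser L := fun i j => inL (H i j).

Definition comp_pi (mu alpha : L) (e r : nat) (S : ser L) (n : nat) (H : bser K) : bser L :=
  ysubst n (bxsubst (bmapL H) mu e)
    (badd (bmul (bconst alpha) (bmul (bXn L r) (bY L))) (ofser S)).
End Degenerate.

Definition perfect (K : fieldType) : Prop :=
  forall p, p \in [pchar K] -> forall a : K, exists b, b ^+ p = a.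

(* Main.v *)
(** Composition with [pi_k] sends every polynomial [A] of degree less than
[deg phi_i] to [x^w] times a unit of [K_i[[x,y]]], and [phi_i] to [x^v y] times
a unit.  This is proved by induction on [i].  Substituting [sigma] in a
[phi_i]-adic expansion, the terms of minimal order carry distinct powers of
[z = z_{i+1}] with coefficients in [K_i], because [q s - m t = 1] turns the
exponent of [phi_i] modulo [q] into a shift of the exponent of [z]; fewer than
[deg P] such powers are linearly independent over [K_i], so no cancellation
occurs below degree [q ell deg phi_i].  A monic polynomial of degree
[e_i f_i] vanishing on the curve exists by Cayley-Hamilton, since [K_i[[x]]] is
free of rank [e_i f_i] over [K[[mu x^e]]]; hence [deg phi_i = e_i f_i], and the
initial form of [phi_{i+1}] is a multiple of [P_{i+1}], which has a simple root
at [z].  Consequently [F o pi_k = x^v U H_k] is also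
[sum_i x^{w_i + v} y^i U_i] with units [U_i], so that the monomials of [H_k] and
the points [(i, w_i)] generate the same ideal of exponents. *)

(* All the fields [K_i] are realized inside one extension [L]. The linear independence argument and
   the count of degrees need coefficients in [K_i], not merely in [L], so membership in [tower z i]
   is carried through every step. This is why the Weierstrass factor [G], given only over [L], has
   to be shown to be defined over [K_{i+1}]: the shift [c_{i+1}], and with it [S_{i+1}], is read off
   it.

   The assumption on the characteristic enters at one point. The coefficient of [y] in the initial
   form of [phi_{i+1}] is [q z Q'(z)] up to powers of [z], and [q] and [ell = deg Q] must be
   invertible in [L]; both are at most [d].

   Equal ideals of exponents do not by themselves give equal lower hulls, since a hull also
   remembers which abscissae it covers. Here both sets of points contain [(N_k, 0)] and have
   non-negative ordinates, so that a point can be moved to the right, along the segment towards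
   [(N_k, 0)], without rising. *)
Require Import Defs.
From HB Require Import structures.
From mathcomp Require Import all_boot all_order all_algebra all_field.
From mathcomp Require Import boolp zify ring lra.
Import Order.TTheory GRing.Theory Num.Theory.
Set Implicit Arguments. Unset Strict Implicit. Unset Printing Implicit Defensive.
Local Open Scope ring_scope.

(** * Power series *)

Section SeriesRing.
Variable R : comNzRingType.
Implicit Types A B C : ser R.

HB.instance Definition _ := gen_eqMixin (ser R).
HB.instance Definition _ := gen_choiceMixin (ser R).

Definition sadd A B : ser R := fun n => A n + B n.
Definition sopp A : ser R := fun n => - A n.
Definition szero : ser R := fun _ => 0.
Definition sone : ser R := fun n => (n == 0%N)%:R.
Definition smul A B : ser R := fun n => \sum_(j < n.+1) A j * B (n - j)%N.

Lemma saddA : associative sadd.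
Proof. by move=> A B C; apply: funext => n; rewrite /sadd addrA. Qed.
Lemma saddC : commutative sadd.
Proof. by move=> A B; apply: funext => n; rewrite /sadd addrC. Qed.
Lemma sadd0 : left_id szero sadd.
Proof. by move=> A; apply: funext => n; rewrite /sadd add0r. Qed.
Lemma saddN : left_inverse szero sopp sadd.
Proof. by move=> A; apply: funext => n; rewrite /sadd /sopp addNr. Qed.

HB.instance Definition _ := GRing.isZmodule.Build (ser R) saddA saddC sadd0 saddN.

Definition strunc n A : {poly R} := \poly_(i < n.+1) A i.

Lemma coef_strunc n A i : (i <= n)%N -> (strunc n A)`_i = A i.
Proof. by move=> le_in; rewrite coef_poly ltnS le_in. Qed.

Lemma coefM_congr_le (p p' r r' : {poly R}) n :
  (forall i, (i <= n)%N -> p`_i = p'`_i) -> (forall i, (i <= n)%N -> r`_i = r'`_i) ->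
  (p * r)`_n = (p' * r')`_n.
Proof.
move=> pp rr; rewrite !coefM; apply: eq_bigr => i _.
by rewrite pp ?rr ?leq_subr // -ltnS.
Qed.

(** A coefficient of a product only sees truncations of the factors, so the ring axioms are
    inherited from [{poly R}]. *)
Lemma smul_strunc n A B i : (i <= n)%N -> smul A B i = (strunc n A * strunc n B)`_i.
Proof.
move=> le_in; rewrite coefM; apply: eq_bigr => j _.
by rewrite !coef_strunc ?(leq_trans (leq_subr _ _)) // (leq_trans _ le_in) // -ltnS.
Qed.

Lemma smulA : associative smul.
Proof.
move=> A B C; apply: funext => n.
rewrite (@smul_strunc n) // (@smul_strunc n (smul A B)) //.
rewrite (@coefM_congr_le _ (strunc n A) _ (strunc n B * strunc n C)) //; last first.
  by move=> i le_in; rewrite coef_strunc // (@smul_strunc n).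
rewrite mulrA; apply: coefM_congr_le => // i le_in.
by rewrite coef_strunc // (@smul_strunc n).
Qed.

Lemma smulC : commutative smul.
Proof.
by move=> A B; apply: funext => n; rewrite !(@smul_strunc n) // mulrC.
Qed.

Lemma smul1 : left_id sone smul.
Proof.
move=> A; apply: funext => n; rewrite /smul big_ord_recl /sone /= mul1r subn0.
by rewrite big1 ?addr0 // => i _; rewrite mul0r.
Qed.

Lemma smulDl : left_distributive smul sadd.
Proof.
move=> A B C; apply: funext => n; rewrite /smul /sadd -big_split /=.
by apply: eq_bigr => i _; rewrite mulrDl.
Qed.

Lemma sone_neq0 : sone != 0 :> ser R.
Proof.
by apply/eqP => /(congr1 (fun h : ser R => h 0%N)) /eqP; rewrite /= oner_eq0.
Qed.

HB.instance Definition _ :=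
  GRing.Zmodule_isComNzRing.Build (ser R) smulA smulC smul1 smulDl sone_neq0.

Lemma serD A B n : (A + B) n = A n + B n. Proof. by []. Qed.
Lemma serN A n : (- A) n = - A n. Proof. by []. Qed.
Lemma ser0 n : (0 : ser R) n = 0. Proof. by []. Qed.
Lemma ser1 n : (1 : ser R) n = (n == 0%N)%:R. Proof. by []. Qed.
Lemma serM A B n : (A * B) n = \sum_(j < n.+1) A j * B (n - j)%N. Proof. by []. Qed.
Lemma serM0 A B : (A * B) 0%N = A 0%N * B 0%N.
Proof. by rewrite serM big_ord1. Qed.
Lemma ser_sum I (r : seq I) (Pr : pred I) (G : I -> ser R) n :
  (\sum_(i <- r | Pr i) G i) n = \sum_(i <- r | Pr i) G i n.
Proof. by elim/big_rec2: _ => // i x y _ <-. Qed.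

Definition sC (c : R) : ser R := fun n => (n == 0%N)%:R * c.
Definition sX : ser R := fun n => (n == 1%N)%:R.

Lemma sC_is_zmod : zmod_morphism sC.
Proof. by move=> x y; apply: funext => n; rewrite /sC serD serN mulrBr. Qed.
Lemma sC_is_monoid : monoid_morphism sC.
Proof.
split=> [|x y]; apply: funext => n; first by rewrite /sC mulr1.
rewrite serM big_ord_recl big1 /sC ?addr0 ?subn0 /=; last by move=> i _; rewrite mul0r mul0r.
by case: n => [|n]; rewrite ?mul1r ?mul0r ?mulr0.
Qed.
HB.instance Definition _ := GRing.isZmodMorphism.Build R (ser R) sC sC_is_zmod.
HB.instance Definition _ := GRing.isMonoidMorphism.Build R (ser R) sC sC_is_monoid.

Lemma serCM c A n : (sC c * A) n = c * A n.
Proof.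
rewrite serM big_ord_recl /sC /= mul1r subn0 big1 ?addr0 // => i _.
by rewrite mul0r mul0r.
Qed.

Lemma serXM A n : (sX * A) n = if n is n'.+1 then A n' else 0.
Proof.
rewrite serM; case: n => [|n]; first by rewrite big_ord1 mul0r.
rewrite big_ord_recl mul0r add0r big_ord_recl /= mul1r subSS subn0 big1 ?addr0 //.
by move=> i _; rewrite mul0r.
Qed.

Lemma serXnM e A n : (sX ^+ e * A) n = if (n < e)%N then 0 else A (n - e)%N.
Proof.
elim: e n => [|e IH] n; first by rewrite expr0 mul1r subn0.
by rewrite exprS -mulrA serXM; case: n => [|n]; rewrite ?IH ?subSS.
Qed.

Lemma serXn e n : (sX ^+ e) n = (n == e)%:R.
Proof.
rewrite -[sX ^+ e]mulr1 serXnM ser1; case: ltngtP => // ne.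
- by rewrite subn_eq0 leqNgt ne.
- by rewrite ne subnn.
Qed.

Lemma serXnMD e A n : (sX ^+ e * A) (e + n)%N = A n.
Proof. by rewrite serXnM ltnNge leq_addr addKn. Qed.

Lemma ser_divXn v A : (forall j, (j < v)%N -> A j = 0) ->
  A = sX ^+ v * (fun j => A (v + j)%N).
Proof.
move=> A0; apply: funext => j; rewrite serXnM; case: ltnP => [/A0 //|vj].
by rewrite subnKC.
Qed.

Lemma sXn_inj e : injective (fun A => sX ^+ e * A).
Proof.
move=> A B /= AB; apply: funext => n.
by rewrite -(serXnMD e A) AB serXnMD.
Qed.

Definition ser_ev0 A := A 0%N.
Lemma ser_ev0_is_zmod : zmod_morphism ser_ev0. Proof. by []. Qed.
Lemma ser_ev0_is_monoid : monoid_morphism ser_ev0.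
Proof. by split=> // A B; rewrite /ser_ev0 serM0. Qed.
HB.instance Definition _ := GRing.isZmodMorphism.Build (ser R) R ser_ev0 ser_ev0_is_zmod.
HB.instance Definition _ := GRing.isMonoidMorphism.Build (ser R) R ser_ev0 ser_ev0_is_monoid.

(* The exponent is shifted so that [xsub] is a ring morphism for every [e];
   it is the intended substitution as soon as [0 < e]. *)
Definition xsub mu e A : ser R := xsubst A mu e.-1.+1.

Lemma xsub_is_zmod mu e : zmod_morphism (xsub mu e).
Proof.
move=> A B; apply: funext => n; rewrite serD serN /xsub /xsubst.
by case: ifP; rewrite ?subr0 // serD serN mulrBl.
Qed.

Lemma xsub_is_monoid mu e : monoid_morphism (xsub mu e).
Proof.
split=> [|A B]; apply: funext => n; rewrite /xsub /xsubst.
  case: ifP => [/dvdnP[k ->]|]; last by case: n => [|n]; rewrite ?dvdn0.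
  rewrite mulnK // !ser1 muln_eq0 orbF; case: k => [|k] /=; first by rewrite mulr1.
  by rewrite mul0r.
rewrite !serM; set e' := e.-1.+1; case: ifP => [/dvdnP[k ->]|ndiv]; last first.
  rewrite big1 // => j _; case: ifP => [dj|]; last by rewrite mul0r.
  case: ifP => [dnj|]; last by rewrite mulr0.
  by rewrite -(subnK (ltnSE (ltn_ord j))) dvdn_add in ndiv.
rewrite mulnK // mulr_suml.
rewrite [RHS](bigID (fun j : 'I_ _ => (e' %| j)%N)) /= [X in _ + X]big1 ?addr0; last first.
  by move=> j /negbTE ->; rewrite mul0r.
have ltk (i : 'I_k.+1) : (i * e' < (k * e').+1)%N by rewrite ltnS leq_mul2r -ltnS ltn_ord orbT.
have ltj (j : 'I_(k * e').+1) : (j %/ e' < k.+1)%N.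
  by rewrite ltn_divLR // (leq_trans (ltn_ord j)) // mulSn addSn ltnS leq_addl.
rewrite (reindex (fun i : 'I_k.+1 => Ordinal (ltk i))) /=; last first.
  exists (fun j => Ordinal (ltj j)) => [i _|j] ; first by apply: val_inj; rewrite /= mulnK.
  by rewrite inE /= => dj; apply: val_inj; rewrite /= divnK.
apply: eq_big => [i|i _]; first by rewrite dvdn_mull.
rewrite dvdn_mull // mulnK // -mulnBl dvdn_mull // mulnK //.
by rewrite mulrACA -exprD subnKC // -ltnS.
Qed.
HB.instance Definition _ mu e :=
  GRing.isZmodMorphism.Build (ser R) (ser R) (xsub mu e) (@xsub_is_zmod mu e).
HB.instance Definition _ mu e :=
  GRing.isMonoidMorphism.Build (ser R) (ser R) (xsub mu e) (@xsub_is_monoid mu e).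

Lemma xsubE mu e A : (0 < e)%N -> xsub mu e A = xsubst A mu e.
Proof. by rewrite /xsub => /prednK ->. Qed.

Lemma xsub_ev0 mu e A : (xsub mu e A) 0%N = A 0%N.
Proof. by rewrite /xsub /xsubst dvdn0 div0n mulr1. Qed.

Lemma xsubX mu e : (0 < e)%N -> xsub mu e sX = sC mu * sX ^+ e.
Proof.
move=> e0; rewrite xsubE //; apply: funext => n; rewrite serCM serXn /xsubst /sX.
case: ifP => [/dvdnP[k ->]|ndiv].
  rewrite mulnK // -{2}[e]mul1n eqn_pmul2r //; case: eqP => [->|_]; last by rewrite mul0r mulr0.
  by rewrite mul1r mulr1.
by case: eqP ndiv => [->|]; rewrite ?dvdnn ?mulr0.
Qed.

Lemma xsubC mu e c : xsub mu e (sC c) = sC c.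
Proof.
apply: funext => n; rewrite /xsub /xsubst /sC.
case: ifP => [/dvdnP[k ->]|ndiv].
  rewrite mulnK // muln_eq0 orbF; case: k => [|k] /=; first by rewrite mulr1.
  by rewrite !mul0r.
by case: eqP ndiv => [->|]; rewrite ?dvdn0 ?mul0r.
Qed.

Lemma xsub_comp mu e nu e' A : (0 < e)%N -> (0 < e')%N ->
  xsub nu e' (xsub mu e A) = xsub (mu * nu ^+ e) (e * e') A.
Proof.
move=> e0 e'0; rewrite !xsubE ?muln_gt0 ?e0 //; apply: funext => n; rewrite /xsubst.
case: ifP => [/dvdnP[k ->]|ndiv]; last first.
  by case: ifP => // d; move: ndiv; rewrite (dvdn_trans _ d) ?dvdn_mull.
rewrite mulnK // dvdn_pmul2r //; case: ifP => [/dvdnP[l ->]|]; last by rewrite mul0r.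
rewrite mulnK // -[(l * e * e')%N]mulnA mulnK ?muln_gt0 ?e0 //.
by rewrite exprMn -exprM mulrA [(l * e)%N]mulnC.
Qed.

End SeriesRing.

Definition smap (R S : comNzRingType) (g : {rmorphism R -> S}) (h : ser R) : ser S :=
  fun n => g (h n).
Lemma smap_is_zmod (R S : comNzRingType) (g : {rmorphism R -> S}) : zmod_morphism (smap g).
Proof. by move=> A B; apply: funext => n; rewrite /smap serD serN rmorphB. Qed.
Lemma smap_is_monoid (R S : comNzRingType) (g : {rmorphism R -> S}) :
  monoid_morphism (smap g).
Proof.
split=> [|A B]; apply: funext => n; rewrite /smap ?ser1 ?rmorph_nat //.
by rewrite !serM rmorph_sum; apply: eq_bigr => i _; rewrite rmorphM.
Qed.
HB.instance Definition _ (R S : comNzRingType) (g : {rmorphism R -> S}) :=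
  GRing.isZmodMorphism.Build (ser R) (ser S) (smap g) (@smap_is_zmod R S g).
HB.instance Definition _ (R S : comNzRingType) (g : {rmorphism R -> S}) :=
  GRing.isMonoidMorphism.Build (ser R) (ser S) (smap g) (@smap_is_monoid R S g).

(** * Dictionary between [bser] and polynomials over power series *)

Lemma beq_eq (R : comNzRingType) (A B : bser R) : beq A B -> A = B.
Proof. by move=> AB; apply: funext => i; apply: funext => j; apply: AB. Qed.

Section Bridge.
Variable R : comNzRingType.
Implicit Types p Y : {poly (ser R)}.

(** Elements of [R[[x]][y]] are handled as [{poly (ser R)}], where division, composition and
    determinants are at hand. [ofB n] cuts at degree [n] in [y], hence inverts [toB] only under
    [ydeg_le A n]. *)
Definition toB p : bser R := fun i j => p`_i j.
Definition ofB n (A : bser R) : {poly (ser R)} := \poly_(i < n.+1) (A i : ser R).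

Lemma toB_inj : injective toB.
Proof.
move=> p Y pY; apply/polyP => i; apply: funext => j.
by rewrite -[p`_i j]/(toB p i j) pY.
Qed.

Lemma ofBK n A : ydeg_le A n -> toB (ofB n A) = A.
Proof.
move=> degA; apply: funext => i; apply: funext => j.
by rewrite /toB coef_poly ltnS; case: leqP => // /degA ->.
Qed.

Lemma toB_deg p n : (size p <= n.+1)%N -> ydeg_le (toB p) n.
Proof. by move=> sp i ni j; rewrite /toB nth_default // (leq_trans sp). Qed.

Lemma monicY_ofB n A : monicY A n ->
  [/\ toB (ofB n A) = A, ofB n A \is monic & size (ofB n A) = n.+1].
Proof.
case=> degA monA; have An : (A n : ser R) = 1 by apply: funext => j; rewrite monA ser1.
have sA : size (ofB n A) = n.+1 by rewrite size_poly_eq //= An oner_eq0.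
split=> //; first exact: ofBK.
by rewrite monicE lead_coefE sA /= coef_poly ltnSn An.
Qed.

Lemma toB0 : toB 0 = bzero R.
Proof. by apply: funext => i; apply: funext => j; rewrite /toB coef0. Qed.
Lemma toB1 : toB 1 = bone R.
Proof.
apply: funext => i; apply: funext => j; rewrite /toB coef1 /bone.
by case: eqP => _ //=; case: eqP.
Qed.
Lemma toBD p Y : toB (p + Y) = badd (toB p) (toB Y).
Proof. by apply: funext => i; apply: funext => j; rewrite /toB coefD. Qed.
Lemma toBM p Y : toB (p * Y) = bmul (toB p) (toB Y).
Proof.
apply: funext => i; apply: funext => j; rewrite /toB coefM ser_sum /bmul.
by apply: eq_bigr => i1 _; rewrite serM.
Qed.
Lemma toBX p n : toB (p ^+ n) = bexp (toB p) n.
Proof. by elim: n => [|n IH]; rewrite ?toB1 // exprS toBM IH. Qed.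
Lemma toB_C (h : ser R) : toB h%:P = ofser h.
Proof.
apply: funext => i; apply: funext => j; rewrite /toB /ofser coefC.
by case: eqP.
Qed.
Lemma toB_Xn n : toB (sX R ^+ n)%:P = bXn R n.
Proof.
rewrite toB_C; apply: funext => i; apply: funext => j; rewrite /ofser /bXn serXn.
by case: eqP.
Qed.
Lemma toB_Y : toB 'X = bY R.
Proof.
apply: funext => i; apply: funext => j; rewrite /toB coefX /bY.
by case: eqP => //= _; rewrite ser1.
Qed.
Lemma toB_const c : toB (sC c)%:P = bconst c.
Proof.
rewrite toB_C; apply: funext => i; apply: funext => j; rewrite /ofser /bconst /sC.
by case: eqP; rewrite ?mul0r.
Qed.
Lemma toB_sum n (G : nat -> {poly (ser R)}) :
  toB (\sum_(i < n) G i) = \big[@badd R/bzero R]_(i < n) toB (G i).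
Proof. by elim/big_rec2: _ => [|i A B _ <-]; rewrite ?toB0 ?toBD. Qed.
Lemma toB_prod n (G : nat -> {poly (ser R)}) :
  toB (\prod_(i < n) G i) = \big[@bmul R/bone R]_(i < n) toB (G i).
Proof. by elim/big_rec2: _ => [|i A B _ <-]; rewrite ?toB1 ?toBM. Qed.

Lemma toB_ysubst n p Y : (size p <= n.+1)%N ->
  ysubst n (toB p) (toB Y) = toB (p \Po Y).
Proof.
move=> sp; rewrite comp_polyE (big_ord_widen n.+1 (fun i => p`_i *: Y ^+ i) sp) big_mkcond.
rewrite (toB_sum n.+1 (fun i => if (i < size p)%N then p`_i *: Y ^+ i else 0)) /ysubst.
apply: eq_bigr => i _; rewrite -toB_C -toBX -toBM; congr toB.
rewrite -[toB p i]/(p`_i : ser R); case: ltnP => [_|sz]; first by rewrite mul_polyC.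
by rewrite nth_default ?mul0r.
Qed.

Lemma toB_bxsubst p mu e : (0 < e)%N ->
  bxsubst (toB p) mu e = toB (map_poly (xsub mu e) p).
Proof.
move=> e0; apply: funext => i; apply: funext => j.
by rewrite /toB coef_map /bxsubst [RHS]/= xsubE.
Qed.

End Bridge.

Section Pim.
Variables (R S : comNzRingType) (g : {rmorphism R -> S}) (Y : {poly S}).
(** Every substitution of the procedure has this shape: [g] acts on the series in [x] and [y] goes
    to [Y]. Composites of substitutions are then computed by [pim_comp]. *)
Definition pim (p : {poly R}) : {poly S} := map_poly g p \Po Y.
Lemma pim_is_zmod : zmod_morphism pim.
Proof. by move=> p p'; rewrite /pim rmorphB raddfB. Qed.
Lemma pim_is_monoid : monoid_morphism pim.
Proof. by split=> [|p p']; rewrite /pim ?rmorph1 // rmorphM rmorphM. Qed.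
HB.instance Definition _ := GRing.isZmodMorphism.Build _ _ pim pim_is_zmod.
HB.instance Definition _ := GRing.isMonoidMorphism.Build _ _ pim pim_is_monoid.
Lemma pimD p p' : pim (p + p') = pim p + pim p'. Proof. exact: rmorphD. Qed.
Lemma pimM p p' : pim (p * p') = pim p * pim p'. Proof. exact: rmorphM. Qed.
Lemma pimC c : pim c%:P = (g c)%:P.
Proof. by rewrite /pim map_polyC comp_polyC. Qed.
Lemma pimX : pim 'X = Y.
Proof. by rewrite /pim map_polyX comp_polyX. Qed.
End Pim.

Lemma pim_comp (R S T : comNzRingType) (g : {rmorphism R -> S}) (h : {rmorphism S -> T})
    (Y : {poly S}) (Z : {poly T}) p :
  pim h Z (pim g Y p) = pim (h \o g) (pim h Z Y) p.
Proof. by rewrite /pim map_comp_poly comp_polyA -map_poly_comp. Qed.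

(** * Initial forms *)

Section Lead.
Variable R : comNzRingType.
Implicit Types (B : {poly (ser R)}) (p : {poly R}).

Notation xx := ((sX R)%:P).
Definition ev0 B : {poly R} := map_poly (@ser_ev0 R) B.
Lemma ev0_is_zmod : zmod_morphism ev0. Proof. exact: rmorphB. Qed.
Lemma ev0_is_monoid : monoid_morphism ev0.
Proof. by split=> [|B B']; [apply: rmorph1 | apply: rmorphM]. Qed.
HB.instance Definition _ := GRing.isZmodMorphism.Build _ _ ev0 ev0_is_zmod.
HB.instance Definition _ := GRing.isMonoidMorphism.Build _ _ ev0 ev0_is_monoid.
Lemma ev0C (h : ser R) : ev0 h%:P = (h 0%N)%:P. Proof. exact: map_polyC. Qed.
Lemma ev0X : ev0 'X = 'X. Proof. exact: map_polyX. Qed.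
(** The form [p] may be zero, in which case [B] is divisible by [x^(v+1)]; sums of terms of order at
    least [v] thus need no case distinction. *)
Definition xlead B v p := exists2 B', B = xx ^+ v * B' & ev0 B' = p.

Lemma coef_ev0 B i : (ev0 B)`_i = B`_i 0%N.
Proof. by rewrite coef_map. Qed.

Lemma coef_xxM v B i j : (xx ^+ v * B)`_i j = if (j < v)%N then 0 else B`_i (j - v)%N.
Proof. by rewrite -rmorphXn coefCM serXnM. Qed.

Lemma xlead_mul B1 B2 v1 v2 p1 p2 :
  xlead B1 v1 p1 -> xlead B2 v2 p2 -> xlead (B1 * B2) (v1 + v2) (p1 * p2).
Proof.
move=> [A1 -> <-] [A2 -> <-]; exists (A1 * A2); last exact: rmorphM.
by rewrite mulrACA exprD.
Qed.
Lemma xlead_exp B v p n : xlead B v p -> xlead (B ^+ n) (n * v) (p ^+ n).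
Proof.
move=> [A -> <-]; exists (A ^+ n); last exact: rmorphXn.
by rewrite exprMn -exprM mulnC.
Qed.
Lemma xlead_add B1 B2 v p1 p2 :
  xlead B1 v p1 -> xlead B2 v p2 -> xlead (B1 + B2) v (p1 + p2).
Proof.
by move=> [A1 -> <-] [A2 -> <-]; exists (A1 + A2); rewrite ?mulrDr // rmorphD.
Qed.
Lemma xlead0 v : xlead 0 v 0.
Proof. by exists 0; rewrite ?mulr0 // rmorph0. Qed.
Lemma xlead_sum I (r : seq I) (F : I -> {poly (ser R)}) v (G : I -> {poly R}) :
  (forall i, xlead (F i) v (G i)) ->
  xlead (\sum_(i <- r) F i) v (\sum_(i <- r) G i).
Proof.
move=> FG; elim/big_rec2: _ => [|i A B _ AB]; first exact: xlead0.
exact: xlead_add.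
Qed.
Lemma xlead_shift B v v0 p : xlead B v p -> (v0 < v)%N -> xlead B v0 0.
Proof.
move=> [A -> _] lt; exists (xx ^+ (v - v0) * A).
  by rewrite mulrA -exprD subnKC // ltnW.
by rewrite rmorphM rmorphXn /= ev0C expr0n subn_eq0 leqNgt lt mul0r.
Qed.

Lemma xlead_low B v p i j : xlead B v p -> (j < v)%N -> B`_i j = 0.
Proof. by move=> [A -> _] jv; rewrite coef_xxM jv. Qed.
Lemma xlead_coef B v p i : xlead B v p -> B`_i v = p`_i.
Proof. by move=> [A -> <-]; rewrite coef_xxM ltnn subnn coef_ev0. Qed.

Lemma xleadP B v : (forall i j, (j < v)%N -> B`_i j = 0) ->
  exists2 B', B = xx ^+ v * B' & forall i j, B'`_i j = B`_i (v + j)%N.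
Proof.
move=> B0; pose f (h : ser R) : ser R := fun j => h (v + j)%N.
have cf i : (\poly_(i < size B) f B`_i)`_i = f B`_i.
  rewrite coef_poly; case: ltnP => // sz; apply: funext => j.
  by rewrite /f nth_default.
exists (\poly_(i < size B) f B`_i) => [|i j]; last by rewrite cf.
apply/polyP => i; apply: funext => j; rewrite coef_xxM cf /f.
by case: ltnP => [/B0|/subnKC] ->.
Qed.

Lemma xlead_uniq B v v' p p' : xlead B v p -> xlead B v' p' ->
  p != 0 -> (exists i, B`_i v' != 0) -> v = v' /\ p = p'.
Proof.
move=> lv lv' p0 [i Bi].
have vv' : v = v'.
  case: (ltngtP v v') => // [lt|lt].
    case/eqP: p0; apply/polyP => l; rewrite coef0 -(xlead_coef l lv).
    exact: xlead_low lv' lt.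
  by rewrite (xlead_low i lv lt) eqxx in Bi.
split=> //; subst v'; apply/polyP => l.
by rewrite -(xlead_coef l lv) -(xlead_coef l lv').
Qed.

(* The flag asserts that the initial form does not involve [y]; this is needed
   for substituting [sigma] when [m = 0], which only happens at the first step. *)
Definition lead (fl : bool) B v lam :=
  exists p, [/\ xlead B v p, p`_0 = lam & fl -> p = lam%:P].

Lemma leadW fl B v lam : lead fl B v lam -> B`_0 v = lam.
Proof. by case=> p [lB <- _]; rewrite (xlead_coef 0 lB). Qed.

End Lead.

Lemma xlead_bord (R : comNzRingType) (B : {poly (ser R)}) v w p :
  xlead B v p -> p != 0 -> bord (toB B) w -> v = w.
Proof.
move=> lB p0 [[i Bi] B0]; have [B' BE _] := xleadP (B0 : forall i j, _).
by have [] := @xlead_uniq _ B v w p (ev0 B') lB (ex_intro2 _ _ B' BE erefl) p0 (ex_intro _ i Bi).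
Qed.

Section Rho.
Variables (L : fieldType) (z : L) (q m t s : nat) (c : ser L).
Hypotheses (q0 : (0 < q)%N) (c0 : c 0%N = 0).

Notation xx := ((sX L)%:P).

Lemma ev0_xx v : ev0 (xx ^+ v) = (v == 0%N)%:R.
Proof. by rewrite rmorphXn /= ev0C /sX /= expr0n. Qed.

(* [rho] is the composition with [sigma o tau] of one step of the procedure. *)
Definition rhoY : {poly (ser L)} := xx ^+ m * ('X + (c + sC (z ^+ s))%:P).
Definition rho : {poly (ser L)} -> {poly (ser L)} := pim (xsub (z ^+ t) q) rhoY.
HB.instance Definition _ := GRing.RMorphism.copy rho (pim (xsub (z ^+ t) q) rhoY).

Lemma rhoM A B : rho (A * B) = rho A * rho B. Proof. exact: rmorphM. Qed.

Lemma rho_xx v : rho (xx ^+ v) = (sC ((z ^+ t) ^+ v))%:P * xx ^+ (q * v).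
Proof.
have -> : rho (xx ^+ v) = rho xx ^+ v by exact: rmorphXn.
have -> : rho xx = (xsub (z ^+ t) q (sX L))%:P by exact: pimC.
have -> : sC ((z ^+ t) ^+ v) = sC (z ^+ t) ^+ v by exact: rmorphXn.
by rewrite xsubX // polyCM exprMn -!polyC_exp -exprM.
Qed.

Lemma ev0_rho B : ev0 (rho B) = ev0 B \Po ev0 rhoY.
Proof.
rewrite /rho /pim /ev0 map_comp_poly -map_poly_comp; congr (_ \Po _).
by apply: eq_map_poly => h /=; rewrite /ser_ev0 xsub_ev0.
Qed.

Lemma ev0_rhoY : ev0 rhoY = (m == 0%N)%:R * ('X + (z ^+ s)%:P).
Proof.
rewrite rmorphM /= ev0_xx; congr (_ * _).
by rewrite rmorphD /= ev0X ev0C serD c0 add0r /sC mul1r.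
Qed.

(** At [x = 0] the image of [y] is zero when [m > 0], so only the constant term of [p] survives;
    when [m = 0] the flag ensures that [p] is constant. *)
Lemma comp_rhoY fl (p : {poly L}) lam : fl || (0 < m)%N -> p`_0 = lam ->
  (fl -> p = lam%:P) -> p \Po ev0 rhoY = lam%:P.
Proof.
move=> flm p0 pfl; case: fl flm pfl => [_ /(_ isT) ->|m0 _]; first by rewrite comp_polyC.
rewrite ev0_rhoY; case: m m0 => // ? _.
by rewrite mul0r comp_poly0r p0.
Qed.

Lemma rho_lead fl B v lam : fl || (0 < m)%N -> lead fl B v lam ->
  xlead (rho B) (q * v) ((z ^+ t) ^+ v * lam)%:P.
Proof.
move=> flm [p [[B' -> evB] p0 pfl]].
exists ((sC ((z ^+ t) ^+ v))%:P * rho B').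
  by rewrite rmorphM /= rho_xx mulrCA mulrA.
by rewrite rmorphM /= ev0_rho evB (comp_rhoY flm p0 pfl) ev0C /sC mul1r polyCM.
Qed.

Lemma rho_leadX fl u v lam : fl || (0 < m)%N -> lead fl u 0 lam ->
  xlead (rho (xx ^+ v * 'X * u)) (q * v + m)
    (((z ^+ t) ^+ v * lam)%:P * ('X + (z ^+ s)%:P)).
Proof.
move=> flm lu; rewrite mulrAC rmorphM; apply: xlead_mul.
  apply: (@rho_lead fl) => //; case: lu => p [[u' -> evu] p0 pfl].
  by exists p; split=> //; exists u'; rewrite ?expr0 ?mul1r.
exists ('X + (c + sC (z ^+ s))%:P); first exact: pimX.
by rewrite rmorphD /= ev0X ev0C serD c0 add0r /sC mul1r.
Qed.

End Rho.

(** Here [u] is the order of the term with [phi^b] before the substitution, [W] its order afterwards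
    and [t * u + s * b] the exponent of [z] it acquires. For fixed [W] this exponent determines
    [b]. *)
Lemma bezout_digit q m t s W b u : (0 < q)%N -> (q * s = m * t + 1)%N ->
  (q * u + b * m = W)%N -> (q * (t * u + s * b) = t * W + b)%N.
Proof. by move=> q0 qs <-; rewrite mulnDr !mulnA qs; lia. Qed.

(** Raising [b = bt + q y] by [q] raises the exponent of [z] by one. The subtraction of natural
    numbers is exact, since [q y1 <= q c1]. *)
Lemma digit_shift q c1 c2 y1 y2 X bt : (0 < q)%N ->
  (q * c1 = X + (bt + q * y1))%N -> (q * c2 = X + (bt + q * y2))%N ->
  c2 = (c1 - y1 + y2)%N.
Proof.
move=> q0 e1 e2; have le1 : (y1 <= c1)%N by rewrite -(leq_pmul2l q0) e1; lia.
by apply/eqP; rewrite -(eqn_pmul2l q0) mulnDr mulnBr e1 e2; apply/eqP; lia.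
Qed.

Lemma modn_eq_of q c1 c2 X b1 b2 :
  (q * c1 = X + b1)%N -> (q * c2 = X + b2)%N -> b2 = b1 %[mod q].
Proof.
move=> e1 e2; have: (q * c1 + b2 = q * c2 + b1)%N by rewrite e1 e2; lia.
by move/(congr1 (modn^~ q)); rewrite ![(q * _)%N]mulnC !modnMDl.
Qed.

Section CoreStep.
Variables (K : fieldType) (L : fieldExtType K) (E : {subfield L}).
Variables (z : L) (q m t s : nat) (c : ser L).
Hypotheses (q0 : (0 < q)%N) (c0 : c 0%N = 0) (z0 : z != 0).
Hypothesis qs1 : (q * s = m * t + 1)%N.
Variables (n : nat) (fl : bool) (nz : pred nat).
Variables (A : nat -> {poly (ser L)}) (w : nat -> nat) (lam : nat -> L).
Variables (u : {poly (ser L)}) (v : nat) (lam0 : L).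
Hypothesis flm : fl || (0 < m)%N.
Hypothesis A0 : forall b, (b < n)%N -> ~~ nz b -> A b = 0.
Hypothesis A1 : forall b, (b < n)%N -> nz b ->
  [/\ lead fl (A b) (w b) (lam b), lam b != 0 & lam b \in E].
Hypothesis u0 : lead fl u 0 lam0.
Hypotheses (lam00 : lam0 != 0) (lam0E : lam0 \in E).
Variable b0 : nat.
Hypotheses (b0n : (b0 < n)%N) (nzb0 : nz b0).

Let rh := rho z q m t s c.
Let phi := (sX L)%:P ^+ v * 'X * u.
Let ww b := (q * w b + b * (q * v + m))%N.

(* A term of minimal order [W] with digit [b] satisfies [q u + b m = W]; hence
   [b = bt + q r] with [bt] fixed, and it carries the factor [z ^ (C + r)].  The
   value at [y = 0] of the initial form is thus [z ^ C * Q(z)]. *)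
Lemma core_step : exists W (Q : {poly L}) bt C p,
  [/\ xlead (\sum_(b < n) rh (A b) * rh phi ^+ b) W p,
      (exists b, [/\ (b < n)%N, nz b & W = ww b]) /\
      (forall b, (b < n)%N -> nz b -> (W <= ww b)%N),
      [/\ Q != 0, Q \is a polyOver E, (bt < q)%N &
        forall r, Q`_r != 0 -> (bt + q * r < n)%N],
      p`_0 = z ^+ C * Q.[z] &
      z ^+ s * p`_1 = z ^+ C * (bt%:R * Q.[z] + q%:R * (z * (Q^`()).[z]))].
Proof.
pose x0 := Ordinal b0n.
pose nzo (b : 'I_n) := nz b; have nzx0 : nzo x0 by [].
case: (@arg_minnP _ x0 nzo (fun b => ww b) nzx0) => b1; rewrite /nzo => nzb1 minb1.
pose W := ww b1; pose att b := nz b && (ww b == W).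
pose kap b := if att b then lam b * lam0 ^+ b else 0.
pose Cb b := (t * (w b + v * b) + s * b)%N.
have qCb b : att b -> (q * Cb b = t * W + b)%N.
  by case/andP=> _ /eqP <-; apply: (@bezout_digit q m) => //; rewrite /ww; lia.
have attb1 : att b1 by rewrite /att nzb1 eqxx.
pose bt := (b1 %% q)%N; pose C := (Cb b1 - b1 %/ q)%N.
have btE b : att b -> (b = bt + q * (b %/ q))%N.
  move=> ab; have: (b %% q = bt)%N by apply: modn_eq_of (qCb _ attb1) (qCb _ ab).
  by move=> <-; rewrite mulnC addnC -divn_eq.
have CbE b : att b -> Cb b = (C + b %/ q)%N.
  move=> ab; have e1 := qCb _ attb1; have e2 := qCb _ ab.
  by apply: (digit_shift q0) (_ : _ = t * W + (bt + q * _))%N _; rewrite -btE; eassumption.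
pose Q : {poly L} := \sum_(b < n) kap b *: 'X^(b %/ q).
(* Indices of minimal order share the residue [bt] modulo [q], so at most one of them has quotient
   [r]: each coefficient of [Q] is a single [kap b] and nothing cancels inside [Q]. *)
have coefQ r : Q`_r != 0 -> exists b : 'I_n, [/\ att b, (b %/ q)%N = r & Q`_r = kap b].
  have QE : Q`_r = \sum_(b < n | (b %/ q)%N == r) kap b.
    rewrite coef_sum [RHS]big_mkcond; apply: eq_bigr => b _.
    rewrite coefZ coefXn eq_sym; case: eqP => _; by rewrite ?mulr1 ?mulr0.
  rewrite {1}QE => Q0.
  have [[b [br ab]]|no] := pselect (exists b : 'I_n, (b %/ q)%N = r /\ att b); last first.
    case/eqP: Q0; apply: big1 => b /eqP br; rewrite /kap; case: ifP => // ab.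
    by case: no; exists b.
  exists b; split=> //; rewrite QE (bigD1 b) ?br //= big1 ?addr0 // => b' /andP[/eqP b'r bb'].
  rewrite /kap; case: ifP => // ab'; case/eqP: bb'; apply: val_inj => /=.
  by rewrite (btE _ ab) (btE _ ab') br b'r.
have Qb1 : Q`_(b1 %/ q) != 0.
  rewrite coef_sum (bigD1 b1) //= coefZ coefXn eqxx mulr1 big1 ?addr0 => [|b bb1].
    have [_ l1 _] := A1 (ltn_ord b1) nzb1.
    by rewrite /kap attb1 mulf_neq0 // expf_neq0.
  rewrite coefZ coefXn /kap; case: ifP => ab; last by rewrite mul0r.
  case: eqP => e; last by rewrite mulr0.
  by case/eqP: bb1; apply: val_inj => /=; rewrite (btE _ ab) (btE _ attb1) e.
(* The initial form of the [b]-th term seen at order [W]: terms of larger order contribute zero. *)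
pose tm b : {poly L} := if att b then
   ((z ^+ t) ^+ w b * lam b)%:P * (((z ^+ t) ^+ v * lam0)%:P * ('X + (z ^+ s)%:P)) ^+ b
   else 0.
pose p := \sum_(b < n) tm b.
have tm_lead (b : 'I_n) : xlead (rh (A b) * rh phi ^+ b) W (tm b).
  rewrite /tm; case nzb: (nz b); last first.
    have rh0 : rh 0 = 0 by exact: rmorph0.
    by rewrite /att nzb A0 ?nzb // rh0 mul0r; apply: xlead0.
  have [lA _ _] := A1 (ltn_ord b) nzb.
  have : xlead (rh (A b) * rh phi ^+ b) (ww b) (((z ^+ t) ^+ w b * lam b)%:P *
      (((z ^+ t) ^+ v * lam0)%:P * ('X + (z ^+ s)%:P)) ^+ b).
    apply: xlead_mul; first by apply: (@rho_lead _ z q m t s c q0 c0 fl).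
    by apply: xlead_exp; apply: (@rho_leadX _ z q m t s c q0 c0 fl).
  rewrite /att nzb /=; case: eqP => [-> //|neq] lw.
  apply: (xlead_shift lw); rewrite ltn_neqAle; apply/andP; split; last exact: minb1.
  by apply/eqP => e; case: neq.
have tmE (b : 'I_n) : tm b =
    (kap b * z ^+ (t * (w b + v * b)))%:P * ('X + (z ^+ s)%:P) ^+ b.
  rewrite /tm /kap; case: ifP => _; last by rewrite mul0r mul0r.
  rewrite exprMn -polyC_exp mulrA -polyCM; congr (_%:P * _).
  rewrite exprMn -!exprM mulnDr exprD mulnA.
  by rewrite mulrACA [RHS]mulrC.
exists W, Q, bt, C, p; split.
- exact: xlead_sum.
- by split; [exists b1 | move=> b bn nzb; apply: (minb1 (Ordinal bn))].
- split.
  + by apply: contra_neq Qb1 => ->; rewrite coef0.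
  + apply: rpred_sum => b _; apply: polyOverZ; last by rewrite rpredX ?polyOverX.
    rewrite /kap; case: ifP => [/andP[nzb _]|_]; last exact: rpred0.
    by have [_ _ lE] := A1 (ltn_ord b) nzb; rewrite rpredM ?rpredX.
  + exact: ltn_pmod.
  + by move=> r /coefQ[b [ab <- _]]; rewrite -btE.
- rewrite -horner_coef0 horner_sum horner_sum mulr_sumr; apply: eq_bigr => b _.
  rewrite tmE hornerM hornerC horner_exp hornerD hornerX hornerC add0r hornerZ hornerXn.
  case: (boolP (att b)) => ab; last by rewrite /kap (negbTE ab) !mul0r mulr0.
  by rewrite [RHS]mulrCA -exprD -CbE // /Cb exprD (exprM z s) mulrA.
(* The coefficient of [y] is read as a derivative at 0. The factor [z ^+ s] on the left restores
   [(z^s)^b] from [(z^s)^(b-1)], and splitting the factor [b] as [bt + q (b %/ q)] yields the terms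
   in [Q] and in [Q']. *)
- have -> : p`_1 = (p^`()).[0] by rewrite horner_coef0 coef_deriv mulr1n.
  rewrite /p [deriv _]raddf_sum horner_sum [Q^`()]raddf_sum !horner_sum !mulr_sumr.
  rewrite -big_split /= mulr_sumr; apply: eq_bigr => b _.
  case: (boolP (att b)) => ab; last first.
    rewrite /tm (negbTE ab) deriv0 horner0 /kap (negbTE ab) scale0r deriv0 !horner0.
    by rewrite !(mulr0, addr0).
  rewrite tmE mul_polyC derivZ hornerZ deriv_exp derivD derivX derivC addr0 mul1r.
  rewrite hornerMn horner_exp hornerD hornerX hornerC add0r derivZ derivXn !hornerZ.
  rewrite hornerMn !hornerXn.
  have e1 : z ^+ s * (z ^+ s ^+ b.-1 *+ b) = z ^+ s ^+ b *+ b.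
    by case: (nat_of_ord b) => [|b']; rewrite ?mulr0n ?mulr0 // mulrnAr -exprS.
  have e2 : z * (z ^+ (b %/ q).-1 *+ (b %/ q)) = z ^+ (b %/ q) *+ (b %/ q).
    by case: (b %/ q)%N => [|b']; rewrite ?mulr0n ?mulr0 // mulrnAr -exprS.
  rewrite [X in _ = z ^+ C * (_ + q%:R * X)]mulrCA e2 mulrCA e1.
  have -> : kap b * z ^+ (t * (w b + v * b)) * (z ^+ s ^+ b *+ b) = kap b * z ^+ Cb b *+ b.
    by rewrite /Cb exprD (exprM z s) mulrnAr mulrA.
  rewrite CbE // exprD [X in _ *+ X = _](btE _ ab) mulrnDr mulrnA.
  rewrite mulrDr !mulr_natl mulrnAr !mulrnAr mulrCA; congr (_ + _).
  by rewrite mulrnAC.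
Qed.

End CoreStep.

(** * Monic polynomials vanishing on a parametrized curve *)

(** The determinant trick: multiply [(y - A) b = 0] by the adjugate matrix. *)
Lemma char_poly_annihilates (R R' : comNzRingType) (g : {rmorphism R -> R'}) n
    (M : 'M[R]_n) (b : 'cV[R']_n) (y : R') :
  map_mx g M *m b = y *: b -> (map_poly g (char_poly M)).[y] *: b = 0.
Proof.
move=> Mb; rewrite map_char_poly /char_poly; set A := map_mx g M.
have -> : (\det (char_poly_mx A)).[y] = \det (y%:M - A).
  rewrite -[LHS]/(horner_eval y _) -det_map_mx; congr (\det _).
  by apply/matrixP => i j; rewrite !mxE /= /horner_eval hornerD hornerN hornerC hornerMn hornerX.
by rewrite -mul_scalar_mx -mul_adj_mx -mulmxA mulmxBl Mb mul_scalar_mx subrr mulmx0.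
Qed.

Section Iota.
Variables (K : fieldType) (L : fieldExtType K).

Definition iota_ser (mu : L) (e : nat) : {rmorphism ser K -> ser L} :=
  xsub mu e \o smap (in_alg L).

(* [{h in E[[x]]}] is spanned over [K[[mu x^e]]] by the products of the powers
   [x^a], [a < e], with a basis of [E]; multiplication by [S] is then given by a
   square matrix of size [e * \dim E]. *)
Lemma exists_vanishing (E : {subfield L}) (mu : L) e (S : ser L) :
  (0 < e)%N -> mu != 0 -> mu \in E -> (forall j, S j \in E) ->
  exists psi : {poly (ser K)}, [/\ psi \is monic, size psi = (e * \dim E).+1 &
    (map_poly (iota_ser mu e) psi).[S] = 0].
Proof.
move=> e0 mu0 muE SE; set f : nat := \dim E; set n := (e * f)%N.
have f0 : (0 < f)%N by rewrite adim_gt0.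
pose th k := (vbasis E)`_k.
have thE k : (k < f)%N -> th k \in E.
  by move=> kf; apply/vbasis_mem/mem_nth; rewrite size_tuple.
pose bb j : ser L := sC (th (j %% f)%N) * sX L ^+ (j %/ f).
have span (h : ser L) : (forall j, h j \in E) ->
    exists a : nat -> ser K, h = \sum_(j < n) iota_ser mu e (a j) * bb j.
  move=> hE.
  pose cf k (y : L) : K := if insub k is Some i then coord (vbasis E) (i : 'I_f) y else 0.
  have cfE y : y \in E -> y = \sum_(i < f) cf i y *: th i.
    move=> /coord_vbasis {1}->; apply: eq_bigr => i _.
    by rewrite /cf valK.
  (* The index [j] stands for the product of the basis element [j %% f] with [x^(j %/ f)]. Since
     [x^p] becomes [mu^p x^(e p)], the coefficient of [x^(e p + j %/ f)] is divided by [mu^p] before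
     its coordinate is taken. *)
  pose a j : ser K := fun p => cf (j %% f)%N (h (e * p + j %/ f)%N / mu ^+ p).
  exists a; apply: funext => p; rewrite ser_sum.
  have term j : (j < n)%N -> (iota_ser mu e (a j) * bb j) p =
      if (j %/ f == p %% e)%N then
        (cf (j %% f)%N (h p / mu ^+ (p %/ e)) *: th (j %% f)%N) * mu ^+ (p %/ e) else 0.
    move=> jn; have je : (j %/ f < e)%N by rewrite ltn_divLR.
    rewrite mulrC -mulrA serCM serXnM /= xsubE // /xsubst /smap /a.
    case: ltnP => [pj|jp].
      case: eqP => [ej|_]; last by rewrite mulr0.
      by move: pj; rewrite ej ltnNge leq_mod.
    have -> : (e %| p - j %/ f)%N = (j %/ f == p %% e)%N.
      by rewrite -eqn_mod_dvd // (modn_small je) eq_sym.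
    case: eqP => [ej|_]; last by rewrite mulr0.
    have -> : ((p - j %/ f) %/ e = p %/ e)%N.
      by rewrite ej {1}(divn_eq p e) addnK mulnK.
    have -> : (e * (p %/ e) + j %/ f)%N = p by rewrite ej mulnC -divn_eq.
    by rewrite mulrA -[X in _ = X * _]mulr_algl [X in X * _ = _]mulrC.
  rewrite (eq_bigr _ (fun (j : 'I_n) _ => term j (ltn_ord j))).
  set y := h p / mu ^+ (p %/ e).
  have yE : y \in E by rewrite /y rpred_div ?rpredX.
  have -> : h p = y * mu ^+ (p %/ e) by rewrite mulfVK // expf_neq0.
  rewrite {1}(cfE y yE) mulr_suml.
  have ltp : (p %% e < e)%N by rewrite ltn_mod.
  have lt1 (i : 'I_f) : ((p %% e) * f + i < n)%N.
    by apply: (@leq_trans (((p %% e).+1) * f)); [rewrite mulSn addnC ltn_add2r | rewrite leq_mul2r ltp orbT].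
  rewrite -big_mkcond /= (reindex (fun i : 'I_f => Ordinal (lt1 i))) /=; last first.
    exists (fun j : 'I_n => Ordinal (ltn_pmod j f0)) => [i _|j].
      by apply: val_inj; rewrite /= modnMDl modn_small.
    by rewrite inE => /eqP ej; apply: val_inj => /=; rewrite -ej -divn_eq.
  apply: eq_big => [i|i _]; first by rewrite divnMDl // divn_small // addn0 eqxx.
  by rewrite modnMDl modn_small.
have Sb j : (j < n)%N -> exists a : nat -> ser K, S * bb j = \sum_(k < n) iota_ser mu e (a k) * bb k.
  move=> jn; apply: span => p; rewrite mulrCA serCM rpredM //.
    by rewrite thE // ltn_mod.
  by rewrite [S * _]mulrC serXnM; case: ifP => _; rewrite ?SE ?rpred0.
have [a aP] : exists a : nat -> nat -> ser K, forall j, (j < n)%N ->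
    S * bb j = \sum_(k < n) iota_ser mu e (a j k) * bb k.
  have /choice[a aP] : forall j, exists a : nat -> ser K, (j < n)%N ->
      S * bb j = \sum_(k < n) iota_ser mu e (a k) * bb k.
    move=> j; case: (ltnP j n) => [/Sb[a aP]|_]; first by exists a.
    by exists (fun _ => 0).
  by exists a.
pose M : 'M[ser K]_n := \matrix_(j, k) a j k.
pose b : 'cV[ser L]_n := \col_j bb j.
have := @char_poly_annihilates _ _ (iota_ser mu e) n M b S _.
have Mb : map_mx (iota_ser mu e) M *m b = S *: b.
  apply/matrixP => j k; rewrite !mxE aP //.
  by apply: eq_bigr => l _; rewrite !mxE.
move=> /(_ Mb) vb; exists (char_poly M); split; rewrite ?char_poly_monic ?size_char_poly //.
have n0 : (0 < n)%N by rewrite muln_gt0 e0.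
(* The generator of index 0 is a nonzero constant, so the first row alone gives the vanishing at
   [S]. *)
have := congr1 (fun N : 'cV_n => N (Ordinal n0) 0) vb; rewrite !mxE /bb /=.
rewrite mod0n div0n expr0 mulr1 => v0.
have th0 : th 0%N != 0.
  by apply: (free_not0 (X := vbasis E)); [exact: basis_free (vbasisP E) | rewrite mem_nth ?size_tuple].
apply: funext => p; move/(congr1 (fun h : ser L => h p)): v0.
by rewrite mulrC serCM ser0 => /eqP; rewrite mulf_eq0 (negbTE th0) => /eqP.
Qed.

End Iota.

Section MonicDivision.
Variable R : comNzRingType.
Implicit Types A phi psi : {poly R}.

(** Iterated division by the monic [phi]; the bound [n * D] on the size leaves exactly [n]
    digits. *)
Lemma base_expansion D phi n A : phi \is monic -> size phi = D.+1 ->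
  (size A <= n * D)%N ->
  exists a : nat -> {poly R}, A = \sum_(b < n) a b * phi ^+ b /\
    forall b, (size (a b) <= D)%N.
Proof.
move=> mphi sphi; elim: n A => [|n IH] A sA.
  exists (fun _ => 0); split=> [|b]; last by rewrite size_poly0.
  by rewrite big_ord0; apply/eqP; rewrite -size_poly_leq0.
set Q := Pdiv.Ring.rdivp A phi; set r := Pdiv.Ring.rmodp A phi.
have AE : A = Q * phi + r by apply: Pdiv.RingMonic.rdivp_eq.
have sr : (size r <= D)%N by rewrite -ltnS -sphi Pdiv.Ring.ltn_rmodp monic_neq0.
have sQ : (size Q <= n * D)%N.
  case: (eqVneq Q 0) => [->|Q0]; first by rewrite size_poly0.
  have : (size (Q * phi)%R <= n.+1 * D)%N.
    have -> : Q * phi = A - r by rewrite AE addrK.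
    rewrite (leq_trans (size_polyD _ _)) // size_polyN geq_max sA.
    by rewrite (leq_trans sr) // mulSn leq_addr.
  by rewrite size_Mmonic // sphi addnS /= mulSn addnC leq_add2l.
have [a [QE sa]] := IH Q sQ.
exists (fun b => if b is b'.+1 then a b' else r); split=> [|[|b]] //.
rewrite big_ord_recl expr0 mulr1 addrC {1}AE; congr (_ + _).
rewrite QE mulr_suml; apply: eq_bigr => b _.
by rewrite /= exprSr mulrA.
Qed.

Lemma monic_size1_eq1 (A : {poly R}) : A \is monic -> (size A <= 1)%N -> A = 1.
Proof.
move=> mA sA; rewrite (size1_polyC sA); move: mA; rewrite monicE lead_coefE.
by case: (size A) sA => [|[|k]] //= _ /eqP ->; rewrite polyC1.
Qed.

Lemma monic_unit (A B : {poly R}) : A \is monic -> A * B = 1 -> A = 1.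
Proof.
move=> mA AB; have B0 : B != 0.
  by apply: contra_eq_neq AB => ->; rewrite mulr0 eq_sym oner_neq0.
have := size_monicM mA B0; rewrite AB size_poly1 => e.
apply: monic_size1_eq1 => //.
by move: B0 e; rewrite -size_poly_gt0; lia.
Qed.

End MonicDivision.

(** Modulo [psi], the polynomial [phi] leaves a remainder of degree less than [n] killed by [h],
    hence zero. Irreducibility of [phi] then makes the monic quotient a unit, since [psi] has
    positive degree. *)
Lemma irred_eq_of_vanishing (R T : comNzRingType) (h : {rmorphism {poly (ser R)} -> T}) n
    (phi psi : {poly (ser R)}) :
  (0 < n)%N -> (forall A : {poly (ser R)}, (size A <= n)%N -> h A = 0 -> A = 0) ->
  psi \is monic -> size psi = n.+1 -> h psi = 0 ->
  phi \is monic -> irredY (toB phi) -> h phi = 0 -> phi = psi.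
Proof.
move=> n0 hinj mpsi spsi hpsi mphi [_ [_ [_ irr]]] hphi.
set Q := Pdiv.Ring.rdivp phi psi; set r := Pdiv.Ring.rmodp phi psi.
have phiE : phi = Q * psi + r by apply: Pdiv.RingMonic.rdivp_eq.
have r0 : r = 0.
  apply: hinj; first by rewrite -ltnS -spsi Pdiv.Ring.ltn_rmodp monic_neq0.
  by move: hphi; rewrite {1}phiE rmorphD rmorphM hpsi mulr0 add0r.
rewrite r0 addr0 in phiE.
have mQ : Q \is monic by rewrite -(monicMr Q mpsi) -phiE.
have polB (A : {poly (ser R)}) : polyY (toB A).
  by exists (size A); apply: toB_deg.
have unitB (A : {poly (ser R)}) : A \is monic -> unitY (toB A) -> A = 1.
  move=> mA [B [[k degB] /beq_eq AB]]; apply: (monic_unit (B := ofB k B)) mA _.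
  by apply: toB_inj; rewrite toBM ofBK // AB toB1.
have [|uQ|upsi] := irr (toB Q) (toB psi) (polB _) (polB _).
- by rewrite phiE toBM.
- by rewrite phiE (unitB _ mQ uQ) mul1r.
- by move: spsi; rewrite (unitB _ mpsi upsi) size_poly1 => -[nE]; rewrite -nE in n0.
Qed.

(** * Adjoining a root of [P] to the residue field *)

Section Adjoin.
Variables (K : fieldType) (L : fieldExtType K) (E : {subfield L}) (P : {poly L}) (z : L).
Hypotheses (PE : P \is a polyOver E) (mP : P \is monic) (irP : irr_over E P) (rPz : root P z).
Let ell := (size P).-1.

Lemma irr_minPoly : P = minPoly E z.
Proof.
have dv : minPoly E z %| P by apply: minPoly_dvdp.
have PQ := divpK dv; set Q := P %/ _ in PQ.
have [_ irr] := irP.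
have [sQ|sm] := irr Q (minPoly E z) (divp_polyOver PE (minPolyOver E z)) (minPolyOver E z) (esym PQ).
  have mQ : Q \is monic by rewrite -(monicMr Q (monic_minPoly E z)) PQ.
  by rewrite -PQ (monic_size1_eq1 mQ) ?mul1r // sQ.
by move: sm; rewrite size_minPoly.
Qed.

Lemma irr_degree : ell = adjoin_degree E z.
Proof. by rewrite /ell irr_minPoly size_minPoly. Qed.

(** Linear independence over [E] of the powers of [z] below [ell], which is what prevents
    cancellation of initial forms. *)
Lemma horner_small_neq0 Q : Q \is a polyOver E -> Q != 0 -> (size Q <= ell)%N -> Q.[z] != 0.
Proof.
move=> QE Q0 sQ; apply/negP => rQ.
have := dvdp_leq Q0 (minPoly_dvdp QE rQ).
by rewrite size_minPoly -irr_degree ltnNge sQ.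
Qed.

Lemma horner_root_size Q : Q \is a polyOver E -> Q != 0 -> (size Q <= ell.+1)%N -> Q.[z] = 0 ->
  Q`_ell != 0.
Proof.
move=> QE Q0 sQ Qz; have sE : size Q = ell.+1.
  apply/eqP; rewrite eqn_leq sQ ltnNge; apply/negP => /(horner_small_neq0 QE Q0).
  by rewrite Qz eqxx.
by rewrite -[ell]/(ell.+1.-1) -sE -lead_coefE lead_coef_eq0.
Qed.

(** The degree of [Q] is exactly [ell], so [Q'] has the nonzero coefficient [ell * Q_ell] and degree
    less than [ell]; it cannot vanish at [z]. *)
Lemma horner_deriv_neq0 Q : Q \is a polyOver E -> Q != 0 -> (size Q <= ell.+1)%N ->
  Q.[z] = 0 -> ell%:R != 0 :> L -> Q^`().[z] != 0.
Proof.
move=> QE Q0 sQ Qz ell0; have Ql := horner_root_size QE Q0 sQ Qz.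
have l0 : (0 < ell)%N by rewrite irr_degree.
apply: horner_small_neq0.
- by apply/polyOverP => i; rewrite coef_deriv rpredMn // (polyOverP QE).
- apply: contra_neq (mulf_neq0 Ql ell0) => Q'0.
  have := congr1 (fun p : {poly L} => p`_ell.-1) Q'0.
  by rewrite coef_deriv coef0 prednK // mulr_natr.
- by rewrite -ltnS (leq_trans (lt_size_deriv Q0)).
Qed.

Lemma irr_dim : \dim <<E; z>> = (ell * \dim E)%N.
Proof. by rewrite dim_Fadjoin irr_degree. Qed.

End Adjoin.

Lemma natr_neq0_le (K : fieldType) (L : fieldExtType K) d n :
  (forall p, p \in [pchar K] -> (d < p)%N) -> (0 < n)%N -> (n <= d)%N -> n%:R != 0 :> L.
Proof.
move=> hp n0 nd; rewrite natf_neq0_pchar; apply/pnatP => // p prp pn.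
rewrite inE /= pchar_lalg; apply/negP => /hp.
by rewrite ltnNge (leq_trans (dvdn_leq n0 pn)).
Qed.

(** * Series with coefficients in an intermediate field *)

Section Over.
Variables (K : fieldType) (L : fieldExtType K) (E : {subfield L}).

Definition overS (h : ser L) := forall n, h n \in E.
Definition overB (A : bser L) := forall i j, A i j \in E.

Lemma overS_mul (g h : ser L) : overS g -> overS h -> overS (g * h).
Proof. by move=> gE hE n; rewrite serM rpred_sum // => i _; rewrite rpredM. Qed.
Lemma overS_add (g h : ser L) : overS g -> overS h -> overS (g + h).
Proof. by move=> gE hE n; rewrite serD rpredD. Qed.
Lemma overS_opp (g : ser L) : overS g -> overS (- g).
Proof. by move=> gE n; rewrite serN rpredN. Qed.
Lemma overS_sum I (r : seq I) (Pr : pred I) (G : I -> ser L) :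
  (forall i, Pr i -> overS (G i)) -> overS (\sum_(i <- r | Pr i) G i).
Proof. by move=> GE n; rewrite ser_sum rpred_sum // => i /GE; apply. Qed.
Lemma overS_Xn n : overS (sX L ^+ n).
Proof. by move=> j; rewrite serXn rpred_nat. Qed.
Lemma overS_xsub h mu e : overS h -> mu \in E -> overS (xsub mu e h).
Proof.
by move=> hE muE n; rewrite /xsub /xsubst; case: ifP => _; rewrite ?rpred0 // rpredM ?rpredX.
Qed.

Lemma overB_mul A B : overB A -> overB B -> overB (bmul A B).
Proof.
move=> AE BE i j; rewrite /bmul rpred_sum // => i1 _.
by rewrite rpred_sum // => j1 _; rewrite rpredM.
Qed.
Lemma overB_add A B : overB A -> overB B -> overB (badd A B).
Proof. by move=> AE BE i j; rewrite rpredD. Qed.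
Lemma overB_const a : a \in E -> overB (bconst a).
Proof. by move=> aE i j; rewrite rpredM ?rpred_nat. Qed.
Lemma overB_Xn n : overB (bXn L n).
Proof. by move=> i j; rewrite rpred_nat. Qed.
Lemma overB_Y : overB (bY L).
Proof. by move=> i j; rewrite rpred_nat. Qed.
Lemma overB_ofser h : overS h -> overB (ofser h).
Proof. by move=> hE i j; rewrite /ofser; case: ifP => _; rewrite ?rpred0. Qed.
Lemma overB_exp A n : overB A -> overB (bexp A n).
Proof.
move=> AE; elim: n => [|n IH]; last exact: overB_mul.
by move=> i j; rewrite rpred_nat.
Qed.
Lemma overB_ysubst n A Y : overB A -> overB Y -> overB (ysubst n A Y).
Proof.
move=> AE YE; rewrite /ysubst; elim/big_rec: _ => [|i B _ BE]; first by move=> i j; rewrite rpred0.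
apply: overB_add => //; apply: overB_mul; last exact: overB_exp.
by apply: overB_ofser => j; apply: AE.
Qed.
Lemma overB_bxsubst A mu e : overB A -> mu \in E -> overB (bxsubst A mu e).
Proof.
move=> AE muE i j; rewrite /bxsubst /xsubst; case: ifP => _; rewrite ?rpred0 // rpredM ?rpredX //.
Qed.

End Over.

Lemma overB_sub (K : fieldType) (L : fieldExtType K) (E E' : {subfield L}) A :
  (E <= E')%VS -> overB E A -> overB E' A.
Proof. by move=> EE' AE i j; apply: (subvP EE'). Qed.

(** * Rationality of Weierstrass factors *)

Section Weierstrass.
Variables (L : fieldType) (U G : bser L) (N : nat).
Hypotheses (mG : monicY G N) (G0 : forall l, (l < N)%N -> G l 0%N = 0).

(* Columns are series in [y], so that the product becomes a convolution in [x]. *)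
Let col (A : bser L) (j : nat) : ser L := fun i => A i j.

Lemma col_mul A B j : col (bmul A B) j = \sum_(j1 < j.+1) col A j1 * col B (j - j1).
Proof.
apply: funext => i; rewrite ser_sum /col /bmul exchange_big /=.
by apply: eq_bigr => j1 _; rewrite serM.
Qed.

Lemma col_G0 : col G 0 = sX L ^+ N.
Proof.
have [degG monG] := mG.
apply: funext => i; rewrite serXn /col; case: ltngtP => [/G0|/degG|->] //.
Qed.

(** By induction on the exponent [j] of [x]: the column [j] of [U G] is [y^N] times that of [U],
    plus products of earlier columns of [U], of degree at most [n], with columns of [G], of degree
    at most [N]. In particular [U] is a polynomial in [y]. *)
Lemma weierstrass_quotient_deg n : ydeg_le (bmul U G) n -> ydeg_le U n.
Proof.
move=> degA; have [degG _] := mG.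
suff hU j : forall i, (n < i)%N -> U i j = 0 by move=> i ni j; apply: hU.
elim/ltn_ind: j => j IH i ni.
have : col (bmul U G) j (i + N)%N = 0 by apply: degA; rewrite ltn_addr.
rewrite col_mul ser_sum big_ord_recr /= subnn col_G0 mulrC addnC serXnMD big1 ?add0r //.
move=> j1 _; rewrite serM big1 // => i1 _; rewrite /col.
case: (ltnP n i1) => [ni1|i1n]; first by rewrite (IH j1) ?mul0r.
by rewrite degG ?mulr0 //; lia.
Qed.

End Weierstrass.

Section WeierstrassOver.
Variables (K : fieldType) (L : fieldExtType K) (E : {subfield L}).
Variables (U G : bser L) (N : nat).
Hypotheses (mG : monicY G N) (G0 : forall l, (l < N)%N -> G l 0%N = 0).
Hypotheses (U00 : U 0%N 0%N != 0) (AE : overB E (bmul U G)).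

Let col (A : bser L) (j : nat) : ser L := fun i => A i j.

(** The columns of [U] and [G] are determined successively by those of the product. In column [j],
    the term [U_j y^N] is invisible below degree [N], where [U_0 G_j] can be solved for [G_j]
    because [U_0] has nonzero constant term; then [U_j] is obtained by dividing by [y^N]. *)
Lemma weierstrass_over : overB E G.
Proof.
have [degG monG] := mG.
suff H j : overS E (col U j) /\ overS E (col G j) by move=> i j; have [_] := H j; apply.
have shiftE h : overS E (sX L ^+ N * h) -> overS E h.
  by move=> hE n; rewrite -(serXnMD N h).
have cG0 : col G 0 = sX L ^+ N := col_G0 mG G0.
elim/ltn_ind: j => j IH; have cA : col (bmul U G) j = \sum_(j1 < j.+1) col U j1 * col G (j - j1)%N := col_mul U G j.
have cAE : overS E (col (bmul U G) j) by move=> i; apply: AE.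
case: j => [|j] in IH cA cAE *.
  have GE : overS E (col G 0) by rewrite cG0; apply: overS_Xn.
  split=> //; apply: shiftE; rewrite mulrC -cG0.
  by move: cAE; rewrite cA big_ord1.
have [U0E G0E] := IH 0%N isT.
rewrite big_ord_recl big_ord_recr /= subn0 subSS subnn cG0 in cA.
set rest := \sum_(i < j) _ in cA.
have restE : overS E rest.
  apply: overS_sum => i _; apply: overS_mul.
    by have [] := IH (bump 0 i); rewrite // /bump /= add1n !ltnS.
  by have [] := IH (j.+1 - bump 0 i)%N; rewrite // /bump /= add1n subSS ltnS leq_subr.
have UGE i : (i < N)%N -> (col U 0 * col G j.+1) i \in E.
  move=> iN; have := congr1 (fun h : ser L => h i) cA.
  rewrite serD serD [col U _ * sX L ^+ N]mulrC serXnM iN addr0 => e.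
  have -> : (col U 0 * col G j.+1) i = col (bmul U G) j.+1 i - rest i by rewrite e addrK.
  by rewrite rpredB.
have GE : overS E (col G j.+1).
  elim/ltn_ind => i IHi; case: (ltngtP i N) => [iN|Ni|->]; last 2 first.
  - by rewrite /col degG ?rpred0.
  - by rewrite /col monG rpred_nat.
  have := UGE i iN; rewrite serM big_ord_recl subn0 => sE.
  have : U 0%N 0%N * G i j.+1 \in E.
    rewrite -[X in X \in _](addrK (\sum_(i1 < i) col U 0 (bump 0 i1) * col G j.+1 (i - bump 0 i1)%N)).
    rewrite rpredB // rpred_sum // => i1 _; rewrite rpredM // IHi //.
    by rewrite /bump add1n; have := ltn_ord i1; lia.
  by rewrite fpredMl //; apply: (U0E 0%N).
split=> //; apply: shiftE; rewrite mulrC.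
have -> : col U j.+1 * sX L ^+ N = col (bmul U G) j.+1 - (col U 0 * col G j.+1 + rest).
  by rewrite cA addrA [_ + (_ * sX L ^+ N)]addrC addrK.
by apply: overS_add => //; apply: overS_opp; apply: overS_add => //; apply: overS_mul.
Qed.

End WeierstrassOver.

(** * Newton polygons *)

Section Convex.
Implicit Types (S : pt -> Prop) (p : pt).

Lemma conv_pt S p : S p -> conv S p.
Proof.
move=> Sp; exists [:: (1, p)]; split; first by move=> w; rewrite inE => /eqP -> /=.
by rewrite !big_seq1 !mul1r; split=> //; case: p {Sp}.
Qed.

Lemma conv_seg S p1 p2 l : conv S p1 -> conv S p2 -> 0 <= l <= 1 -> conv S (seg_pt p1 p2 l).
Proof.
move=> [l1 [S1 [e1 ->]]] [l2 [S2 [e2 ->]]] /andP[l0 l1'].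
exists ([seq ((1 - l) * w.1, w.2) | w <- l1] ++ [seq (l * w.1, w.2) | w <- l2]); split.
  move=> w; rewrite mem_cat => /orP[] /mapP[w' w'l ->] /=.
    by have [Sw w0] := S1 w' w'l; rewrite mulr_ge0 ?subr_ge0.
  by have [Sw w0] := S2 w' w'l; rewrite mulr_ge0.
rewrite !big_cat !big_map /= /seg_pt /= -!mulr_sumr e1 e2 !mulr1 subrK; split=> //.
by congr (_, _); rewrite !mulr_sumr; congr (_ + _); apply: eq_bigr => w _; rewrite mulrA.
Qed.

Lemma conv_lin S a b c p : (forall s : pt, S s -> c <= a * s.1 + b * s.2) -> conv S p ->
  c <= a * p.1 + b * p.2.
Proof.
move=> Sc [l [Sl [el ->]]] /=.
have -> : c = \sum_(w <- l) w.1 * c by rewrite -mulr_suml el mul1r.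
rewrite !mulr_sumr -big_split /= big_seq_cond [X in _ <= X]big_seq_cond.
apply: ler_sum => w; rewrite andbT => /Sl[/Sc cw w0].
by rewrite (mulrCA a) (mulrCA b) -mulrDr ler_wpM2l.
Qed.

Lemma conv_dominate S1 S2 p :
  (forall s, S1 s -> exists2 s', S2 s' & s'.1 <= s.1 /\ s'.2 <= s.2) -> conv S1 p ->
  exists2 p', conv S2 p' & p'.1 <= p.1 /\ p'.2 <= p.2.
Proof.
move=> dom [l [Sl [el ->]]].
have /choice[g gP] : forall s : pt, exists s' : pt, S1 s -> [/\ S2 s', s'.1 <= s.1 & s'.2 <= s.2].
  move=> s; case: (pselect (S1 s)) => [/dom[s' ? []]|no]; first by exists s'.
  by exists s.
exists (\sum_(w <- l) w.1 * (g w.2).1, \sum_(w <- l) w.1 * (g w.2).2) => /=.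
  exists [seq (w.1, g w.2) | w <- l]; split; last by rewrite !big_map.
  by move=> w /mapP[w' /Sl[Sw w0] ->] /=; have [] := gP _ Sw.
split; rewrite big_seq_cond [X in _ <= X]big_seq_cond; apply: ler_sum => w;
  rewrite andbT => /Sl[/gP[_ l1 l2] w0]; exact: ler_wpM2l.
Qed.

(** Domination produces a point [p'] to the left of [p] and not above it. The segment from [p'] to
    [(N, 0)] meets the vertical line through [p] at height [(1 - l) p'.2], which is at most [p'.2]
    as ordinates are non-negative. *)
Lemma conv_below S1 S2 (N : rat) p :
  (forall s, S1 s -> s.1 <= N) -> (forall s, S1 s -> 0 <= s.2) ->
  (forall s, S2 s -> 0 <= s.2) -> S2 (N, 0) ->
  (forall s, S1 s -> exists2 s', S2 s' & s'.1 <= s.1 /\ s'.2 <= s.2) -> conv S1 p ->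
  exists2 b, conv S2 (p.1, b) & b <= p.2.
Proof.
move=> le1 ge1 ge2 S2N dom cp; have [p' cp' [l1 l2]] := conv_dominate dom cp.
have p1N : p.1 <= N.
  have := @conv_lin S1 (-1) 0 (- N) p _ cp; rewrite mul0r; case: p {cp l1 l2} => /= x y H.
  suff : - N <= -1 * x + 0 by lra.
  by apply: H => s /le1; lra.
have p'0 : 0 <= p'.2.
  have := @conv_lin S2 0 1 0 p' _ cp'; case: p' {cp' l1 l2} => /= x y H.
  suff : 0 <= 0 * x + 1 * y by lra.
  by apply: H => s /ge2; lra.
case: (ltrP p'.1 N) => [p'N|Np']; last first.
  have e : p'.1 = p.1 by apply/eqP; rewrite eq_le l1 (le_trans p1N).
  by exists p'.2 => //; rewrite -e; case: p' cp' {l1 l2 p'0 Np' e}.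
pose l := (p.1 - p'.1) / (N - p'.1).
have d0 : 0 < N - p'.1 by rewrite subr_gt0.
have l01 : 0 <= l <= 1.
  apply/andP; split; first by apply: divr_ge0; rewrite ?subr_ge0 // ltW.
  by rewrite ler_pdivrMr // mul1r lerD2r.
exists ((1 - l) * p'.2).
  have := conv_seg cp' (conv_pt S2N) l01; rewrite /seg_pt /= mulr0 addr0.
  suff -> : (1 - l) * p'.1 + l * N = p.1 by [].
  have -> : (1 - l) * p'.1 + l * N = p'.1 + l * (N - p'.1) by ring.
  by rewrite mulfVK ?gt_eqF // addrC subrK.
apply: le_trans l2; case/andP: l01 => l0 l1'.
by rewrite -[X in _ <= X]mul1r ler_wpM2r // gerBl.
Qed.

(** [conv_below], used in both directions, makes the two lower boundaries bound each other at every
    abscissa. *)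
Lemma lower_hull_sub S1 S2 (N : rat) p :
  (forall s, S1 s -> s.1 <= N) -> (forall s, S2 s -> s.1 <= N) ->
  (forall s, S1 s -> 0 <= s.2) -> (forall s, S2 s -> 0 <= s.2) ->
  S1 (N, 0) -> S2 (N, 0) ->
  (forall s, S1 s -> exists2 s', S2 s' & s'.1 <= s.1 /\ s'.2 <= s.2) ->
  (forall s, S2 s -> exists2 s', S1 s' & s'.1 <= s.1 /\ s'.2 <= s.2) ->
  lower_hull S1 p -> lower_hull S2 p.
Proof.
move=> le1 le2 ge1 ge2 S1N S2N d12 d21 [cp minp].
have [b cb bp] := conv_below le1 ge1 ge2 S2N d12 cp.
have H b' : conv S2 (p.1, b') -> p.2 <= b'.
  move=> cb'; have [b'' cb'' /= le] := conv_below le2 ge2 ge1 S1N d21 cb'.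
  exact: le_trans (minp _ cb'') le.
split=> //; have e : b = p.2 by apply/eqP; rewrite eq_le bp H.
by move: cb; rewrite e; case: p {cp minp bp H e}.
Qed.

Lemma lower_hull_eq S1 S2 (N : rat) p :
  (forall s, S1 s -> s.1 <= N) -> (forall s, S2 s -> s.1 <= N) ->
  (forall s, S1 s -> 0 <= s.2) -> (forall s, S2 s -> 0 <= s.2) ->
  S1 (N, 0) -> S2 (N, 0) ->
  (forall s, S1 s -> exists2 s', S2 s' & s'.1 <= s.1 /\ s'.2 <= s.2) ->
  (forall s, S2 s -> exists2 s', S1 s' & s'.1 <= s.1 /\ s'.2 <= s.2) ->
  lower_hull S1 p <-> lower_hull S2 p.
Proof. by move=> *; split; apply: (@lower_hull_sub _ _ N). Qed.

End Convex.

Lemma sord_exists (R : comNzRingType) (h : ser R) j : h j != 0 -> exists2 v, sord h v & (v <= j)%N.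
Proof.
move=> hj; have ex : exists j, h j != 0 by exists j.
exists (ex_minn ex); case: ex_minnP => v hv minv; last exact: minv.
by split=> // i iv; apply/eqP; apply: contraTT iv => /minv; rewrite -leqNgt.
Qed.

Lemma sord_uniq (R : comNzRingType) (h : ser R) v v' : sord h v -> sord h v' -> v = v'.
Proof.
move=> [hv v0] [hv' v'0]; case: (ltngtP v v') => // lt.
- by rewrite v'0 ?eqxx in hv.
- by rewrite v0 ?eqxx in hv'.
Qed.

Section FirstEdge.
Variables (R : comNzRingType) (H : bser R) (n : nat).

(** Turns a polygon with two distinct abscissae into explicit vertices carrying nonzero coefficients
    of [H]. The first is the leftmost point; the second minimizes the slope seen from it, so that
    the line through both is a supporting line. *)
Lemma first_edge : (exists p1 p2 : pt, [/\ conv (NP_pts H n) p1, conv (NP_pts H n) p2 & p1.1 < p2.1]) ->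
  exists i1 j1 i2 j2 : nat, [/\ (i1 < i2)%N, (i2 <= n)%N, sord (H i1) j1, sord (H i2) j2 &
    (forall i j, (i <= n)%N -> sord (H i) j -> (i1 <= i)%N /\
       (j2%:Q - j1%:Q) * (i%:Q - i1%:Q) <= (j%:Q - j1%:Q) * (i2%:Q - i1%:Q)) /\
    forall l, 0 <= l <= 1 -> newton_polygon H n (seg_pt (i1%:Q, j1%:Q) (i2%:Q, j2%:Q) l)].
Proof.
move=> [p1 [p2 [c1 c2 lt12]]].
(* The value 0 is a default for vanishing coefficients of [H]; [nzi] singles out the indices where
   [v] is the true order. *)
have /choice[v vP] : forall i, exists v, (exists j, H i j != 0) -> sord (H i) v.
  move=> i; case: (pselect (exists j, H i j != 0)) => [[j /sord_exists[v ? _]]|no].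
    by exists v.
  by exists 0%N.
pose nzi i := (i <= n)%N /\ sord (H i) (v i).
have nziP i j : (i <= n)%N -> sord (H i) j -> nzi i /\ j = v i.
  move=> lei sj; have sv : sord (H i) (v i) by apply: vP; exists j; case: sj.
  by split=> //; apply: sord_uniq sj sv.
have [i0 n0] : exists i, nzi i.
  apply: contrapT => no; case: c1 => [[|w l] [Sl [el _]]].
    by move: el; rewrite big_nil => /eqP; rewrite eq_sym oner_eq0.
  have [[i [j [li [sj _]]]] _] := Sl w (mem_head _ _).
  by case: no; exists i; have [] := nziP i j li sj.
have ex1 : exists i, `[< nzi i >] by exists i0; apply/asboolP.
pose i1 := ex_minn ex1; have [n1 min1] : nzi i1 /\ forall i, nzi i -> (i1 <= i)%N.
  by rewrite /i1; case: ex_minnP => i /asboolP ni mi; split=> // k nk; apply: mi; apply/asboolP.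
have [i2' [n2' lt2']] : exists i, nzi i /\ (i1 < i)%N.
  apply: contrapT => no.
  have cst p : conv (NP_pts H n) p -> p.1 = i1%:Q.
    move=> cp; have st s : NP_pts H n s -> s.1 = i1%:Q.
      move=> [i [j [li [sj ->]]]] /=; have [ni _] := nziP i j li sj.
      suff -> : i = i1 by []; apply/eqP; rewrite eqn_leq min1 // andbT leqNgt; apply/negP => lt.
      by case: no; exists i.
    have := @conv_lin _ 1 0 i1%:Q p _ cp; have := @conv_lin _ (-1) 0 (- i1%:Q) p _ cp.
    move=> /(_ ltac:(by move=> s /st ->; lra)) h1 /(_ ltac:(by move=> s /st ->; lra)).
    lra.
  by move: lt12; rewrite (cst _ c1) (cst _ c2) ltxx.
pose sl i : rat := ((v i)%:Q - (v i1)%:Q) / (i%:Q - i1%:Q).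
pose Pi (i : 'I_n.+1) := `[< nzi i >] && (i1 < i)%N.
have [i2 /andP[/asboolP n2 lt2] min2] : exists2 i2 : 'I_n.+1, Pi i2 &
    forall i : 'I_n.+1, Pi i -> sl i2 <= sl i.
  have lt : (i2' < n.+1)%N by case: n2'.
  have P0 : Pi (Ordinal lt) by rewrite /Pi lt2' andbT; apply/asboolP.
  by case: (@Order.TotalTheory.arg_minP _ _ _ (Ordinal lt) Pi (fun i : 'I__ => sl i) P0) => i Pi_i mi; exists i.
have posI (a b : nat) : (a < b)%N -> 0 < b%:Q - a%:Q :> rat.
  by move=> ab; rewrite subr_gt0 ltr_int.
have line i j : (i <= n)%N -> sord (H i) j -> (i1 <= i)%N /\
    ((v i2)%:Q - (v i1)%:Q) * (i%:Q - i1%:Q) <= (j%:Q - (v i1)%:Q) * (i2%:Q - i1%:Q).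
  move=> li sj; have [ni ->] := nziP i j li sj; split; first exact: min1.
  have : (i1 <= i)%N by apply: min1.
  rewrite leq_eqVlt => /orP[/eqP <-|lt]; first by rewrite !subrr mulr0 mul0r.
  have := min2 (Ordinal (li : (i < n.+1)%N)) _; rewrite /Pi /= lt andbT.
  move=> /(_ ltac:(by apply/asboolP)); rewrite /sl ler_pdivrMr ?posI //.
  by rewrite mulrAC ler_pdivlMr ?posI.
exists i1, (v i1), i2, (v i2); split=> //.
- by case: n2.
- by case: n1.
- by case: n2.
split=> // l l01; have S1 : NP_pts H n (i1%:Q, (v i1)%:Q) by exists i1, (v i1); case: n1.
have S2 : NP_pts H n (i2%:Q, (v i2)%:Q) by exists i2, (v i2); case: n2.
split; first by apply: conv_seg => //; apply: conv_pt.
move=> b cb; set a1 := (v i1)%:Q in S1 *; set a2 := (v i2)%:Q in S2 *.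
have d0 := posI _ _ lt2.
(* The supporting line written as a linear inequality, so that [conv_lin] extends it from the points
   to their convex hull. *)
have h1 s : NP_pts H n s -> a1 * (i2%:Q - i1%:Q) - (a2 - a1) * i1%:Q <=
    - (a2 - a1) * s.1 + (i2%:Q - i1%:Q) * s.2.
  by move=> [i [j [li [sj ->]]]] /=; have [_] := line i j li sj; rewrite -/a1 -/a2; nra.
have h := conv_lin h1 cb; rewrite /seg_pt /= in h *.
have : ((1 - l) * a1 + l * a2) * (i2%:Q - i1%:Q) <= b * (i2%:Q - i1%:Q) by nra.
by rewrite ler_pM2r.
Qed.

End FirstEdge.

(** * Boundary polynomials and the data of an edge *)

Section BoundaryPolynomial.
Variables (K : fieldType) (L : fieldExtType K) (P : {poly L}) (q m : nat).
Hypotheses (q0 : (0 < q)%N) (mP : P \is monic).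
Let ell := (size P).-1.

(** This is [x^(m ell) P(y^q / x^m)], the case [m >= 0] of [Pqm]; [ell - r] is exact because
    [r <= ell] for every index of the sum. *)
Definition Pqm_poly : {poly (ser L)} :=
  \sum_(r < size P) (sC P`_r * sX L ^+ (m * (ell - r)))%:P * 'X^(q * r).

Lemma toB_Pqm : toB Pqm_poly = Pqm P q m%:Z.
Proof.
apply: funext => i; apply: funext => j; rewrite /toB /Pqm_poly /Pqm coef_sum ser_sum.
apply: eq_bigr => r _; rewrite coefCM coefXn.
have rl : (r <= ell)%N by rewrite -ltnS prednK ?ltn_ord // size_poly_gt0 monic_neq0.
have -> : (j%:Z == (if 0 <= m%:Z then 1 else 0) * m%:Z * ell%:Z - m%:Z * r%:Z) = (j == m * (ell - r))%N.
  rewrite (_ : (0 <= m%:Z) = true) // mul1r -!PoszM.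
  by rewrite subzn ?leq_mul2l ?rl ?orbT // -mulnBr.
case: (i == q * r)%N; last by rewrite mulr0 ser0.
by rewrite mulr1 serCM serXn /=; case: eqP; rewrite ?mulr1 ?mulr0.
Qed.

Lemma Pqm_poly_monic : Pqm_poly \is monic /\ size Pqm_poly = (q * ell).+1.
Proof.
have sP : size P = ell.+1 by rewrite prednK // size_poly_gt0 monic_neq0.
have -> : Pqm_poly = 'X^(q * ell) +
    \sum_(r < ell) (sC P`_r * sX L ^+ (m * (ell - r)))%:P * 'X^(q * r).
  pose F r : {poly (ser L)} := (sC P`_r * sX L ^+ (m * (ell - r)))%:P * 'X^(q * r).
  have -> : Pqm_poly = \sum_(r < ell.+1) F r by rewrite -sP.
  rewrite big_ord_recr /= addrC {1}/F; congr (_ + _).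
  have -> : P`_ell = 1 by apply/eqP; rewrite -monicE // /lead_coef.
  rewrite subnn muln0 expr0 mulr1.
  have -> : sC (1 : L) = 1 by exact: rmorph1.
  by rewrite mul1r.
set Q := \sum_(r < _) _.
have sQ : (size Q < size ('X^(q * ell) : {poly (ser L)}))%N.
  rewrite size_polyXn ltnS; apply: (leq_trans (size_sum _ _ _)); apply/bigmax_leqP => r _.
  rewrite mul_polyC (leq_trans (size_scale_leq _ _)) // size_polyXn.
  by rewrite -[X in (X < _)%N]addn0 -addnS; have := ltn_ord r; nia.
by rewrite monicE lead_coefDl // lead_coefXn size_polyDl // size_polyXn.
Qed.

(** The pure power [y^(q ell N)] occurs in the boundary polynomial; its point therefore lies on the
    polygon, which bounds [q ell N]. *)
Lemma bexp_Pqm_top N : bexp (Pqm P q m%:Z) N (q * ell * N)%N 0%N = 1.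
Proof.
have [mPp sPp] := Pqm_poly_monic; rewrite -toB_Pqm -toBX /toB.
have mPN : Pqm_poly ^+ N \is monic by apply: rpredX.
have sPN : size (Pqm_poly ^+ N) = (q * ell * N).+1.
  elim: N {mPN} => [|N IH]; first by rewrite expr0 size_poly1 muln0.
  by rewrite exprS size_monicM // ?monic_neq0 ?rpredX // sPp IH addSn /= addnS mulnS.
by move: mPN; rewrite monicE lead_coefE sPN /= => /eqP ->.
Qed.

Lemma bexp_Pqm_X N i j : P = 'X -> bexp (Pqm P q m%:Z) N i j != 0 -> i = (q * N)%N.
Proof.
move=> PX; rewrite -toB_Pqm -toBX /toB.
have -> : Pqm_poly = 'X^q.
  rewrite /Pqm_poly /ell PX size_polyX big_ord_recl big_ord1 /= !coefX /=.
  have -> : sC (0 : L) = 0 by exact: rmorph0.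
  have -> : sC (1 : L) = 1 by exact: rmorph1.
  by rewrite !mul0r add0r subnn muln0 mulr1 mul1r muln1.
by rewrite -exprM coefXn; case: (i =P _) => // _; rewrite eqxx.
Qed.

End BoundaryPolynomial.

Section Degenerated.
Variables (K : fieldType) (L : fieldExtType K) (E : {subfield L}).
Variables (Pg : pt -> Prop) (H : bser L) (n q m : nat) (P : {poly L}) (N : nat) (z : L).
Hypotheses (deg : degenerated E Pg H q m%:Z P N) (rPz : root P z).
Hypothesis PgN : forall p, Pg p -> newton_polygon H n p.
Hypothesis edge : forall i1 j1 i2 j2 : nat, (i1 < i2)%N -> (i2 <= n)%N ->
  sord (H i1) j1 -> sord (H i2) j2 ->
  (forall i j, (i <= n)%N -> sord (H i) j -> (i1 <= i)%N /\
     (j2%:Q - j1%:Q) * (i%:Q - i1%:Q) <= (j%:Q - j1%:Q) * (i2%:Q - i1%:Q)) ->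
  (forall l, 0 <= l <= 1 -> newton_polygon H n (seg_pt (i1%:Q, j1%:Q) (i2%:Q, j2%:Q) l)) ->
  Pg (i1%:Q, j1%:Q) /\ Pg (i2%:Q, j2%:Q).

(** The hypothesis [edge] treats the whole and the principal polygon alike: it puts the two ends of
    the first edge on [Pg]. Both then lie in the support of the boundary polynomial, at different
    abscissae. This excludes [N = 0], where that polynomial is constant, and [P = X], where it is a
    monomial; so [z] is nonzero. *)
Lemma degenerated_facts :
  [/\ z != 0, (0 < N)%N, (q * (size P).-1 * N <= n)%N &
   exists i1 j1 i2 j2 : nat, [/\ (i1 < i2)%N, (i2 <= n)%N, sord (H i1) j1, sord (H i2) j2 &
    (forall i j, (i <= n)%N -> sord (H i) j ->
     (j2%:Q - j1%:Q) * (i%:Q - i1%:Q) <= (j%:Q - j1%:Q) * (i2%:Q - i1%:Q)) /\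
    (j2%:Q - j1%:Q) * q%:Q = - m%:Q * (i2%:Q - i1%:Q)]].
Proof.
have [q0 [_ [[p1 [p2 [lt12 [PgE slope]]]] [PE [mP [irP [c c0 bd]]]]]]] := deg.
have Pg1 : Pg p1.
  by apply/PgE; exists 0; rewrite ?lexx ?ler01 // /seg_pt subr0 !mul1r !mul0r !addr0; case: (p1).
have Pg2 : Pg p2.
  by apply/PgE; exists 1; rewrite ?lexx ?ler01 // /seg_pt subrr !mul1r !mul0r !add0r; case: (p2).
have [c1 _] := PgN Pg1; have [c2 _] := PgN Pg2.
have [|i1 [j1 [i2 [j2 [lt le2 s1 s2 [line seg]]]]]] := @first_edge _ H n.
  by exists p1, p2.
have [PA PB] := edge lt le2 s1 s2 line seg.
have nzb i j : sord (H i) j -> Pg (i%:Q, j%:Q) -> bexp (Pqm P q m%:Z) N i j != 0.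
  by move=> [hj _] /(proj1 (bd i j)) e; apply: contraNneq hj => b0; rewrite e b0 mulr0.
split.
- apply/eqP => z0; have PX : P = 'X.
    rewrite (irr_minPoly PE mP irP rPz) z0.
    have E0 : 0 \in E by rewrite rpred0.
    by move/minPoly_XsubC: E0 => ->; rewrite subr0.
  have := bexp_Pqm_X mP PX (nzb _ _ s1 PA); have := bexp_Pqm_X mP PX (nzb _ _ s2 PB).
  by move=> e2 e1; rewrite e1 e2 ltnn in lt.
- rewrite lt0n; apply/eqP => N0; have bone0 i j : sord (H i) j -> Pg (i%:Q, j%:Q) -> i = 0%N.
    by move=> sj /(nzb _ _ sj); rewrite N0 /bexp /= /bone; case: (i =P 0%N) => // _; rewrite eqxx.
  by rewrite (bone0 _ _ s1 PA) (bone0 _ _ s2 PB) in lt.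
- have [PgT|no] := pselect (Pg ((q * (size P).-1 * N)%N%:Q, 0%N%:Q)).
    have [cT _] := PgN PgT.
    have := @conv_lin _ (-1) 0 (- n%:Q) _ _ cT => /= h.
    have : - n%:Q <= -1 * (q * (size P).-1 * N)%N%:Q + 0 * 0%N%:Q.
      apply: h => s [i [j [li [_ ->]]]] /=.
      have : i%:Q <= n%:Q by rewrite ler_int lez_nat.
      lra.
    rewrite mulN1r mul0r addr0 lerN2 ler_int lez_nat //.
  have := (proj2 (bd _ _) no); rewrite bexp_Pqm_top // mulr1 => e.
  by rewrite -e eqxx in c0.
- exists i1, j1, i2, j2; split=> //; split; first by move=> i j li sj; have [] := line i j li sj.
  have /PgE[l1 _ [e1 f1]] := PA; have /PgE[l2 _ [e2 f2]] := PB.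
  rewrite e1 f1 e2 f2 /=.
  transitivity ((l2 - l1) * ((p2.2 - p1.2) * q%:Q)); first by ring.
  by rewrite slope; ring.
Qed.

End Degenerated.

Lemma degenerated_first (K : fieldType) (L : fieldExtType K) (E : {subfield L})
    (H : bser L) (n q m : nat) (P : {poly L}) (N : nat) (z : L) :
  degenerated E (newton_polygon H n) H q m%:Z P N -> root P z ->
  [/\ z != 0, (0 < N)%N & (q * (size P).-1 * N <= n)%N].
Proof.
move=> deg rPz; have [] // := degenerated_facts (n := n) deg rPz (fun p h => h).
move=> i1 j1 i2 j2 lt le2 s1 s2 line seg; split.
  by have := seg 0; rewrite lexx ler01 /seg_pt subr0 !mul1r !mul0r !addr0; apply.
by have := seg 1; rewrite lexx ler01 /seg_pt subrr !mul1r !mul0r !add0r; apply.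
Qed.

(** The leftmost vertex has positive ordinate because [H] is Weierstrass, and [(n, 0)] is not below
    the supporting line of the first edge. Hence this edge descends strictly: it belongs to the
    principal polygon, and [m > 0]. *)
Lemma degenerated_principal (K : fieldType) (L : fieldExtType K) (E : {subfield L})
    (H : bser L) (n q m : nat) (P : {poly L}) (N : nat) (z : L) :
  monicY H n -> (forall i, (i < n)%N -> H i 0%N = 0) ->
  degenerated E (principal_newton_polygon H n) H q m%:Z P N -> root P z ->
  [/\ z != 0, (0 < N)%N, (q * (size P).-1 * N <= n)%N & (0 < m)%N].
Proof.
move=> [_ monH] H0 deg rPz.
have sn : sord (H n) 0 by split=> //; rewrite monH oner_eq0.
have neg (i1 j1 i2 j2 : nat) : (i1 < i2)%N -> (i2 <= n)%N -> sord (H i1) j1 ->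
    (forall i j, (i <= n)%N -> sord (H i) j ->
     (j2%:Q - j1%:Q) * (i%:Q - i1%:Q) <= (j%:Q - j1%:Q) * (i2%:Q - i1%:Q)) ->
    i1%:Q < i2%:Q :> rat /\ j2%:Q < j1%:Q :> rat.
  move=> lt le2 [s1 _] line; have := line n 0%N (leqnn n) sn.
  have i1n : (i1 < n)%N by apply: leq_trans le2.
  have j1p : (0 < j1)%N.
    by rewrite lt0n; apply: contraNneq s1 => ->; rewrite H0.
  have a1 : i1%:Q < i2%:Q :> rat by rewrite ltr_int.
  have a2 : i1%:Q < n%:Q :> rat by rewrite ltr_int.
  have a3 : 0 < j1%:Q :> rat by rewrite ltr0z.
  move=> h; split=> //; rewrite ltNge; apply/negP => le.
  have : 0 <= (j2%:Q - j1%:Q) * (n%:Q - i1%:Q) by rewrite mulr_ge0 // subr_ge0 // ltW.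
  have : (0%N%:Q - j1%:Q) * (i2%:Q - i1%:Q) < 0 by rewrite nmulr_rlt0 ?subr_gt0 // sub0r oppr_lt0.
  lra.
have [||z0 N0 qn [i1 [j1 [i2 [j2 [lt le2 s1 s2 [line sl]]]]]]] := @degenerated_facts _ _ _ _ _ n _ _ _ _ _ deg rPz.
- by move=> p [p1 [p2 [_ [_ [_ [_ [seg [l l01 ->]]]]]]]]; apply: seg.
- move=> i1 j1 i2 j2 lt le2 s1 s2 line seg.
  have [|l1 l2] := neg i1 j1 i2 j2 lt le2 s1; first by move=> i j li sj; have [] := line i j li sj.
  have A : newton_polygon H n (i1%:Q, j1%:Q).
    by have := seg 0; rewrite lexx ler01 /seg_pt subr0 !mul1r !mul0r !addr0; apply.
  have B : newton_polygon H n (i2%:Q, j2%:Q).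
    by have := seg 1; rewrite lexx ler01 /seg_pt subrr !mul1r !mul0r !add0r; apply.
  split; exists (i1%:Q, j1%:Q), (i2%:Q, j2%:Q); do 5!split=> //.
    by exists 0; rewrite ?lexx ?ler01 // /seg_pt subr0 !mul1r !mul0r !addr0.
  by exists 1; rewrite ?lexx ?ler01 // /seg_pt subrr !mul1r !mul0r !add0r.
split=> //; have [a1 a2] := neg i1 j1 i2 j2 lt le2 s1 line.
rewrite lt0n; apply/eqP => m0; rewrite m0 mulr0z oppr0 mul0r in sl.
have [q0 _] := deg.
move/eqP: sl; rewrite mulf_eq0 subr_eq0 (lt_eqF a2) intr_eq0 /=.
by move=> /eqP[q00]; rewrite q00 in q0.
Qed.

(** * Minimal exponents of bivariate polynomials *)

Lemma min_below (T : nat -> nat -> Prop) i j : T i j ->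
  exists i0 j0, [/\ (i0 <= i)%N, (j0 <= j)%N, T i0 j0 &
    forall i' j', (i' <= i0)%N -> (j' <= j0)%N -> T i' j' -> i' = i0 /\ j' = j0].
Proof.
move: {2}(i + j)%N (leqnn (i + j)) => n; elim: n i j => [|n IH] i j ijn Tij.
  exists i, j; split=> // i' j' ii' jj' _; lia.
case: (pselect (exists i' j', [/\ (i' <= i)%N, (j' <= j)%N, T i' j' & (i' + j' < i + j)%N])).
  move=> [i' [j' [ii jj Tij' lt]]].
  have [|i0 [j0 [i0i j0j T0 m0]]] := IH i' j' _ Tij'; first by lia.
  by exists i0, j0; split=> //; [apply: leq_trans ii | apply: leq_trans jj].
move=> no; exists i, j; split=> // i' j' ii jj Tij'.
have : ~~ (i' + j' < i + j)%N by apply/negP => lt; apply: no; exists i', j'.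
by move=> *; lia.
Qed.

Section Support.
Variable R : fieldType.
Implicit Types A B V : {poly (ser R)}.

Lemma supp_mul V B i j : (V * B)`_i j != 0 ->
  exists i' j', [/\ (i' <= i)%N, (j' <= j)%N & B`_i' j' != 0].
Proof.
move=> nz; apply: contrapT => no; case/eqP: nz.
rewrite mulrC coefM ser_sum big1 // => i' _; rewrite serM big1 // => j' _.
case: (eqVneq (B`_i' j') 0) => [->|nz]; first by rewrite mul0r.
by case: no; exists i', j'; split=> //; rewrite -ltnS.
Qed.

(** At a minimal exponent of [B] the product has a single nonzero contribution, from the constant
    term of [V]. *)
Lemma supp_mul_unit V B i j : V`_0 0%N != 0 -> B`_i j != 0 ->
  exists i0 j0, [/\ (i0 <= i)%N, (j0 <= j)%N & (V * B)`_i0 j0 != 0].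
Proof.
move=> V0 Bij.
have [i0 [j0 [ii jj B0 minB]]] := @min_below (fun i j => B`_i j != 0) i j Bij.
exists i0, j0; split=> //.
rewrite mulrC coefM ser_sum (bigD1 ord_max) //= subnn big1 ?addr0 => [|i' ni].
  rewrite serM (bigD1 ord_max) //= subnn big1 ?addr0 ?mulf_neq0 // => j' nj.
  case: (eqVneq (B`_i0 j') 0) => [->|nz]; first by rewrite mul0r.
  have le_j : (j' <= j0)%N by rewrite -ltnS.
  have [_ e] := minB i0 j' (leqnn _) le_j nz.
  by case/eqP: nj; apply: val_inj.
rewrite serM big1 // => j' _.
case: (eqVneq (B`_i' j') 0) => [->|nz]; first by rewrite mul0r.
have le_i : (i' <= i0)%N by rewrite -ltnS.
have le_j : (j' <= j0)%N by rewrite -ltnS.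
have [e _] := minB i' j' le_i le_j nz.
by case/eqP: ni; apply: val_inj.
Qed.

Notation xx := ((sX R)%:P).

Lemma supp_term n w B i j : (xx ^+ w * 'X^n * B)`_i j != 0 -> (n <= i)%N /\ (w <= j)%N.
Proof.
rewrite -mulrA coef_xxM; case: ltnP => [_|wj]; first by rewrite eqxx.
by rewrite coefXnM; case: ltnP => [_|ni]; rewrite ?ser0 ?eqxx.
Qed.

Lemma coef_term n w B : (xx ^+ w * 'X^n * B)`_n w = B`_0 0%N.
Proof. by rewrite -mulrA coef_xxM ltnn coefXnM ltnn !subnn. Qed.

Section Monomials.
Variables (M : nat) (nz : pred nat) (w : nat -> nat) (B : nat -> {poly (ser R)}).
Hypothesis B0 : forall n, nz n -> (B n)`_0 0%N != 0.
Let T := \sum_(n < M | nz n) xx ^+ w n * 'X^n * B n.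

Lemma supp_sum i j : T`_i j != 0 -> exists n, [/\ (n < M)%N, nz n, (n <= i)%N & (w n <= j)%N].
Proof.
move=> Tij; apply: contrapT => no; case/eqP: Tij.
rewrite /T coef_sum ser_sum big1 // => n nzn; apply: contrapT => /eqP nz0.
by have [ni wj] := supp_term nz0; apply: no; exists n.
Qed.

(** Take [(n0, w n0)] minimal among the pairs [(n, w n)] below the given one: another term meeting
    this monomial would have a smaller pair. *)
Lemma supp_sum_conv n : (n < M)%N -> nz n ->
  exists i j, [/\ (i <= n)%N, (j <= w n)%N & T`_i j != 0].
Proof.
move=> nM nzn.
have [n0 [v0 [nn0 vv0 [n0M nzn0 wE] min0]]] :=
  @min_below (fun n v => [/\ (n < M)%N, nz n & w n = v]) n (w n) (And3 nM nzn erefl).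
exists n0, v0; split=> //; rewrite /T coef_sum ser_sum (bigD1 (Ordinal n0M)) //=.
rewrite big1 ?addr0 => [|x /andP[nzx nx]]; first by rewrite -wE coef_term B0.
apply: contrapT => /eqP /supp_term[xn0 wx].
have [|e _] := min0 x (w x) xn0 wx; first by [].
by case/eqP: nx; apply: val_inj.
Qed.
End Monomials.
End Support.

(** * Sums over multi-exponents *)

Lemma big_ord_change (V : zmodType) m n (f : nat -> V) :
  (forall x, f x != 0 -> (x < m)%N /\ (x < n)%N) -> \sum_(x < m) f x = \sum_(x < n) f x.
Proof.
wlog mn : m n / (m <= n)%N => [hw|].
  move=> h; case: (leqP m n) => [|/ltnW] mn; first exact: hw.
  by rewrite (hw n m) // => x /h[].
move=> h; rewrite (big_ord_widen n f mn) big_mkcond; apply: eq_bigr => x _.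
case: ifP => // xm; case: (eqVneq (f x) 0) => [->//|/h[]]; by rewrite xm.
Qed.

Definition upd (b : nat -> nat) i x : nat -> nat := fun l => if l == i then x else b l.

Section NestedSum.
Variable (V : nzRingType) (m : nat).
Implicit Types (G : (nat -> nat) -> V) (b : nat -> nat).

(** The sum over all exponents [b_0, ..., b_{n-1}] below [m], with the last one outermost as in a
    [phi]-adic expansion; the entries of [b] from [n] on are parameters. *)
Fixpoint psum n G b : V :=
  if n is n'.+1 then \sum_(x < m) psum n' G (upd b n' x) else G b.

Definition extend n (B : {ffun 'I_n -> 'I_m}) b : nat -> nat :=
  fun l => if insub l is Some i then val (B i) else b l.

Lemma psum_ffun n G b : \sum_(B : {ffun 'I_n -> 'I_m}) G (extend B b) = psum n G b.
Proof.
elim: n b => [|n IH] b /=.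
  rewrite (big_pred1 [ffun i : 'I_0 => False_rect 'I_m (notF (ltn_ord i))]); last first.
    by move=> B; apply/esym/eqP/ffunP => -[].
  by congr G; apply: funext => l; rewrite /extend insubF.
under [RHS]eq_bigr => x _ do rewrite -IH.
rewrite pair_big /=.
pose h (p : 'I_m * {ffun 'I_n -> 'I_m}) : {ffun 'I_n.+1 -> 'I_m} :=
  [ffun i : 'I_n.+1 => if insub (val i) is Some i' then p.2 i' else p.1].
pose h' (B : {ffun 'I_n.+1 -> 'I_m}) : 'I_m * {ffun 'I_n -> 'I_m} :=
  (B ord_max, [ffun i : 'I_n => B (widen_ord (leqnSn n) i)]).
rewrite (reindex h) /=; last first.
  exists h' => [[x B] _|B _]; rewrite /h /h'.
    congr (_, _); first by rewrite ffunE insubF //= ltnn.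
    apply/ffunP => i; rewrite !ffunE; case: insubP => [i' _ e|]; last by rewrite /= ltn_ord.
    by congr (B _); apply: val_inj.
  apply/ffunP => i; rewrite ffunE; case: insubP => [i' lt e|] /=.
    by rewrite ffunE; congr (B _); apply: val_inj.
  rewrite -leqNgt => ni; congr (B _); apply: val_inj => /=.
  by apply/eqP; rewrite eqn_leq ni -ltnS ltn_ord.
apply: eq_bigr => -[x B] _ /=; congr G; apply: funext => l; rewrite /extend /h.
case: insubP => [i lt e|]; rewrite /upd.
  rewrite ffunE e; case: insubP => [i' lt' e'|] //=.
  rewrite -leqNgt => nl; case: eqP => // ne.
  by case: ne; apply/eqP; rewrite eqn_leq nl -ltnS lt.
rewrite -leqNgt => nl; rewrite insubF ?ltnNge ?(ltnW nl) //.
by rewrite gtn_eqF.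
Qed.

Lemma psum_mulr n n' G (C : nat -> V) b : (n <= n')%N ->
  psum n (fun b' => G b' * C (b' n')) b = psum n G b * C (b n').
Proof.
elim: n b => [//|n IH] b nn' /=; rewrite mulr_suml; apply: eq_bigr => x _.
by rewrite IH 1?ltnW // {2}/upd gtn_eqF.
Qed.

End NestedSum.

Lemma bXn_mul (R : comNzRingType) n (B : bser R) i j :
  bmul (bXn R n) B i (n + j)%N = B i j.
Proof.
rewrite /bmul big_ord_recl [X in _ + X]big1 ?addr0 => [|i2 _]; last first.
  by apply: big1 => j2 _; rewrite /bXn /= mul0r.
have lt : (n < (n + j).+1)%N by rewrite ltnS leq_addr.
rewrite (bigD1 (Ordinal lt)) //= big1 ?addr0 => [|j2 /eqP nj2].
  by rewrite /bXn !eqxx mul1r subn0 addKn.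
by rewrite /bXn /=; case: eqP => [e2|_]; rewrite ?mul0r //; case: nj2; apply: val_inj.
Qed.

Lemma monic_comp_shift (R : comNzRingType) (A : {poly R}) (h : R) :
  A \is monic -> (A \Po ('X + h%:P)) \is monic /\ size (A \Po ('X + h%:P)) = size A.
Proof.
move=> mA; set B := 'X + h%:P; set n := (size A).-1.
have sA : size A = n.+1 by rewrite prednK // size_poly_gt0 monic_neq0.
have BE : B = 'X - (- h)%:P by rewrite /B polyCN opprK.
have mB : B \is monic by rewrite BE monicXsubC.
have sB : size B = 2 by rewrite BE size_XsubC.
have mBn : B ^+ n \is monic by apply: rpredX.
have sBn j : size (B ^+ j) = j.+1.
  elim: j => [|j IH]; first by rewrite expr0 size_poly1.
  by rewrite exprS size_monicM ?monic_neq0 ?rpredX // sB IH.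
pose r := A - 'X^n.
have sr : (size r <= n)%N.
  apply/leq_sizeP => j; rewrite coefB coefXn leq_eqVlt => /orP[/eqP <-|nj].
    by move: mA; rewrite monicE lead_coefE sA /= => /eqP ->; rewrite eqxx subrr.
  by rewrite nth_default ?sA // gtn_eqF // subr0.
have AE : A \Po B = B ^+ n + (r \Po B).
  by have -> : A = r + 'X^n; [rewrite /r subrK | rewrite comp_polyD comp_Xn_poly addrC].
have srB : (size (r \Po B) < size (B ^+ n))%N.
  rewrite sBn ltnS; case: (posnP (size r)) => [/eqP|s0].
    by rewrite size_poly_eq0 => /eqP ->; rewrite comp_poly0 size_poly0.
  by apply: leq_trans (size_comp_poly_leq _ _) _; rewrite sB muln1 prednK.
by rewrite AE monicE lead_coefDl // size_polyDl // sBn sA; split=> //; rewrite -monicE.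
Qed.

Lemma pim_comp_poly (R S : comNzRingType) (g : {rmorphism R -> S}) (Y Z : {poly S}) A :
  pim g Y A \Po Z = pim g (Y \Po Z) A.
Proof. by rewrite /pim comp_polyA. Qed.

Lemma size_pim (R S : comNzRingType) (g : {rmorphism R -> S}) (Y : {poly S}) (A : {poly R}) n :
  (size A <= n.+1)%N -> (size Y <= 2)%N -> (size (pim g Y A) <= n.+1)%N.
Proof.
move=> sA sY; apply: leq_trans (size_comp_poly_leq _ _) _; rewrite ltnS.
have sg : (size (map_poly g A) <= n.+1)%N := leq_trans (size_poly _ _) sA.
by case: (size Y) sY => [|[|[|]]] //; case: (size (map_poly g A)) sg => //= *; rewrite ?muln0 ?muln1.
Qed.

(** The equation makes [q s = 1 + m t] positive, so that the integer power [z ^ s] is an ordinary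
    one. *)
Lemma bezout_nat (q m t : nat) (s : int) : (0 < q)%N ->
  q%:Z * s - m%:Z * t%:Z = 1 -> s = `|s|%N%:Z /\ (q * `|s| = m * t + 1)%N.
Proof.
move=> q0 e; have s0 : 0 <= s by nia.
by case: s e s0 => [s'|s'] // e _; split=> //; rewrite absz_nat; nia.
Qed.

(** * The procedure *)

Section Procedure.
Variables (K : fieldType) (L : fieldExtType K) (d : nat) (F : bser K) (k : nat)
  (N : nat -> nat) (c : nat -> ser L) (H G U : nat -> bser L) (a : nat -> nat)
  (q m : nat -> nat) (P : nat -> {poly L}) (z : nat -> L) (s : nat -> int) (t : nat -> nat)
  (mu alpha : nat -> L) (e r : nat -> nat) (S : nat -> ser L)
  (phi : nat -> bser K) (D : nat -> nat).
Hypothesis hchar : forall p, p \in [pchar K] -> (d < p)%N.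
Hypothesis hF : monicY F d.
Hypothesis hN0 : N 0%N = d.
Hypothesis hc0 : forall j, c 0%N j = inL L (- F d.-1 j / d%:R).
Hypothesis hH0 : beq (H 0%N) (ysubst d (bmapL L F) (badd (bY L) (ofser (c 0%N)))).
Hypothesis hstep : forall i, (i < k)%N ->
     N i <> 1%N /\
     degenerated (tower z i)
       (if i == 0%N then newton_polygon (H i) (N i)
        else principal_newton_polygon (H i) (N i))
       (H i) (q i.+1) (m i.+1)%:Z (P i.+1) (N i.+1) /\
     root (P i.+1) (z i.+1) /\
     (t i.+1 < q i.+1)%N /\
     (q i.+1)%:Z * s i.+1 - (m i.+1)%:Z * (t i.+1)%:Z = 1 /\
     beq (ysubst (N i) (bxsubst (H i) (z i.+1 ^+ t i.+1) (q i.+1))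
            (bmul (bXn L (m i.+1)) (badd (bY L) (bconst (z i.+1 ^ s i.+1)))))
         (bmul (bXn L (a i.+1)) (bmul (U i.+1) (G i.+1))) /\
     U i.+1 0%N 0%N != 0 /\
     monicY (G i.+1) (N i.+1) /\
     (forall l, (l < N i.+1)%N -> G i.+1 l 0%N = 0) /\
     (forall j, c i.+1 j = - G i.+1 (N i.+1).-1 j / (N i.+1)%:R) /\
     beq (H i.+1) (ysubst (N i.+1) (G i.+1) (badd (bY L) (ofser (c i.+1)))).
Hypothesis hmu0 : beq (bmul (bconst (mu 0%N)) (bXn L (e 0%N))) (bXn L 1).
Hypothesis hY0 : beq (badd (bmul (bconst (alpha 0%N)) (bmul (bXn L (r 0%N)) (bY L))) (ofser (S 0%N)))
      (badd (bY L) (ofser (c 0%N))).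
Hypothesis hpi : forall i, (i < k)%N ->
     let X1 := bmul (bconst (z i.+1 ^+ t i.+1)) (bXn L (q i.+1)) in
     beq (bmul (bconst (mu i.+1)) (bXn L (e i.+1)))
         (bmul (bconst (mu i)) (bexp X1 (e i))) /\
     beq (badd (bmul (bconst (alpha i.+1)) (bmul (bXn L (r i.+1)) (bY L))) (ofser (S i.+1)))
         (badd (bmul (bmul (bconst (alpha i)) (bexp X1 (r i)))
                     (bmul (bXn L (m i.+1))
                        (badd (badd (bY L) (ofser (c i.+1))) (bconst (z i.+1 ^ s i.+1)))))
               (ofser (xsubst (S i) (z i.+1 ^+ t i.+1) (q i.+1)))).
Hypothesis hphi : forall i, (i <= k)%N ->
     monicY (phi i) (D i) /\ irredY (phi i) /\
     beq (ysubst (D i) (bxsubst (bmapL L (phi i)) (mu i) (e i)) (ofser (S i))) (bzero L).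

Notation xx := ((sX L)%:P).
Let E i := tower z i.
Let ell i := (size (P i)).-1.
Let sn i := `|s i|%N.

(** [H_0] is only monic, whence the restriction [0 < i] on the vanishing at [x = 0]. *)
Definition weierstrass_data i :=
  [/\ monicY (H i) (N i), (0 < i)%N -> forall l, (l < N i)%N -> H i l 0%N = 0,
      overB (E i) (H i) & (N i <= d)%N].

Lemma tower_sub i : (E i <= E i.+1)%VS. Proof. exact: subv_adjoin. Qed.
Lemma tower_z i : z i.+1 \in E i.+1. Proof. exact: memv_adjoin. Qed.

Lemma step_facts i : (i < k)%N -> weierstrass_data i ->
  [/\ z i.+1 != 0, (0 < q i.+1)%N, (0 < N i.+1)%N,
      (q i.+1 * ell i.+1 * N i.+1 <= N i)%N & (i == 0%N) || (0 < m i.+1)%N].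
Proof.
move=> ik [mH H0 _ _]; have [_ [deg [rPz _]]] := hstep ik.
have [q0 _] := deg; case: i ik mH H0 deg rPz q0 => [|i] ik mH H0 deg rPz q0.
  by have [? ? ?] := degenerated_first deg rPz.
by have [? ? ? ?] := degenerated_principal mH (H0 isT) deg rPz.
Qed.

Lemma sn_facts i : (i < k)%N -> weierstrass_data i ->
  z i.+1 ^ s i.+1 = z i.+1 ^+ sn i.+1 /\ (q i.+1 * sn i.+1 = m i.+1 * t i.+1 + 1)%N.
Proof.
move=> ik wi; have [_ q0 _ _ _] := step_facts ik wi.
have [_ [_ [_ [_ [bz _]]]]] := hstep ik.
by have [sE qs] := bezout_nat q0 bz; split=> //; rewrite {1}sE.
Qed.

(** Consequently [tau_{i+1}] is the identity at [x = 0], and preserves units and the Weierstrass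
    condition. *)
Lemma c_zero i : (i < k)%N -> weierstrass_data i -> c i.+1 0%N = 0.
Proof.
move=> ik wi; have [_ _ N0 _ _] := step_facts ik wi.
have [_ [_ [_ [_ [_ [_ [_ [_ [G0 [-> _]]]]]]]]]] := hstep ik.
by rewrite G0 ?oppr0 ?mul0r // prednK.
Qed.

Definition Hp i : {poly (ser L)} := ofB (N i) (H i).
Definition sigY i : {poly (ser L)} := xx ^+ m i.+1 * ('X + (sC (z i.+1 ^+ sn i.+1))%:P).

(** [U] is only given as a bivariate series; the degree in [y] of [H_i o sigma] bounds its degree,
    and the factorization takes place in [L[[x]][y]]. The left side is over [E_{i+1}], hence so is
    [G]. *)
Lemma weierstrass_step i : (i < k)%N -> weierstrass_data i ->
  exists Up Gp : {poly (ser L)},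
   [/\ toB Up = U i.+1, toB Gp = G i.+1, Gp \is monic /\ size Gp = (N i.+1).+1,
       pim (xsub (z i.+1 ^+ t i.+1) (q i.+1)) (sigY i) (Hp i) = xx ^+ a i.+1 * (Up * Gp) &
       overB (E i.+1) (G i.+1)].
Proof.
move=> ik wi; have [z0 q0 N0 _ _] := step_facts ik wi; have [zs _] := sn_facts ik wi.
have [mH _ HE _] := wi; have [tH mHp sHp] := monicY_ofB mH.
have [_ [_ [_ [_ [_ [/beq_eq HUG [U0 [mG [G0 _]]]]]]]]] := hstep ik.
have [tG mGp sGp] := monicY_ofB mG.
set lhs := ysubst _ _ _ in HUG.
have lhsE : lhs = toB (pim (xsub (z i.+1 ^+ t i.+1) (q i.+1)) (sigY i) (Hp i)).
  rewrite /lhs -[in bxsubst _]tH toB_bxsubst // zs -toB_Y -toB_const -toBD -toB_Xn -toBM.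
  rewrite toB_ysubst; first by rewrite /pim /sigY rmorphXn.
  by apply: leq_trans (size_poly _ _) _; rewrite sHp.
have sY : (size (sigY i) <= 2)%N.
  rewrite /sigY -rmorphXn mul_polyC (leq_trans (size_scale_leq _ _)) //.
  by rewrite size_polyDl ?size_polyX // size_polyC; case: (_ != 0).
have degUG : ydeg_le (bmul (U i.+1) (G i.+1)) (N i).
  have : ydeg_le lhs (N i) by rewrite lhsE; apply/toB_deg/size_pim; rewrite ?sHp.
  by move=> dl i1 ni1 j; rewrite -(bXn_mul (a i.+1)) -HUG dl.
have dU := weierstrass_quotient_deg mG G0 degUG.
exists (ofB (N i) (U i.+1)), (ofB (N i.+1) (G i.+1)); rewrite (ofBK dU) tG; split=> //.
  apply: toB_inj; rewrite -lhsE HUG !toBM (ofBK dU) tG; congr bmul.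
  by rewrite -toB_Xn rmorphXn.
apply: (weierstrass_over mG G0 U0) => i1 j1.
have lhsEE : overB (E i.+1) lhs.
  have HE' := overB_sub (tower_sub i) HE; have zE := tower_z i.
  rewrite /lhs zs; apply: overB_ysubst.
    by apply: overB_bxsubst; rewrite ?rpredX.
  apply: overB_mul; first exact: overB_Xn.
  by apply: overB_add; [exact: overB_Y | apply: overB_const; rewrite rpredX].
by rewrite -(bXn_mul (a i.+1)) -HUG.
Qed.

Definition rh i := rho (z i.+1) (q i.+1) (m i.+1) (t i.+1) (sn i.+1) (c i.+1).

Lemma sigY_shift i : sigY i \Po ('X + (c i.+1)%:P) = rhoY (z i.+1) (m i.+1) (sn i.+1) (c i.+1).
Proof.
rewrite /sigY comp_polyM -polyC_exp comp_polyC comp_polyD comp_polyX comp_polyC.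
by rewrite -addrA -polyCD /rhoY polyC_exp.
Qed.

Lemma weierstrass_data_step i : (i < k)%N -> weierstrass_data i -> weierstrass_data i.+1 /\
  exists2 V, rh i (Hp i) = xx ^+ a i.+1 * (V * Hp i.+1) & V`_0 0%N != 0.
Proof.
move=> ik wi; have [Up [Gp [tU tG [mGp sGp] UGE GE]]] := weierstrass_step ik wi.
have [z0 q0 N0 qN _] := step_facts ik wi; have c0 := c_zero ik wi.
have [_ [_ [_ [_ [_ [_ [U0 [_ [G0 [cE /beq_eq HE]]]]]]]]]] := hstep ik.
pose tau : {poly (ser L)} := 'X + (c i.+1)%:P.
have [mG' sG'] := monic_comp_shift (c i.+1) mGp.
have tH : H i.+1 = toB (Gp \Po tau).
  by rewrite HE -tG -toB_Y -toB_C -toBD toB_ysubst // sGp.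
have HpE : Hp i.+1 = Gp \Po tau.
  by apply: toB_inj; rewrite /Hp ofBK ?tH //; apply: toB_deg; rewrite sG' sGp.
have N'd : (N i.+1 <= d)%N.
  have [_ _ _ Nd] := wi; apply: leq_trans Nd; apply: leq_trans qN.
  have [_ [dg _]] := hstep ik; have [_ [_ [_ [_ [_ [[sP _] _]]]]]] := dg.
  by rewrite leq_pmull // muln_gt0 q0 /ell -ltnS prednK // ltnW.
have ev0tau B : ev0 (B \Po tau) = ev0 B.
  by rewrite /ev0 map_comp_poly rmorphD /= map_polyX map_polyC /= /ser_ev0 c0 addr0 comp_polyXr.
have cE' : overS (E i.+1) (c i.+1).
  by move=> j; rewrite cE rpred_div ?rpredN ?rpred_nat //; apply: GE.
split.
  split=> //.
  - split; first by rewrite tH; apply: toB_deg; rewrite sG' sGp.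
    move=> j; rewrite tH /toB; move: mG'; rewrite monicE lead_coefE sG' sGp /= => /eqP ->.
    by rewrite ser1.
  - move=> _ l lN; rewrite tH /toB -coef_ev0 ev0tau coef_ev0.
    by rewrite -[_ 0%N]/(toB Gp l 0%N) tG G0.
  - rewrite HE; apply: overB_ysubst => //.
    by apply: overB_add; [exact: overB_Y | exact: overB_ofser].
exists (Up \Po tau).
  rewrite /rh /rho -sigY_shift -pim_comp_poly UGE HpE !comp_polyM.
  by rewrite -polyC_exp comp_polyC.
by rewrite -coef_ev0 ev0tau coef_ev0 -[_ 0%N]/(toB Up 0%N 0%N) tU.
Qed.

Definition Fp : {poly (ser K)} := ofB d F.

Lemma bmapL_toB A : bmapL L (toB A) = toB (map_poly (smap (in_alg L)) A).
Proof. by apply: funext => i; apply: funext => j; rewrite /toB coef_map. Qed.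

Lemma weierstrass_data_base : Hp 0 = map_poly (smap (in_alg L)) Fp \Po ('X + (c 0%N)%:P) /\ weierstrass_data 0.
Proof.
have [tF mF sF] := monicY_ofB hF.
set Fm := map_poly (smap (in_alg L)) Fp.
have mFm : Fm \is monic by apply: monic_map.
have sFm : size Fm = d.+1 by rewrite size_map_poly_id0 // (monicP mF) rmorph1 oner_eq0.
have [mH sH] := monic_comp_shift (c 0%N) mFm.
have tH : H 0%N = toB (Fm \Po ('X + (c 0%N)%:P)).
  by rewrite (beq_eq hH0) -tF bmapL_toB -toB_Y -toB_C -toBD toB_ysubst // sFm.
have dH : ydeg_le (H 0%N) d by rewrite tH; apply: toB_deg; rewrite sH sFm.
split; first by apply: toB_inj; rewrite /Hp hN0 ofBK // tH.
have in1 (x : K) : x%:A \in E 0%N by rewrite rpredZ ?rpred1.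
split; rewrite ?hN0 //.
- split=> // j; rewrite tH /toB; move: mH; rewrite monicE lead_coefE sH sFm /= => /eqP ->.
  by rewrite ser1.
- rewrite (beq_eq hH0); apply: overB_ysubst; first by move=> i j; apply: in1.
  apply: overB_add; first exact: overB_Y.
  by apply: overB_ofser => j; rewrite hc0; apply: in1.
Qed.

Lemma weierstrass_data_all i : (i <= k)%N -> weierstrass_data i.
Proof.
elim: i => [_|i IH ik]; first by have [] := weierstrass_data_base.
by have [] := weierstrass_data_step ik (IH (ltnW ik)).
Qed.

(** * Composition with the parametrizations [pi_i] *)

Definition Yp i : {poly (ser L)} :=
  (sC (alpha i))%:P * ((sX L ^+ r i)%:P * 'X) + (S i)%:P.
(* Composition with [pi_i], whose second component is [Yp i]. *)
Definition pi i : {poly (ser K)} -> {poly (ser L)} := pim (iota_ser (mu i) (e i)) (Yp i).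

Lemma piM i A B : pi i (A * B) = pi i A * pi i B. Proof. exact: rmorphM. Qed.
Lemma piX i A n : pi i (A ^+ n) = pi i A ^+ n. Proof. exact: rmorphXn. Qed.
Lemma pi_sum i I (l : seq I) (B : I -> {poly (ser K)}) :
  pi i (\sum_(j <- l) B j) = \sum_(j <- l) pi i (B j).
Proof. exact: rmorph_sum. Qed.

Definition param i := [/\ (0 < e i)%N, mu i != 0, mu i \in E i, alpha i \in E i & overS (E i) (S i)].

Lemma toB_Yp i : toB (Yp i) =
  badd (bmul (bconst (alpha i)) (bmul (bXn L (r i)) (bY L))) (ofser (S i)).
Proof. by rewrite toBD !toBM toB_const toB_Xn toB_Y toB_C. Qed.

Lemma Yp_over i (E' : {subfield L}) :
  overB E' (toB (Yp i)) -> alpha i \in E' /\ overS E' (S i).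
Proof.
move=> YE; have c1 : (Yp i)`_1 = sC (alpha i) * sX L ^+ r i.
  by rewrite coefD coefC coefCM coefMX coefC addr0.
have c0 : (Yp i)`_0 = S i by rewrite coefD coefC coefCM coefMX mulr0 add0r.
split; last by move=> j; rewrite -c0; apply: YE.
by have := YE 1%N (r i); rewrite /toB c1 serCM serXn eqxx mulr1.
Qed.

Lemma pi_base : [/\ e 0%N = 1%N, mu 0%N = 1, Yp 0 = 'X + (c 0%N)%:P & param 0].
Proof.
have YE : Yp 0 = 'X + (c 0%N)%:P.
  by apply: toB_inj; rewrite toB_Yp (beq_eq hY0) toBD toB_Y toB_C.
have : sC (mu 0%N) * sX L ^+ e 0%N = sX L ^+ 1.
  apply: polyC_inj; apply: toB_inj; rewrite polyCM toBM toB_const !toB_Xn.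
  exact: beq_eq.
(* The coefficient of [x] in [mu x^e = x] forces [e = 1] and [mu = 1]. *)
move=> h; have := congr1 (fun g : ser L => g 1%N) h; rewrite serCM !serXn eqxx /=.
case: eqP => [e1|_]; last by rewrite mulr0 => /esym/eqP; rewrite oner_eq0.
rewrite mulr1 => mu1; split=> //; rewrite /param -e1 mu1 oner_eq0 rpred1.
have [_ wp] := weierstrass_data_base.
have [] := @Yp_over 0 (E 0%N) _; last by [].
rewrite YE toBD toB_Y toB_C; apply: overB_add; first exact: overB_Y.
by apply: overB_ofser => j; rewrite hc0 rpredZ ?rpred1.
Qed.

Lemma eq_pim (R1 R2 : comNzRingType) (g h : {rmorphism R1 -> R2}) Y A :
  g =1 h -> pim g Y A = pim h Y A.
Proof. by move=> gh; rewrite /pim (eq_map_poly gh). Qed.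

Lemma pi_step i : (i < k)%N -> param i ->
  [/\ param i.+1, e i.+1 = (e i * q i.+1)%N & forall A, pi i.+1 A = rh i (pi i A)].
Proof.
move=> ik [e0 mu0 muE alE SE]; have wi := weierstrass_data_all (ltnW ik).
have [z0 q0 N0 qN _] := step_facts ik wi; have [zs _] := sn_facts ik wi.
have [/beq_eq hmu /beq_eq hY] := hpi ik.
set ze := z i.+1 ^+ t i.+1 in hmu hY.
have zeE : ze \in E i.+1 by rewrite rpredX ?tower_z.
have sE x : x \in E i -> x \in E i.+1 by apply: subvP; apply: tower_sub.
have X1E : bmul (bconst ze) (bXn L (q i.+1)) = toB (sC ze * sX L ^+ q i.+1)%:P.
  by rewrite polyCM toBM toB_const toB_Xn.
have h : sC (mu i.+1) * sX L ^+ e i.+1 = sC (mu i * ze ^+ e i) * sX L ^+ (e i * q i.+1).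
  apply: polyC_inj; apply: toB_inj; rewrite polyCM toBM toB_const toB_Xn hmu X1E.
  rewrite -toBX -toB_const -toBM -polyC_exp -polyCM; congr (toB _%:P).
  have -> : sC (mu i * ze ^+ e i) = sC (mu i) * sC ze ^+ e i by rewrite rmorphM rmorphXn.
  by rewrite exprMn -exprM mulrA mulnC.
have mz0 : mu i * ze ^+ e i != 0 by rewrite mulf_neq0 ?expf_neq0.
(* Equality of two monomials determines the exponent because the coefficient on the right is
   nonzero. *)
have := congr1 (fun g : ser L => g (e i * q i.+1)%N) h; rewrite !serCM !serXn eqxx mulr1 eq_sym.
case: eqP => [e'E|_]; last by rewrite mulr0 => /eqP; rewrite eq_sym (negbTE mz0).
rewrite mulr1 => mu'E.
have YE : Yp i.+1 = rh i (Yp i).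
  apply: toB_inj; rewrite toB_Yp hY X1E.
  have -> : rh i (Yp i) = ((sC (alpha i) * (sC ze * sX L ^+ q i.+1) ^+ r i))%:P *
     (xx ^+ m i.+1 * ('X + (c i.+1 + sC (z i.+1 ^+ sn i.+1))%:P)) +
     (xsub ze (q i.+1) (S i))%:P.
    rewrite /rh /rho /Yp pimD mulrA -polyCM pimM !pimC pimX.
    congr (_%:P * _ + _); rewrite rmorphM rmorphXn /= xsubC xsubX //.
  rewrite -xsubE // zs -toBX -!toB_const -toB_Xn -toB_Y -!toB_C -!(toBD, toBM).
  congr (toB (_ * _ + _)); first by rewrite [RHS]polyCM polyC_exp.
  by rewrite polyC_exp polyCD addrA.
have YE' : overB (E i.+1) (toB (Yp i.+1)).
  rewrite toB_Yp hY zs; apply: overB_add.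
    apply: overB_mul; last first.
      apply: overB_mul; first exact: overB_Xn.
      apply: overB_add; last by apply: overB_const; rewrite rpredX ?tower_z.
      apply: overB_add; first exact: overB_Y.
      apply: overB_ofser => j.
      have [Up [Gp [_ _ _ _ GE]]] := weierstrass_step ik wi.
      have [_ [_ [_ [_ [_ [_ [_ [_ [_ [-> _]]]]]]]]]] := hstep ik.
      by rewrite rpred_div ?rpredN ?rpred_nat //; apply: GE.
    apply: overB_mul; first by apply: overB_const; apply: sE.
    by apply: overB_exp; apply: overB_mul; [apply: overB_const | apply: overB_Xn].
  apply: overB_ofser; rewrite -xsubE //; apply: overS_xsub => // j; exact: sE.
have [al'E S'E] := Yp_over YE'.
split=> //.
  split=> //; first by rewrite e'E muln_gt0 e0.
    by rewrite mu'E.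
  rewrite mu'E; apply: rpredM; [exact: sE | exact: rpredX].
move=> A; rewrite /pi /rh /rho pim_comp YE; apply: eq_pim => h' /=.
by rewrite xsub_comp // e'E mu'E.
Qed.

Lemma param_all i : (i <= k)%N -> param i.
Proof.
elim: i => [_|i IH ik]; first by have [] := pi_base.
by have [] := pi_step ik (IH (ltnW ik)).
Qed.

(** Setting [y = 0] restricts to the curve, so vanishing on the curve means divisibility of the
    image by [y]. *)
Lemma pi_coef0 i A : (pi i A)`_0 = (map_poly (iota_ser (mu i) (e i)) A).[S i].
Proof.
rewrite /pi /pim -horner_coef0 horner_comp; congr (_.[_]).
by rewrite /Yp hornerD hornerM !hornerC hornerM hornerC hornerX !mulr0 add0r.
Qed.

Definition ph i : {poly (ser K)} := ofB (D i) (phi i).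

Lemma ph_facts i : (i <= k)%N ->
  [/\ toB (ph i) = phi i, ph i \is monic, size (ph i) = (D i).+1,
      irredY (toB (ph i)) & (pi i (ph i))`_0 = 0].
Proof.
move=> ik; have [mphi [irr /beq_eq van]] := hphi ik.
have [tp mp sp] := monicY_ofB mphi; have [e0 _ _ _ _] := param_all ik.
split=> //; first by rewrite tp.
rewrite pi_coef0; apply: polyC_inj; apply: toB_inj; rewrite -comp_polyCr.
rewrite polyC0 toB0 -van -tp bmapL_toB toB_bxsubst // -toB_C.
rewrite toB_ysubst; first by congr (toB (_ \Po _)); rewrite -map_poly_comp.
by apply: leq_trans (size_poly _ _) _; apply: leq_trans (size_poly _ _) _; rewrite sp.
Qed.

Lemma pi_zeroE A : pi 0 A = map_poly (smap (in_alg L)) A \Po ('X + (c 0%N)%:P).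
Proof.
have [e1 mu1 YE _] := pi_base; rewrite /pi /pim YE; congr (_ \Po _).
apply: eq_map_poly => h /=; rewrite e1 mu1; apply: funext => j.
by rewrite xsubE // /xsubst dvd1n divn1 expr1n mulr1.
Qed.

Lemma lead1 fl : lead fl (1 : {poly (ser L)}) 0 1.
Proof.
exists 1; split=> //; last by rewrite coefC.
by exists 1; rewrite ?mulr1 ?expr0 //; apply: rmorph1.
Qed.

Lemma pi_F i : (i <= k)%N -> exists a' V lam,
  [/\ pi i Fp = xx ^+ a' * (V * Hp i), lead (i == 0%N) V 0 lam & lam != 0].
Proof.
elim: i => [_|i IH ik].
  exists 0%N, 1, 1; split; [|exact: lead1|exact: oner_neq0].
  by rewrite pi_zeroE expr0 !mul1r; have [] := weierstrass_data_base.
have [a' [V [lam [piE lV lam0]]]] := IH (ltnW ik).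
have wi := weierstrass_data_all (ltnW ik); have [z0 q0 _ _ fm] := step_facts ik wi.
have [_ _ piS] := pi_step ik (param_all (ltnW ik)).
have [_ [V' rHE V'0]] := weierstrass_data_step ik wi; have c0 := c_zero ik wi.
exists (q i.+1 * a' + a i.+1)%N, ((sC ((z i.+1 ^+ t i.+1) ^+ a'))%:P * rh i V * V').
exists ((z i.+1 ^+ t i.+1) ^+ a' * lam * V'`_0 0%N); split.
- rewrite piS piE /rh !rhoM rho_xx // -/(rh i _) -/(rh i _) rHE exprD.
  have swap (x1 x2 x3 x4 x5 x6 : {poly (ser L)}) :
    x1 * x2 * (x3 * (x4 * (x5 * x6))) = x2 * x4 * (x1 * x3 * x5 * x6) by ring.
  exact: swap.
- have lr := @rho_lead _ (z i.+1) _ (m i.+1) (t i.+1) (sn i.+1) _ q0 c0 _ _ _ _ fm lV; rewrite muln0 expr0 mul1r in lr.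
  exists ((((z i.+1 ^+ t i.+1) ^+ a' * lam)%:P) * ev0 V'); split=> //.
  - apply: (@xlead_mul _ _ _ 0 0); last by exists V'; rewrite ?mul1r.
    rewrite polyCM; apply: (@xlead_mul _ _ _ 0 0) => //.
    exists (sC ((z i.+1 ^+ t i.+1) ^+ a'))%:P; first by rewrite mul1r.
    by rewrite ev0C /sC mul1r.
  - by rewrite coefCM coef_ev0.
- by rewrite !mulf_neq0 ?expf_neq0.
Qed.

(** * Induction on the key polynomials *)

Definition small_degree_lead i := forall A : {poly (ser K)}, (size A <= D i)%N -> A != 0 ->
  exists w lam, [/\ lead (i == 0%N) (pi i A) w lam, lam != 0 & lam \in E i].

(** With [small_degree_lead], this is the induction hypothesis. The constants must lie in [E i], as
    they become coefficients of the polynomial evaluated at [z_{i+1}]. *)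
Definition key_poly_lead i := exists u v lam,
  [/\ pi i (ph i) = xx ^+ v * 'X * u, lead (i == 0%N) u 0 lam, lam != 0 & lam \in E i].

Lemma lead_coef0_neq0 (fl : bool) (B : {poly (ser L)}) w lam : lead fl B w lam -> lam != 0 -> B`_0 != 0.
Proof.
move=> lB; apply: contra_neq => B0.
by have := leadW lB; rewrite B0 ser0 => ->.
Qed.

(** Applies [irred_eq_of_vanishing] to the polynomial of degree [n] provided by
    [exists_vanishing]. *)
Lemma key_poly_degree i n : (i <= k)%N -> n = (e i * \dim (E i))%N ->
  (forall A : {poly (ser K)}, (size A <= n)%N -> (pi i A)`_0 = 0 -> A = 0) -> D i = n.
Proof.
move=> ik nE inj; have [e0 mu0 muE _ SE] := param_all ik.
have [psi [mpsi spsi vpsi]] := exists_vanishing e0 mu0 muE SE.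
have [_ mph sph irr van] := ph_facts ik.
have n0 : (0 < n)%N by rewrite nE muln_gt0 e0 adim_gt0.
pose h : {rmorphism {poly (ser K)} -> ser L} :=
  horner_eval (S i) \o map_poly (iota_ser (mu i) (e i)).
have hE A : h A = (pi i A)`_0 by rewrite pi_coef0.
have phE : ph i = psi.
  apply: (@irred_eq_of_vanishing _ _ h n) => //; rewrite ?nE //.
  - by move=> A; rewrite -nE hE; apply: inj.
  - by rewrite hE.
by apply: succn_inj; rewrite -sph phE spsi nE.
Qed.

Lemma key_poly_facts_base : [/\ D 0%N = (e 0%N * \dim (E 0%N))%N, small_degree_lead 0 & pi 0 (ph 0) = 'X].
Proof.
have [e1 mu1 YE _] := pi_base; have n1 : (e 0%N * \dim (E 0%N) = 1)%N by rewrite e1 dimv1.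
(* Degree 0 in [y] means a series in [x], unchanged by [tau_0] except for the extension of scalars;
   the image does not involve [y], as the flag demands. *)
have R1 (A : {poly (ser K)}) : (size A <= 1)%N -> A != 0 ->
  exists w lam, [/\ lead true (pi 0 A) w lam, lam != 0 & lam \in E 0%N].
  move=> sA; rewrite (size1_polyC sA) => A0.
  set h := A`_0 in A0 *; have h0 : h != 0 by rewrite polyC_eq0 in A0.
  have [j hj] : exists j, h j != 0.
    apply: contrapT => no; case/eqP: h0; apply: funext => j; apply: contrapT => hj.
    by apply: no; exists j; apply/eqP.
  have [v [hv hlow] _] := sord_exists hj.
  have lowL j' : (j' < v)%N -> smap (in_alg L) h j' = 0.
    by move=> lt; rewrite /smap hlow // rmorph0.
  exists v, (in_alg L (h v)); rewrite pi_zeroE map_polyC comp_polyC; split.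
  - exists (in_alg L (h v))%:P; split; rewrite ?coefC //.
    exists ((fun j => smap (in_alg L) h (v + j)%N) : ser L)%:P.
      by rewrite -polyC_exp -polyCM; congr _%:P; apply: ser_divXn.
    by rewrite ev0C addn0.
  - by rewrite fmorph_eq0.
  - by rewrite rpredZ ?rpred1.
have D1 : D 0%N = 1%N.
  apply: (key_poly_degree (leq0n k)) => // A sA A0; apply: contrapT => /eqP An0.
  have [w [lam [lA lam0 _]]] := R1 A sA An0.
  by have := lead_coef0_neq0 lA lam0; rewrite A0 eqxx.
split; rewrite ?D1 ?n1 //; first by move=> A; rewrite D1; apply: R1.
have [_ mph sph _ van] := ph_facts (leq0n k); rewrite D1 in sph.
have phE : ph 0 = 'X + ((ph 0)`_0)%:P.
  apply/polyP => -[|[|j]]; rewrite coefD coefX coefC /= ?add0r ?addr0 //.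
    by move: mph; rewrite monicE lead_coefE sph /= => /eqP ->.
  by rewrite nth_default ?sph.
move: van; rewrite pi_zeroE phE rmorphD /= map_polyX map_polyC comp_polyD comp_polyX comp_polyC.
rewrite -addrA -polyCD coefD coefX coefC add0r => /= ->.
by rewrite polyC0 addr0.
Qed.

Lemma key_poly_lead_base : key_poly_lead 0.
Proof.
have [_ _ piX] := key_poly_facts_base; exists 1, 0%N, 1; split; rewrite ?rpred1 ?oner_eq0 //.
  by rewrite piX expr0 mul1r mulr1.
exact: lead1.
Qed.

Lemma core_step_pi i n (b : nat -> {poly (ser K)}) (b0 : nat) : (i < k)%N ->
  (0 < D i)%N -> small_degree_lead i -> key_poly_lead i ->
  (forall l, (size (b l) <= D i)%N) -> (b0 < n)%N -> b b0 != 0 ->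
  exists W (Q : {poly L}) bt C p,
  [/\ xlead (pi i.+1 (\sum_(l < n) b l * ph i ^+ l)) W p,
      [/\ Q != 0, Q \is a polyOver (E i), (bt < q i.+1)%N &
        forall l, Q`_l != 0 -> (bt + q i.+1 * l < n)%N],
      p`_0 = z i.+1 ^+ C * Q.[z i.+1] &
      z i.+1 ^+ sn i.+1 * p`_1 =
        z i.+1 ^+ C * (bt%:R * Q.[z i.+1] + (q i.+1)%:R * (z i.+1 * (Q^`()).[z i.+1]))].
Proof.
move=> ik D0 R J sb b0n nzb0; have wi := weierstrass_data_all (ltnW ik).
have [z0 q0 _ _ fm] := step_facts ik wi; have [_ qs] := sn_facts ik wi.
have [_ _ piS] := pi_step ik (param_all (ltnW ik)); have c0 := c_zero ik wi.
have [u [v [lam0 [phE lu lam00 lam0E]]]] := J.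
have /choice[wl wlP] : forall l, exists wl : nat * L, b l != 0 ->
    [/\ lead (i == 0%N) (pi i (b l)) wl.1 wl.2, wl.2 != 0 & wl.2 \in E i].
  move=> l; case: (eqVneq (b l) 0) => [_|bl0]; first by exists (0%N, 0).
  by have [w [lam wP]] := R _ (sb l) bl0; exists (w, lam).
have [|W [Q [bt [C [p [xl _ Qp p0 p1]]]]]] := @core_step _ _ (E i) _ _ _ _ _ (c i.+1)
    q0 c0 z0 qs n (i == 0%N) (fun l => b l != 0) (fun l => pi i (b l))
    (fun l => (wl l).1) (fun l => (wl l).2) u v lam0 fm _ (fun l _ nz => wlP l nz)
    lu lam00 lam0E b0 b0n nzb0.
  by move=> l _ /negPn/eqP ->; apply: rmorph0.
exists W, Q, bt, C, p; split=> //.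
suff -> : pi i.+1 (\sum_(l < n) b l * ph i ^+ l) =
   \sum_(l < n) rho (z i.+1) (q i.+1) (m i.+1) (t i.+1) (sn i.+1) (c i.+1) (pi i (b l)) *
     rho (z i.+1) (q i.+1) (m i.+1) (t i.+1) (sn i.+1) (c i.+1) (xx ^+ v * 'X * u) ^+ l by [].
by rewrite pi_sum; apply: eq_bigr => l _; rewrite piM piX !piS phE.
Qed.

Lemma step_field i : (i < k)%N ->
  [/\ P i.+1 \is a polyOver (E i), P i.+1 \is monic, irr_over (E i) (P i.+1),
      root (P i.+1) (z i.+1) & (0 < ell i.+1)%N].
Proof.
move=> ik; have [_ [dg [rPz _]]] := hstep ik.
have [_ [_ [_ [PE [mP [irP _]]]]]] := dg; split=> //.
by have [sP _] := irP; rewrite /ell -ltnS prednK // ltnW.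
Qed.

Lemma small_degree_lead_step i : (i < k)%N -> (0 < D i)%N -> small_degree_lead i -> key_poly_lead i ->
  forall A : {poly (ser K)}, (size A <= q i.+1 * ell i.+1 * D i)%N -> A != 0 ->
  exists w lam, [/\ lead false (pi i.+1 A) w lam, lam != 0 & lam \in E i.+1].
Proof.
move=> ik D0 R J A sA A0; have wi := weierstrass_data_all (ltnW ik).
have [z0 q0 _ _ fm] := step_facts ik wi.
have [PE mP irP rPz ell0] := step_field ik.
have [_ mph sph _ _] := ph_facts (ltnW ik).
have [b [AE sb]] := base_expansion mph sph sA.
set n := (q i.+1 * ell i.+1)%N in AE.
have [b0 b0n nzb0] : exists2 b0, (b0 < n)%N & b b0 != 0.
  apply: contrapT => no; case/eqP: A0; rewrite AE big1 // => l _.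
  case: (eqVneq (b l) 0) => [->|nz]; first by rewrite mul0r.
  by case: no; exists l.
have [W [Q [bt [C [p [xl [Q0 QE btq Qn] p0 _]]]]]] := core_step_pi ik D0 R J sb b0n nzb0.
exists W, p`_0; split.
- by exists p; split=> //; rewrite AE.
- rewrite p0 mulf_neq0 ?expf_neq0 // (horner_small_neq0 PE mP irP rPz) //.
  (* A nonzero coefficient in degree [j] gives [q j <= bt + q j < q ell], so [deg Q < ell]. *)
  apply/leq_sizeP => j lj; apply/eqP; apply: contraTT lj => /Qn lt.
  rewrite -ltnNge -(ltn_pmul2l q0); exact: leq_ltn_trans (leq_addl _ _) lt.
- rewrite p0 rpredM ?rpredX ?tower_z // rpred_horner ?tower_z //.
  by apply: polyOverS QE => x; apply: subvP; apply: tower_sub.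
Qed.

Lemma small_degree_inj i n : (forall A : {poly (ser K)}, (size A <= n)%N -> A != 0 ->
    exists w lam, [/\ lead (i == 0%N) (pi i A) w lam, lam != 0 & lam \in E i]) ->
  forall A : {poly (ser K)}, (size A <= n)%N -> (pi i A)`_0 = 0 -> A = 0.
Proof.
move=> R A sA A0; apply: contrapT => /eqP An0.
have [w [lam [lA lam0 _]]] := R A sA An0.
by have := lead_coef0_neq0 lA lam0; rewrite A0 eqxx.
Qed.

Definition key_poly_facts i := [/\ D i = (e i * \dim (E i))%N, small_degree_lead i & key_poly_lead i].

Lemma divX_ev0 (T : {poly (ser L)}) : T`_0 = 0 ->
  exists2 u : {poly (ser L)}, T = 'X * u & u`_0 = T`_1.
Proof.
move=> T0; exists (drop_poly 1 T); last by rewrite coef_drop_poly.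
rewrite -['X]expr1 mulrC -{1}(poly_take_drop 1 T) [X in X + _](_ : _ = 0) ?add0r //.
by apply/polyP => j; rewrite coef_take_poly coef0; case: j => [|j] /=; rewrite ?T0.
Qed.

Lemma key_poly_facts_step i : (i < k)%N -> key_poly_facts i -> key_poly_facts i.+1.
Proof.
move=> ik [DE R J]; have wi := weierstrass_data_all (ltnW ik).
have [z0 q0 N0 qN fm] := step_facts ik wi; have [_ _ _ Nd] := wi.
have [PE mP irP rPz ell0] := step_field ik.
have pa := param_all (ltnW ik); have [e0 _ _ _ _] := pa.
have [_ eE piS] := pi_step ik pa.
have D0 : (0 < D i)%N by rewrite DE muln_gt0 e0 adim_gt0.
have Rs := small_degree_lead_step ik D0 R J.
have nE : (q i.+1 * ell i.+1 * D i = e i.+1 * \dim (E i.+1))%N.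
  by rewrite /E /= (irr_dim PE mP irP rPz) eE DE; ring.
have D'E := key_poly_degree ik nE (@small_degree_inj i.+1 _ Rs).
split; first by rewrite D'E.
  by move=> A; rewrite D'E; apply: Rs.
have [_ mph sph _ _] := ph_facts (ltnW ik).
have [_ mph' sph' _ van'] := ph_facts ik.
set n := (q i.+1 * ell i.+1)%N.
have sphn j : size (ph i ^+ j) = (j * D i).+1.
  elim: j => [|j IH]; first by rewrite expr0 size_poly1.
  by rewrite exprS size_monicM ?monic_neq0 ?rpredX // sph IH addSn /= addnS mulSn.
have mphn : ph i ^+ n \is monic by apply: rpredX.
(* [phi_{i+1}] and [phi_i^n] are monic of the same degree, so the expansion of [phi_{i+1}] has top
   digit 1 in position [n]. *)
have sdiff : (size (ph i.+1 - ph i ^+ n)%R <= n * D i)%N.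
  apply/leq_sizeP => j; rewrite coefB leq_eqVlt => /orP[/eqP <-|lt].
    move: mph' mphn; rewrite !monicE !lead_coefE sph' sphn D'E /= => /eqP -> /eqP ->.
    by rewrite subrr.
  by rewrite !nth_default ?subrr // ?sphn ?sph' ?D'E.
have [b [bE sb]] := base_expansion mph sph sdiff.
pose b' l := if l == n then 1 else b l.
have phE : ph i.+1 = \sum_(l < n.+1) b' l * ph i ^+ l.
  rewrite big_ord_recr /= {2}/b' eqxx mul1r -[LHS](subrK (ph i ^+ n)) {1}bE.
  by congr (_ + _); apply: eq_bigr => l _; rewrite /b' ltn_eqF.
have sb' l : (size (b' l) <= D i)%N by rewrite /b'; case: eqP => // _; rewrite size_poly1.
have nzb' : b' n != 0 by rewrite /b' eqxx oner_neq0.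
have [W [Q [bt [C [p [xl [Q0 QE btq Qn] p0 p1]]]]]] := core_step_pi ik D0 R J sb' (ltnSn n) nzb'.
rewrite -phE in xl.
(* The vanishing on the curve kills the value at [y = 0] of the initial form. *)
have Qz : Q.[z i.+1] = 0.
  have : p`_0 = 0 by rewrite -(xlead_coef 0 xl) van' ser0.
  by rewrite p0 => /eqP; rewrite mulf_eq0 expf_eq0 (negbTE z0) andbF => /eqP.
have sQ : (size Q <= (ell i.+1).+1)%N.
  apply/leq_sizeP => j lj; apply/eqP; apply: contraTT lj => /Qn lt.
  by rewrite -ltnNge ltnS -(leq_pmul2l q0) -ltnS; apply: leq_ltn_trans (leq_addl _ _) lt.
have elld : (ell i.+1 <= d)%N.
  by apply: leq_trans Nd; apply: leq_trans qN; rewrite mulnAC leq_pmull // muln_gt0 q0.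
have qd : (q i.+1 <= d)%N.
  by apply: leq_trans Nd; apply: leq_trans qN; rewrite -mulnA leq_pmulr // muln_gt0 ell0.
have ellL : (ell i.+1)%:R != 0 :> L by apply: (natr_neq0_le _ hchar).
have qL : (q i.+1)%:R != 0 :> L by apply: (natr_neq0_le _ hchar).
have Q'z := horner_deriv_neq0 PE mP irP rPz QE Q0 sQ Qz ellL.
(* The summand with [bt] disappears, leaving [q z Q'(z)] up to powers of [z], a nonzero value. *)
rewrite Qz mulr0 add0r in p1.
have zs0 : z i.+1 ^+ sn i.+1 != 0 by rewrite expf_neq0.
have p1E : p`_1 = z i.+1 ^+ C * ((q i.+1)%:R * (z i.+1 * Q^`().[z i.+1])) / z i.+1 ^+ sn i.+1.
  by rewrite -p1 mulrC mulKf.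
have [T TE evT] := xl.
(* Dividing by [x^W] keeps divisibility by [y]; the cofactor of [y] is the sought unit. *)
have T0 : T`_0 = 0.
  apply: (@sXn_inj _ W) => /=; rewrite mulr0 -coefCM polyC_exp -TE.
  exact: van'.
have [u uE u0] := divX_ev0 T0.
exists u, W, p`_1; split.
- by rewrite TE uE mulrA.
- exists (ev0 u); split=> //; first by exists u; rewrite ?mul1r.
  by rewrite coef_ev0 u0 -coef_ev0 evT.
- by rewrite p1E mulf_neq0 ?invr_eq0 // mulf_neq0 ?expf_neq0 // !mulf_neq0.
- have zE := tower_z i; rewrite p1E rpredM ?rpredV ?rpredX //.
  rewrite rpredM ?rpredX // rpredM ?rpred_nat // rpredM // rpred_horner //.
  apply/polyOverP => j; rewrite coef_deriv rpredMn //.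
  by have /polyOverP/(_ j.+1) := QE; apply: subvP; apply: tower_sub.
Qed.

Lemma key_poly_facts_all i : (i <= k)%N -> key_poly_facts i.
Proof.
elim: i => [_|i IH ik]; last exact: key_poly_facts_step ik (IH (ltnW ik)).
by have [? ? _] := key_poly_facts_base; split=> //; apply: key_poly_lead_base.
Qed.

(** * Orders of multi-adic expansions *)

Fixpoint phisum i (g : (nat -> nat) -> ser K) (b : nat -> nat) : {poly (ser K)} :=
  if i is i'.+1 then
    \sum_(x < q i * ell i) phisum i' g (upd b i' x) * ph i' ^+ x
  else (g b)%:P.

(** The pairs [(b', j)] for which [x^j phi_0^(b'_0) ... phi_{i-1}^(b'_{i-1})] occurs in
    [phisum i g b]; powers of [phi_{-1} = x] are collected in the series [g b'], and the entries of
    [b] from [i] on are parameters. *)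
Definition admissible i (g : (nat -> nat) -> ser K) b b' j :=
  [/\ forall l, (i <= l)%N -> b' l = b l,
      forall l, (l < i)%N -> (b' l < q l.+1 * ell l.+1)%N & g b' j != 0].

(** The part of [<B, V>] due to [phi_{-1}, ..., phi_{i-1}], where [x] has value [e i]. *)
Definition wval i (vl : nat -> nat) (b' : nat -> nat) j :=
  (j * e i + \sum_(l < i) b' l * vl l)%N.

(** The order equals the minimum of the values and is not merely bounded below by it. Zero has no
    order, whence the first alternative; [g] and [b] are arbitrary so that each digit of a longer
    expansion is covered. *)
Definition expansion_lead i vl := forall g b,
  ((forall b' j, ~ admissible i g b b' j) /\ phisum i g b = 0) \/
  exists w lam, [/\ lead (i == 0%N) (pi i (phisum i g b)) w lam, lam != 0, lam \in E i,
    exists b' j, admissible i g b b' j /\ w = wval i vl b' j &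
    forall b' j, admissible i g b b' j -> (w <= wval i vl b' j)%N].

Definition level_values i vl :=
  [/\ forall l, (l < i)%N -> exists2 lam, lead (i == 0%N) (pi i (ph l)) (vl l) lam & lam != 0,
     exists u lam, [/\ pi i (ph i) = xx ^+ vl i * 'X * u, lead (i == 0%N) u 0 lam,
        lam != 0 & lam \in E i] & expansion_lead i vl].

Lemma level_values_base : level_values 0 (fun _ => 0%N).
Proof.
have [_ R _] := key_poly_facts_all (leq0n k); have [D1 _ piX] := key_poly_facts_base.
have [e1 _ _ _] := pi_base.
split=> //.
  by exists 1, 1; rewrite piX expr0 mul1r mulr1 oner_neq0 rpred1; split=> //; apply: lead1.
move=> g b; have admE b' j : admissible 0 g b b' j <-> b' = b /\ g b j != 0.
  split=> [[bb _ gj]|[-> gj]]; last by split.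
  by have -> : b = b'; [apply: funext => l; rewrite bb | split].
case: (eqVneq (g b) 0) => [g0|g0].
  by left; rewrite /= g0 polyC0; split=> // b' j /admE[_]; rewrite g0 eqxx.
right; have D1' : (size (g b)%:P <= D 0)%N by rewrite D1 e1 dimv1 size_polyC; case: (_ != 0).
have [|w [lam [lA lam0 lamE]]] := R _ D1'; first by rewrite polyC_eq0.
have cE j : (pi 0 (g b)%:P)`_0 j = in_alg L (g b j).
  by rewrite pi_zeroE map_polyC comp_polyC coefC.
have gw : g b w != 0 by apply: contra_neq lam0 => gw; rewrite -(leadW lA) cE gw rmorph0.
exists w, lam; split=> //.
  exists b, w; split; first exact/admE.
  by rewrite /wval e1 muln1 big_ord0 addn0.
move=> b' j /admE[_ gj]; rewrite /wval e1 muln1 big_ord0 addn0 leqNgt.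
apply/negP => jw; case: lA => p [xl _ _]; have := xlead_low 0 xl jw.
by rewrite cE => /eqP; rewrite fmorph_eq0 (negbTE gj).
Qed.

Lemma admissible_digit i g b b' j x :
  admissible i g (upd b i x) b' j -> (x < q i.+1 * ell i.+1)%N -> admissible i.+1 g b b' j /\ b' i = x.
Proof.
move=> [bu bl gj] xlt; have b'i : b' i = x by rewrite bu // /upd eqxx.
split=> //; split=> // l il; first by rewrite bu ?(ltnW il) // /upd gtn_eqF.
by move: il; rewrite ltnS leq_eqVlt => /orP[/eqP ->|/bl //]; rewrite b'i.
Qed.

Lemma digit_admissible i g b b' j : admissible i.+1 g b b' j ->
  admissible i g (upd b i (b' i)) b' j /\ (b' i < q i.+1 * ell i.+1)%N.
Proof.
move=> [bu bl gj]; split; last exact: bl.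
split=> // [l|l il]; last exact/bl/ltnW.
rewrite leq_eqVlt /upd => /orP[/eqP <-|il]; first by rewrite eqxx.
by rewrite gtn_eqF // bu.
Qed.

(** One step multiplies orders by [q] and adds [m] for the factor [y] carried by [phi_i]. Each digit
    already realizes the minimum over the lower exponents, so the minimum over digits found by
    [core_step] is the overall one. *)
Lemma level_values_step i vl : (i < k)%N -> level_values i vl -> exists vl', level_values i.+1 vl'.
Proof.
move=> ik [Vl [u [lam0 [phE lu lam00 lam0E]]] Qi]; have wi := weierstrass_data_all (ltnW ik).
have [z0 q0 _ _ fm] := step_facts ik wi; have [_ qs] := sn_facts ik wi.
have [_ eE piS] := pi_step ik (param_all (ltnW ik)); have c0 := c_zero ik wi.
have [PE mP irP rPz ell0] := step_field ik.
have [_ _ [u' [v' [lam' [phE' lu' lam'0 lam'E]]]]] := key_poly_facts_all ik.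
pose vl' l := if (l < i)%N then (q i.+1 * vl l)%N else
   if l == i then (q i.+1 * vl i + m i.+1)%N else v'.
have vl'i : vl' i.+1 = v' by rewrite /vl' ltnNge leqnSn /= gtn_eqF.
have wvE b' j : wval i.+1 vl' b' j =
    (q i.+1 * wval i vl b' j + b' i * (q i.+1 * vl i + m i.+1))%N.
  rewrite /wval big_ord_recr /= {2}/vl' ltnn eqxx addnA eE [X in _ = (X + _)%N]mulnDr big_distrr /=.
  congr (_ + _ + _)%N; first by rewrite mulnA mulnC.
  by apply: eq_bigr => l _; rewrite /vl' ltn_ord mulnCA.
exists vl'; split.
- move=> l; rewrite ltnS leq_eqVlt => /orP[/eqP ->|li].
    exists (((z i.+1 ^+ t i.+1) ^+ vl i * lam0) * z i.+1 ^+ sn i.+1); last first.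
      by rewrite !mulf_neq0 ?expf_neq0.
    rewrite piS phE /vl' ltnn eqxx.
    exists (((z i.+1 ^+ t i.+1) ^+ vl i * lam0)%:P * ('X + (z i.+1 ^+ sn i.+1)%:P)).
    split=> //; first exact: rho_leadX q0 c0 _ _ _ _ fm lu.
    by rewrite coefCM coefD coefX coefC add0r.
  have [lam lB lamn0] := Vl l li; exists ((z i.+1 ^+ t i.+1) ^+ vl l * lam); last first.
    by rewrite mulf_neq0 ?expf_neq0.
  rewrite piS /vl' li; exists ((z i.+1 ^+ t i.+1) ^+ vl l * lam)%:P; split=> //; last by rewrite coefC.
  exact: rho_lead q0 c0 _ _ _ _ fm lB.
- by exists u', lam'; rewrite vl'i.
move=> g b; set n := (q i.+1 * ell i.+1)%N.
(* The boolean records which alternative of [expansion_lead] holds for the digit [x], and serves as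
   the predicate [nz] of [core_step]. *)
have /choice[wl wlP] : forall x, exists wl : bool * (nat * L),
    if wl.1 then
      [/\ lead (i == 0%N) (pi i (phisum i g (upd b i x))) wl.2.1 wl.2.2, wl.2.2 != 0,
        wl.2.2 \in E i,
        exists b' j, admissible i g (upd b i x) b' j /\ wl.2.1 = wval i vl b' j &
        forall b' j, admissible i g (upd b i x) b' j -> (wl.2.1 <= wval i vl b' j)%N]
    else (forall b' j, ~ admissible i g (upd b i x) b' j) /\ phisum i g (upd b i x) = 0.
  move=> x; have [no|[w [lam wP]]] := Qi g (upd b i x); first by exists (false, (0%N, 0)).
  by exists (true, (w, lam)).
case: (pselect (exists2 x, (x < n)%N & (wl x).1)) => [[x0 x0n nzx0]|no]; last first.
  left; split=> [b' j /digit_admissible[ad lt]|/=].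
    have := wlP (b' i); case: ifP => [nz _|_ [na _]]; last exact: na ad.
    by apply: no; exists (b' i).
  rewrite big1 // => x _; have := wlP x; case: ifP => [nz _|_ [_ ->]]; last by rewrite mul0r.
  by case: no; exists (nat_of_ord x).
right.
have [||W [Q [bt [C [p [xl [[x1 [x1n nzx1 WE]] minW] [Q0 QE btq Qn] p0 _]]]]]] :=
    @core_step _ _ (E i) _ _ _ _ _ (c i.+1)
    q0 c0 z0 qs n (i == 0%N) (fun x => (wl x).1) (fun x => pi i (phisum i g (upd b i x)))
    (fun x => (wl x).2.1) (fun x => (wl x).2.2) u (vl i) lam0 fm _ _
    lu lam00 lam0E x0 x0n nzx0.
- move=> x _ /negbTE nz; have := wlP x; rewrite nz => -[_ ->]; exact: rmorph0.
- by move=> x _ nz; have := wlP x; rewrite nz => -[].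
exists W, p`_0; split.
- exists p; split=> //.
  suff -> : pi i.+1 (phisum i.+1 g b) =
     \sum_(x < n) rho (z i.+1) (q i.+1) (m i.+1) (t i.+1) (sn i.+1) (c i.+1)
        (pi i (phisum i g (upd b i x))) *
       rho (z i.+1) (q i.+1) (m i.+1) (t i.+1) (sn i.+1) (c i.+1) (xx ^+ vl i * 'X * u) ^+ x by [].
  by rewrite pi_sum; apply: eq_bigr => x _; rewrite piM piX !piS phE.
- rewrite p0 mulf_neq0 ?expf_neq0 // (horner_small_neq0 PE mP irP rPz) //.
  apply/leq_sizeP => j lj; apply/eqP; apply: contraTT lj => /Qn lt.
  rewrite -ltnNge -(ltn_pmul2l q0); exact: leq_ltn_trans (leq_addl _ _) lt.
- rewrite p0 rpredM ?rpredX ?tower_z // rpred_horner ?tower_z //.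
  by apply: polyOverS QE => x; apply: subvP; apply: tower_sub.
- have := wlP x1; rewrite nzx1 => -[_ _ _ [b' [j [ad wE]]] _].
  have [ad' b'i] := admissible_digit ad x1n.
  by exists b', j; split=> //; rewrite wvE b'i WE wE.
- move=> b' j /digit_admissible[ad lt]; rewrite wvE.
  have := wlP (b' i); case: ifP => [nz|_ [na _]]; last by case: (na _ _ ad).
  move=> [_ _ _ _ /(_ _ _ ad) le]; apply: leq_trans (minW _ lt nz) _.
  by rewrite leq_add2r leq_mul2l le orbT.
Qed.

Lemma level_values_all i : (i <= k)%N -> exists vl, level_values i vl.
Proof.
elim: i => [_|i IH ik]; first by exists (fun _ => 0%N); apply: level_values_base.
by have [vl V] := IH (ltnW ik); apply: level_values_step V.
Qed.

Lemma comp_piE n (A : {poly (ser K)}) : (size A <= n.+1)%N ->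
  comp_pi (mu k) (alpha k) (e k) (r k) (S k) n (toB A) = toB (pi k A).
Proof.
move=> sA; have [e0 _ _ _ _] := param_all (leqnn k).
rewrite /comp_pi -toB_Yp bmapL_toB toB_bxsubst // toB_ysubst; last first.
  by apply: leq_trans (size_poly _ _) _; apply: leq_trans (size_poly _ _) _.
by rewrite -map_poly_comp.
Qed.

Lemma phisum_eq0 i (g : (nat -> nat) -> ser K) b :
  (forall b', (forall l, (i <= l)%N -> b' l = b l) -> g b' = 0) -> phisum i g b = 0.
Proof.
elim: i b => [|i IH] b g0 /=; first by rewrite g0 // polyC0.
rewrite big1 // => x _; rewrite IH ?mul0r // => b' b'E; apply: g0 => l il.
by rewrite b'E ?(ltnW il) // /upd gtn_eqF.
Qed.

(** The ranges of summation differ, but [g] vanishes outside their intersection. *)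
Lemma psum_phisum M i (g : (nat -> nat) -> ser K) b :
  (forall b' l, g b' != 0 -> (l < i)%N -> (b' l < q l.+1 * ell l.+1)%N /\ (b' l < M)%N) ->
  psum M i (fun b' => (g b')%:P * \prod_(l < i) ph l ^+ b' l) b = phisum i g b.
Proof.
elim: i b => [|i IH] b bd /=; first by rewrite big_ord0 mulr1.
transitivity (\sum_(x < M) phisum i g (upd b i x) * ph i ^+ x).
  apply: eq_bigr => x _; rewrite -IH; last by move=> b' l gn li; apply: bd => //; apply: ltnW.
  rewrite -[X in _ * ph i ^+ X](_ : upd b i x i = x); last by rewrite /upd eqxx.
  rewrite -(@psum_mulr _ M i i _ (fun y => ph i ^+ y) (upd b i x) (leqnn i)); congr psum.
  by apply: funext => b'; rewrite big_ord_recr /= mulrA.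
apply: (big_ord_change (f := fun x => phisum i g (upd b i x) * ph i ^+ x)) => x nz.
apply: contrapT => no; case/eqP: nz; rewrite phisum_eq0 ?mul0r // => b' b'E.
case: (eqVneq (g b') 0) => // gn; case: no.
by have [] := bd b' i gn (ltnSn i); rewrite b'E // /upd eqxx.
Qed.

(** * The expansion of [F] and the valuations *)

Variables (f : {ffun 'I_k.+2 -> nat} -> K) (V : nat -> nat) (vF : nat).
Hypothesis hf1 : forall B, f B != 0 ->
     forall i : 'I_k, (B (inord i.+1) < q i.+1 * (size (P i.+1)).-1)%N.
Hypothesis hf2 : exists M : nat,
     (forall B, f B != 0 -> forall i : 'I_k.+2, i != ord0 -> (B i <= M)%N) /\
     forall i j, F i j =
       \sum_(B : {ffun 'I_k.+2 -> 'I_(maxn j M).+1})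
          f [ffun l => val (B l)] *
          bmul (bXn K (B ord0))
               (\big[@bmul K/bone K]_(l < k.+1) bexp (phi l) (B (inord l.+1))) i j.

(* [B_{-1} = j] and [B_l = b l]; so [gf b] is the coefficient of [\prod phi_l^(b l)] in [K[[x]]]. *)
Definition expo (b : nat -> nat) j : {ffun 'I_k.+2 -> nat} :=
  [ffun l : 'I_k.+2 => if val l is l'.+1 then b l' else j].
Definition gf (b : nat -> nat) : ser K := fun j => f (expo b j).

Lemma expoE b j l : (l <= k)%N -> expo b j (inord l.+1) = b l.
Proof. by move=> lk; rewrite ffunE /= inordK. Qed.

(** The coefficientwise expansion, whose range depends on [j], is regrouped into one identity of
    polynomials in [phi_k] over [K[[x]]]. For a fixed [j], the bound [mj] exceeds both the exponents
    of [x] that matter and all the others. *)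
Lemma Fp_expansion : exists M, (forall B, f B != 0 -> (B ord_max <= M)%N) /\
  Fp = \sum_(n < M.+1) phisum k gf (upd (fun _ => 0%N) k n) * ph k ^+ n.
Proof.
have [M [hM hFM]] := hf2; exists M; split=> [B fB|].
  by apply: hM fB _ _; apply/eqP => /(congr1 val).
have [tF _ _] := monicY_ofB hF.
apply: toB_inj; rewrite tF; apply: funext => i; apply: funext => j.
rewrite hFM; set mj := (maxn j M).+1.
pose b0 := fun _ : nat => 0%N.
pose Gm (b : nat -> nat) : {poly (ser K)} := (gf b)%:P * \prod_(l < k.+1) ph l ^+ b l.
have bdg b l : gf b != 0 -> (l <= k)%N -> (b l <= M)%N.
  move=> gn lk; have [j' fn] : exists j', f (expo b j') != 0.
    apply: contrapT => no; case/eqP: gn; apply: funext => j'; apply: contrapT => fn.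
    by apply: no; exists j'; apply/eqP.
  rewrite -(expoE b j' lk); apply: hM fn _ _.
  by apply/eqP => /(congr1 val) /=; rewrite inordK.
have bdq b l : gf b != 0 -> (l < k)%N -> (b l < q l.+1 * ell l.+1)%N.
  move=> gn lk; have [j' fn] : exists j', f (expo b j') != 0.
    apply: contrapT => no; case/eqP: gn; apply: funext => j'; apply: contrapT => fn.
    by apply: no; exists j'; apply/eqP.
  by have := hf1 fn (Ordinal lk); rewrite /= expoE // ltnW.
have -> : \sum_(n < M.+1) phisum k gf (upd b0 k n) * ph k ^+ n = psum mj k.+1 Gm b0.
  transitivity (\sum_(n < mj) phisum k gf (upd b0 k n) * ph k ^+ n).
    apply: (big_ord_change (f := fun n => phisum k gf (upd b0 k n) * ph k ^+ n)) => x nz.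
    have xM : (x <= M)%N.
      rewrite leqNgt; apply/negP => Mx; case/eqP: nz; rewrite phisum_eq0 ?mul0r // => b' b'E.
      apply: contrapT => /eqP gn; have := bdg b' k gn (leqnn k).
      by rewrite b'E // /upd eqxx leqNgt Mx.
    by rewrite ltnS xM /mj ltnS leq_max xM orbT.
  apply: eq_bigr => x _; rewrite -(@psum_phisum mj); last first.
    move=> b' l gn lk; split; first exact: bdq.
    by rewrite /mj ltnS leq_max (bdg _ _ gn (ltnW lk)) orbT.
  rewrite -[X in _ * ph k ^+ X](_ : upd b0 k x k = x); last by rewrite /upd eqxx.
  rewrite -(@psum_mulr _ mj k k _ (fun y => ph k ^+ y) (upd b0 k x) (leqnn k)); congr psum.
  by apply: funext => b'; rewrite /Gm big_ord_recr /= mulrA.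
rewrite -psum_ffun /toB coef_sum ser_sum.
have termE (B : {ffun 'I_k.+1 -> 'I_mj}) : (Gm (extend B b0))`_i j =
   \sum_(x < mj) gf (extend B b0) x *
     bmul (bXn K x) (toB (\prod_(l < k.+1) ph l ^+ extend B b0 l)) i j.
  rewrite /Gm coefCM serM; set T := \prod_(l < k.+1) _.
  have xE x : bmul (bXn K x) (toB T) i j = if (x <= j)%N then T`_i (j - x)%N else 0.
    by rewrite -toB_Xn -toBM /toB coefCM serXnM ltnNge; case: (x <= j)%N.
  (* The convolution stops at [x = j]; the added terms vanish since [x^x] then has order greater
     than [j]. *)
  rewrite (big_ord_widen mj (fun x => gf (extend B b0) x * T`_i (j - x)%N)); last first.
    by rewrite /mj ltnS leq_maxl.
  rewrite big_mkcond; apply: eq_bigr => x _; rewrite xE ltnS.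
  by case: ifP => // _; rewrite mulr0.
under [RHS]eq_bigr => B _ do rewrite termE.
rewrite exchange_big pair_big /=.
(* Separates the exponent of [phi_{-1} = x] from the others. *)
pose h (p : 'I_mj * {ffun 'I_k.+1 -> 'I_mj}) : {ffun 'I_k.+2 -> 'I_mj} :=
  [ffun l : 'I_k.+2 => if unlift ord0 l is Some l' then p.2 l' else p.1].
pose h' (B : {ffun 'I_k.+2 -> 'I_mj}) : 'I_mj * {ffun 'I_k.+1 -> 'I_mj} :=
  (B ord0, [ffun l => B (lift ord0 l)]).
rewrite (reindex h) /=; last first.
  exists h' => [[x B] _|B _]; rewrite /h /h'.
    congr (_, _); first by rewrite ffunE unlift_none.
    by apply/ffunP => l; rewrite !ffunE liftK.
  apply/ffunP => l; rewrite ffunE; case: unliftP => [l' ->|->] //.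
  by rewrite ffunE.
apply: eq_bigr => -[x B] _ /=; rewrite /gf.
have hS (l : 'I_k.+1) : h (x, B) (inord l.+1) = B l.
  rewrite ffunE (_ : inord l.+1 = lift ord0 l) ?liftK //.
  by apply: val_inj; rewrite /= inordK // ltnS.
have exE (l : 'I_k.+1) : extend B b0 l = B l by rewrite /extend valK.
have -> : [ffun l => val (h (x, B) l)] = expo (extend B b0) x.
  apply/ffunP => l; rewrite !ffunE; case: unliftP => [l' ->|->] //=.
  by rewrite exE.
have -> : h (x, B) ord0 = x by rewrite ffunE unlift_none.
congr (_ * bmul _ _ i j); rewrite (toB_prod _ (fun l => ph l ^+ extend B b0 l)).
apply: eq_bigr => l _; rewrite hS exE toBX.
by have [-> _ _ _ _] := ph_facts (ltnSE (ltn_ord l)).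
Qed.

Hypothesis hV : forall i, (i <= k.+1)%N ->
     bord (comp_pi (mu k) (alpha k) (e k) (r k) (S k)
             (if i == 0%N then 0%N else D i.-1)
             (if i == 0%N then bXn K 1 else phi i.-1)) (V i).
Hypothesis hvF : bord (comp_pi (mu k) (alpha k) (e k) (r k) (S k) d F) vF.

(** An order with nonzero initial form is unique. The forms are the constant [mu k] for [x], one
    with nonzero constant term for [phi_l] with [l < k], and [y] times such a form for [phi_k]. *)
Lemma V_values vl : level_values k vl -> V 0%N = e k /\ forall l, (l <= k)%N -> V l.+1 = vl l.
Proof.
move=> [Vl [u [lam [phE lu lam0 _]]] _]; have [e0 mu0 _ _ _] := param_all (leqnn k).
split.
  have := hV (leq0n _); rewrite /= -toB_Xn comp_piE ?size_polyC_leq1 // => /xlead_bord xb.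
  apply/esym; apply: (xb _ (mu k)%:P); rewrite ?polyC_eq0 //.
  exists (sC (mu k))%:P; last by rewrite ev0C /sC mul1r.
  rewrite /pi pimC -polyC_exp -polyCM mulrC; congr _%:P.
  have -> : iota_ser (mu k) (e k) (sX K ^+ 1) = xsub (mu k) (e k) (smap (in_alg L) (sX K)) by [].
  have -> : smap (in_alg L) (sX K) = sX L by apply: funext => j; rewrite /smap /sX rmorph_nat.
  exact: xsubX.
move=> l lk; have := hV (lk : (l.+1 <= k.+1)%N); have [tp _ sp _ _] := ph_facts lk.
rewrite /= -tp comp_piE ?sp // => /xlead_bord xb; apply/esym.
move: lk; rewrite leq_eqVlt => /orP[/eqP lk|/Vl[lam' [p [xl p0 _]] lam'0]]; last first.
  by apply: xb xl _; apply: contraNneq lam'0 => p00; rewrite -p0 p00 coef0.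
subst l; apply: (xb _ ('X * ev0 u)).
  by exists ('X * u); rewrite ?mulrA // rmorphM /= ev0X.
apply/eqP => /(congr1 (fun p : {poly L} => p`_1)); rewrite coefXM /= coef_ev0 coef0.
by rewrite (leadW lu) => /eqP; rewrite (negbTE lam0).
Qed.

(** The exponent of [x] is [v_k(F)] because at [x = 0] neither the unit nor the monic [H_k]
    vanishes. *)
Lemma F_pullback : exists2 T, pi k Fp = xx ^+ vF * (T * Hp k) & T`_0 0%N != 0.
Proof.
have [a' [T [lam [piE lT lam0]]]] := pi_F (leqnn k).
have T0 : T`_0 0%N != 0 by rewrite (leadW lT).
exists T => //; suff <- : a' = vF by [].
have [tF _ sF] := monicY_ofB hF.
move: hvF; rewrite -tF comp_piE ?sF // => /xlead_bord; apply.
  by exists (T * Hp k); first exact: piE; exact: rmorphM.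
have [mH _ _ _] := weierstrass_data_all (leqnn k); have [tH mHp sHp] := monicY_ofB mH.
rewrite mulf_neq0 //.
  by apply: contraNneq T0 => ev; rewrite -coef_ev0 ev coef0.
apply/eqP => /(congr1 (fun p : {poly L} => p`_(N k))); rewrite coef0 coef_ev0.
move: mHp; rewrite monicE lead_coefE sHp /= => /eqP ->.
by rewrite ser1 => /eqP; rewrite oner_eq0.
Qed.

(** * Comparison of the two polygons *)

Definition inBB (B : {ffun 'I_k.+2 -> nat}) :=
  forall i : 'I_k, (B (inord i.+1) < q i.+1 * (size (P i.+1)).-1)%N.
Definition BV (B : {ffun 'I_k.+2 -> nat}) := (\sum_(l < k.+2) B l * V l)%N.

Definition minB i B := [/\ inBB B, B ord_max = i, f B != 0 &
  forall B', inBB B' -> B' ord_max = i -> f B' != 0 -> (BV B <= BV B')%N].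

Let b0 := fun _ : nat => 0%N.

Lemma BV_expo vl b j : level_values k vl -> BV (expo b j) = (wval k vl b j + b k * vl k)%N.
Proof.
move=> /V_values[V0 VS]; rewrite /BV big_ord_recl /= ffunE /= V0 /wval -addnA; congr (_ + _)%N.
rewrite big_ord_recr /= ffunE /= VS //; congr (_ + _)%N.
by apply: eq_bigr => l _; rewrite ffunE /= VS // ltnW.
Qed.

Lemma expo_max b j : expo b j ord_max = b k. Proof. by rewrite ffunE. Qed.

Lemma admissible_expo n b j : admissible k gf (upd b0 k n) b j ->
  [/\ inBB (expo b j), expo b j ord_max = n & f (expo b j) != 0].
Proof.
move=> [bu bl gj]; rewrite expo_max bu // /upd eqxx; split=> // i.
by rewrite expoE; [apply: bl | apply: ltnW].
Qed.

Lemma expo_surj n B : inBB B -> B ord_max = n -> f B != 0 ->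
  exists b j, admissible k gf (upd b0 k n) b j /\ B = expo b j.
Proof.
move=> BB Bn fB; pose b l := if (l <= k)%N then B (inord l.+1) else 0%N.
have BE : B = expo b (B ord0).
  apply/ffunP => -[[|l] lt]; rewrite ffunE /=; first by congr (B _); apply: val_inj.
  by rewrite /b -ltnS -ltnS lt; congr (B _); apply: val_inj; rewrite /= inordK.
exists b, (B ord0); split=> //; split; last by rewrite /gf -BE.
  move=> l; rewrite leq_eqVlt => /orP[/eqP <-|kl]; rewrite /upd.
    rewrite eqxx /b leqnn -Bn; congr (B _); apply: val_inj; by rewrite /= inordK.
  by rewrite gtn_eqF // /b leqNgt kl.
move=> l lk; rewrite /b (ltnW lk); exact: BB (Ordinal lk).
Qed.

Lemma newton_polygon_expansion p :
  newton_polygon (H k) (N k) p <->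
  lower_hull (fun p => exists i, (i <= N k)%N /\ exists B, [/\ inBB B, B ord_max = i, f B != 0,
    (forall B', inBB B' -> B' ord_max = i -> f B' != 0 -> (BV B <= BV B')%N) &
    p = (i%:Q, ((BV B)%:Z - vF%:Z)%:~R)]) p.
Proof.
have [vl Vk] := level_values_all (leqnn k); have [_ [u [lamk [phE lu lamk0 _]]] Qk] := Vk.
have [M [hM FE]] := Fp_expansion; have [T TE T0] := F_pullback.
have [mH Hw _ _] := weierstrass_data_all (leqnn k); have [tH mHp sHp] := monicY_ofB mH.
pose A n := phisum k gf (upd b0 k n).
have /choice[wl wlP] : forall n, exists wl : bool * (nat * L),
    if wl.1 then
      [/\ lead (k == 0%N) (pi k (A n)) wl.2.1 wl.2.2, wl.2.2 != 0,
        wl.2.2 \in E k,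
        exists b' j, admissible k gf (upd b0 k n) b' j /\ wl.2.1 = wval k vl b' j &
        forall b' j, admissible k gf (upd b0 k n) b' j -> (wl.2.1 <= wval k vl b' j)%N]
    else (forall b' j, ~ admissible k gf (upd b0 k n) b' j) /\ A n = 0.
  move=> n; have [no|[w [lam wP]]] := Qk gf (upd b0 k n); first by exists (false, (0%N, 0)).
  by exists (true, (w, lam)).
pose nz n := (wl n).1; pose W n := ((wl n).2.1 + n * vl k)%N.
have nzM n : nz n -> (n < M.+1)%N.
  move=> nzn; have := wlP n; rewrite -/(nz n) nzn => -[_ _ _ [b' [j [/admissible_expo[_ <- fe] _]]] _].
  exact: hM.
have WB n : nz n -> exists2 B, minB n B & BV B = W n.
  move=> nzn; have := wlP n; rewrite -/(nz n) nzn => -[_ _ _ [b' [j [ad wE]]] minw].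
  have [BB Bn fB] := admissible_expo ad; have b'k : b' k = n by rewrite -Bn expo_max.
  exists (expo b' j); last by rewrite (BV_expo _ _ Vk) b'k /W wE.
  split=> // B' BB' B'n fB'; have [b2 [j2 [ad2 BE]]] := expo_surj BB' B'n fB'.
  have b2k : b2 k = n by rewrite -B'n BE expo_max.
  by rewrite BE !(BV_expo _ _ Vk) b'k b2k leq_add2r -wE; apply: minw.
have BW n B : minB n B -> nz n /\ BV B = W n.
  move=> [BB Bn fB minb]; have nzn : nz n.
    apply: contrapT => /negP/negbTE nzn; have := wlP n; rewrite -/(nz n) nzn => -[na _].
    by have [b [j [/na]]] := expo_surj BB Bn fB.
  split=> //; have [B2 [BB2 B2n fB2 min2] <-] := WB n nzn.
  by apply/eqP; rewrite eqn_leq minb // min2.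
have /choice[Bn BnP] : forall n, exists B, nz n ->
    pi k (A n) * pi k (ph k) ^+ n = xx ^+ W n * 'X^n * B /\ B`_0 0%N != 0.
  move=> n; case nzn: (nz n); last by exists 0.
  have := wlP n; rewrite -/(nz n) nzn => -[[p' [[B1 BE evB] p0 _]] lam0 _ _ _].
  exists (B1 * u ^+ n) => _; split.
    rewrite BE phE /W exprD !exprMn -exprM [(n * _)%N]mulnC.
    have swap (x1 x2 x3 x4 x5 : {poly (ser L)}) : x1 * x2 * (x3 * x4 * x5) = x1 * x3 * x4 * (x2 * x5) by ring.
    exact: swap.
  have B10 : B1`_0 0%N = (wl n).2.2 by rewrite -coef_ev0 evB.
  rewrite -coef_ev0 rmorphM rmorphXn /= coef0M -horner_coef0 -horner_coef0 horner_exp !horner_coef0.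
  by rewrite !coef_ev0 B10 (leadW lu) mulf_neq0 ?expf_neq0.
(* Two expressions of [F o pi_k]: a unit times [x^vF H_k], and a sum of units times [x^(W n) y^n].
   The dominations [d12] and [d21] compare their minimal exponents. *)
have TS : xx ^+ vF * (T * Hp k) = \sum_(n < M.+1 | nz n) xx ^+ W n * 'X^n * Bn n.
  rewrite -TE FE pi_sum [RHS]big_mkcond; apply: eq_bigr => n _; rewrite piM piX.
  case: ifP => [nzn|nzn]; first by have [-> _] := BnP n nzn.
  have := wlP n; rewrite -/(nz n) nzn -/(A n) => -[_ ->].
  have -> : pi k 0 = 0 by exact: rmorph0.
  by rewrite mul0r.
have Bn0 n : nz n -> (Bn n)`_0 0%N != 0 by move=> /BnP[].
have Hcoef i j : (Hp k)`_i j = H k i j by rewrite -[in RHS]tH.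
have d12 i j : H k i j != 0 -> exists n, [/\ (n < M.+1)%N, nz n, (n <= i)%N & (W n <= vF + j)%N].
  rewrite -Hcoef => /(supp_mul_unit T0)[i0 [j0 [ii jj nz0]]].
  have [|n [nM nzn ni wj]] := @supp_sum _ M.+1 nz W Bn i0 (vF + j0)%N.
    by rewrite -TS coef_xxM ltnNge leq_addr /= addKn.
  exists n; split=> //; first exact: leq_trans ii.
  by apply: leq_trans wj _; rewrite leq_add2l.
have d21 n : nz n -> exists i j, [/\ (i <= n)%N, H k i j != 0 & (vF + j <= W n)%N].
  move=> nzn; have [i0 [j0 [i0n j0w]]] := @supp_sum_conv _ M.+1 nz W Bn Bn0 n (nzM n nzn) nzn.
  rewrite -TS coef_xxM; case: ltnP => [_|vj]; first by rewrite eqxx.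
  move=> /supp_mul[i' [j' [ii jj]]]; rewrite Hcoef => nz'.
  exists i', j'; split=> //; first exact: leq_trans ii i0n.
  by apply: leq_trans j0w; rewrite -leq_subRL.
have HN : H k (N k) 0%N != 0 by have [_ ->] := mH; rewrite oner_eq0.
have WN : nz (N k) /\ W (N k) = vF.
  have [n [nM nzn nN wn]] := d12 _ _ HN; rewrite addn0 in wn.
  have [i' [j' [i'n Hij vw]]] := d21 n nzn.
  have j'0 : j' = 0%N by lia.
  (* For [k > 0] the Weierstrass condition makes [y^(N k)] the only monomial of [H_k] of degree at
     most [N k] without [x], which forces [n = N k]. For [k = 0] this may fail; but there
     [pi_0(phi_0) = y], so the digits are the coefficients of [H_0] and the one of index [N 0] is
     1. *)
  case: (posnP k) => [k0|kpos]; last first.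
    have i'N : i' = N k.
      apply/eqP; rewrite eqn_leq (leq_trans i'n nN) leqNgt; apply/negP => lt.
      by rewrite j'0 Hw ?eqxx in Hij.
    have nE : n = N k by apply/eqP; rewrite eqn_leq nN -i'N.
    by rewrite -nE; split=> //; lia.
  have piX' : pi k (ph k) = 'X by have [_ _] := key_poly_facts_base; rewrite -k0.
  have AC l : pi k (A l) = (smap (in_alg L) (gf (upd b0 k l)))%:P.
    have -> : A l = (gf (upd b0 k l))%:P by rewrite /A; move: (upd _ _ _); rewrite k0.
    by rewrite k0 pi_zeroE map_polyC comp_polyC.
  have TN : (pi k Fp)`_(N k) = if (N k < M.+1)%N then smap (in_alg L) (gf (upd b0 k (N k))) else 0.
    rewrite FE pi_sum coef_sum; case: ifP => [lt|ge].
      rewrite (bigD1 (Ordinal lt)) //= big1 ?addr0 => [|l nl].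
        by rewrite piM piX piX' -/(A _) AC coefCM coefXn eqxx mulr1.
      rewrite piM piX piX' -/(A _) AC coefCM coefXn; case: eqP => [e'|]; rewrite ?mulr0 //.
      by case/eqP: nl; apply: val_inj.
    rewrite big1 // => l _; rewrite piM piX piX' -/(A _) AC coefCM coefXn.
    case: eqP => [e'|_]; last by rewrite mulr0.
    by rewrite e' ltn_ord in ge.
  have Hk1 : (pi k Fp)`_(N k) = 1.
    have -> : pi k Fp = Hp k by have [E0 _] := weierstrass_data_base; rewrite k0 pi_zeroE.
    by apply: funext => j; rewrite Hcoef; have [_ ->] := mH; rewrite ser1.
  rewrite TN in Hk1.
  have gE : smap (in_alg L) (gf (upd b0 k (N k))) = 1.
    move: Hk1; case: ifP => // _ /esym/eqP; by rewrite oner_eq0.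
  have AN : pi k (A (N k)) = 1 by rewrite AC gE.
  have nzN : nz (N k).
    apply: contrapT => /negP/negbTE nzNf; have := wlP (N k); rewrite -/(nz (N k)) nzNf => -[_ A0].
    have := AN; rewrite A0; have -> : pi k 0 = 0 by exact: rmorph0.
    by move/eqP; rewrite eq_sym oner_eq0.
  split=> //.
  have w0 : (wl (N k)).2.1 = 0%N.
    have := wlP (N k); rewrite -/(nz (N k)) nzN AN => -[lA lam0 _ _ _].
    have e0 : (1 : {poly (ser L)})`_0 = 1 by rewrite coef1.
    have := leadW lA; rewrite e0 ser1; case: eqP => // _ l0.
    by rewrite -l0 eqxx in lam0.
  have vl0 : vl k = 0%N.
    have := congr1 (fun p : {poly (ser L)} => p`_1 0%N) phE.
    have X1 : ('X : {poly (ser L)})`_1 = 1 by rewrite coefX.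
    rewrite piX' X1 ser1 -mulrA coef_xxM; case: posnP => // _ /eqP.
    by rewrite oner_eq0.
  have : (vF <= 0)%N.
    have := congr1 (fun p : {poly (ser L)} => p`_(N k) 0%N) TE.
    rewrite TN Hk1 ser1 coef_xxM; case: posnP => [->//|_] /eqP.
    by rewrite oner_eq0.
  by rewrite /W w0 vl0 muln0 leqn0 => /eqP ->.
have WvF n : nz n -> (vF <= W n)%N.
  by move=> /d21[i [j [_ _ le]]]; apply: leq_trans le; apply: leq_addr.
have ptE (w : nat) : ((w%:Z - vF%:Z)%:~R : rat) = w%:Q - vF%:Q by rewrite rmorphB.
have leQ (x y : nat) : (x <= y)%N -> x%:Q <= y%:Q :> rat by move=> xy; rewrite ler_int.
apply: (@lower_hull_eq _ _ (N k)%:Q).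
- by move=> s' [i [j [li [_ ->]]]]; apply: leQ.
- by move=> s' [i [li [B [_ _ _ _ ->]]]]; apply: leQ.
- by move=> s' [i [j [_ [_ ->]]]] /=; rewrite ler0z.
- move=> s' [i [_ [B [h1 h2 h3 h4 ->]]]] /=.
  have [nzi ->] := BW i B (And4 h1 h2 h3 h4).
  by rewrite ptE subr_ge0; apply/leQ/WvF.
- by exists (N k), 0%N; split=> //; split.
- have [nzN WNE] := WN; have [B [h1 h2 h3 h4] BE] := WB _ nzN.
  exists (N k); split=> //; exists B; split=> //.
  by rewrite BE WNE subrr.
- move=> s' [i [j [li [[Hj _] ->]]]].
  have [n [nM nzn ni wn]] := d12 i j Hj; have [B [h1 h2 h3 h4] BE] := WB _ nzn.
  exists (n%:Q, ((BV B)%:Z - vF%:Z)%:~R).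
    by exists n; split; [apply: leq_trans li | exists B].
  split; first exact: leQ.
  by rewrite /= ptE BE lerBlDl -rmorphD; apply: leQ.
- move=> s' [n [nN [B [h1 h2 h3 h4 ->]]]].
  have [nzn BE] := BW n B (And4 h1 h2 h3 h4).
  have [i [j [i_n Hij le]]] := d21 n nzn; have [v sv vj] := sord_exists Hij.
  exists (i%:Q, v%:Q); first by exists i, v; split=> //; apply: leq_trans nN.
  split; first exact: leQ.
  rewrite /= ptE BE lerBrDl -rmorphD; apply: leQ; apply: leq_trans le.
  by rewrite leq_add2l.
Qed.

End Procedure.

Theorem theorem5
  (K : fieldType) (L : fieldExtType K) (d : nat) (F : bser K) (k : nat)
  (* data of the procedure, steps 0..k *)
  (N : nat -> nat) (c : nat -> ser L) (H G U : nat -> bser L) (a : nat -> nat)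
  (q m : nat -> nat) (P : nat -> {poly L}) (z : nat -> L) (s : nat -> int) (t : nat -> nat)
  (* pi_i(x,y) = (mu_i x^(e_i), alpha_i x^(r_i) y + S_i(x)) *)
  (mu alpha : nat -> L) (e r : nat -> nat) (S : nat -> ser L)
  (* phi_i (0 <= i <= k), of degree D i *)
  (phi : nat -> bser K) (D : nat -> nat)
  (* the Phi-adic expansion; B ord0 = b_{-1}, B (inord (i.+1)) = b_i *)
  (f : {ffun 'I_k.+2 -> nat} -> K)
  (* V i = v_k(phi_{i-1}) (i = 0..k+1), vF = v_k(F) *)
  (V : nat -> nat) (vF : nat) :
  (* standing assumptions *)
  perfect K ->
  (forall p, p \in [pchar K] -> (d < p)%N) ->
  monicY F d ->
  (* step 0 *)
  N 0%N = d ->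
  (forall j, c 0%N j = inL L (- F d.-1 j / d%:R)) ->
  beq (H 0%N) (ysubst d (bmapL L F) (badd (bY L) (ofser (c 0%N)))) ->
  (* steps i -> i+1 for i < k *)
  (forall i, (i < k)%N ->
     N i <> 1%N /\
     degenerated (tower z i)
       (if i == 0%N then newton_polygon (H i) (N i)
        else principal_newton_polygon (H i) (N i))
       (H i) (q i.+1) (m i.+1)%:Z (P i.+1) (N i.+1) /\
     root (P i.+1) (z i.+1) /\
     (t i.+1 < q i.+1)%N /\
     (q i.+1)%:Z * s i.+1 - (m i.+1)%:Z * (t i.+1)%:Z = 1 /\
     (* H_i o sigma_{i+1} = x^a U G *)
     beq (ysubst (N i) (bxsubst (H i) (z i.+1 ^+ t i.+1) (q i.+1))
            (bmul (bXn L (m i.+1)) (badd (bY L) (bconst (z i.+1 ^ s i.+1)))))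
         (bmul (bXn L (a i.+1)) (bmul (U i.+1) (G i.+1))) /\
     U i.+1 0%N 0%N != 0 /\
     monicY (G i.+1) (N i.+1) /\
     (forall l, (l < N i.+1)%N -> G i.+1 l 0%N = 0) /\
     (forall j, c i.+1 j = - G i.+1 (N i.+1).-1 j / (N i.+1)%:R) /\
     beq (H i.+1) (ysubst (N i.+1) (G i.+1) (badd (bY L) (ofser (c i.+1))))) ->
  (1 < N k)%N ->
  (* pi_0 = tau_0 *)
  beq (bmul (bconst (mu 0%N)) (bXn L (e 0%N))) (bXn L 1) ->
  beq (badd (bmul (bconst (alpha 0%N)) (bmul (bXn L (r 0%N)) (bY L))) (ofser (S 0%N)))
      (badd (bY L) (ofser (c 0%N))) ->
  (* pi_{i+1} = pi_i o sigma_{i+1} o tau_{i+1} *)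
  (forall i, (i < k)%N ->
     let X1 := bmul (bconst (z i.+1 ^+ t i.+1)) (bXn L (q i.+1)) in
     beq (bmul (bconst (mu i.+1)) (bXn L (e i.+1)))
         (bmul (bconst (mu i)) (bexp X1 (e i))) /\
     beq (badd (bmul (bconst (alpha i.+1)) (bmul (bXn L (r i.+1)) (bY L))) (ofser (S i.+1)))
         (badd (bmul (bmul (bconst (alpha i)) (bexp X1 (r i)))
                     (bmul (bXn L (m i.+1))
                        (badd (badd (bY L) (ofser (c i.+1))) (bconst (z i.+1 ^ s i.+1)))))
               (ofser (xsubst (S i) (z i.+1 ^+ t i.+1) (q i.+1))))) ->
  (* phi_i: monic irreducible in K[[x]][y] with phi_i(mu_i x^(e_i), S_i(x)) = 0 *)
  (forall i, (i <= k)%N ->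
     monicY (phi i) (D i) /\ irredY (phi i) /\
     beq (ysubst (D i) (bxsubst (bmapL L (phi i)) (mu i) (e i)) (ofser (S i))) (bzero L)) ->
  (* F = sum_B f_B Phi^B, B in the set script-B, x-adically convergent *)
  (forall B, f B != 0 ->
     forall i : 'I_k, (B (inord i.+1) < q i.+1 * (size (P i.+1)).-1)%N) ->
  (exists M : nat,
     (forall B, f B != 0 -> forall i : 'I_k.+2, i != ord0 -> (B i <= M)%N) /\
     forall i j, F i j =
       \sum_(B : {ffun 'I_k.+2 -> 'I_(maxn j M).+1})
          f [ffun l => val (B l)] *
          bmul (bXn K (B ord0))
               (\big[@bmul K/bone K]_(l < k.+1) bexp (phi l) (B (inord l.+1))) i j) ->
  (* the valuations v_k *)
  (forall i, (i <= k.+1)%N ->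
     bord (comp_pi (mu k) (alpha k) (e k) (r k) (S k)
             (if i == 0%N then 0%N else D i.-1)
             (if i == 0%N then bXn K 1 else phi i.-1)) (V i)) ->
  bord (comp_pi (mu k) (alpha k) (e k) (r k) (S k) d F) vF ->
  (* conclusion *)
  let inBB (B : {ffun 'I_k.+2 -> nat}) :=
    forall i : 'I_k, (B (inord i.+1) < q i.+1 * (size (P i.+1)).-1)%N in
  let BV (B : {ffun 'I_k.+2 -> nat}) := (\sum_(l < k.+2) B l * V l)%N in
  let Wpts (p : pt) :=
    exists i, (i <= N k)%N /\
      exists B, [/\ inBB B, B ord_max = i, f B != 0,
        (forall B', inBB B' -> B' ord_max = i -> f B' != 0 -> (BV B <= BV B')%N) &
        p = (i%:Q, ((BV B)%:Z - vF%:Z)%:~R)] in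
  forall p : pt, newton_polygon (H k) (N k) p <-> lower_hull Wpts p.
Proof.
move=> _ hchar hF hN0 hc0 hH0 hstep hNk hmu0 hY0 hpi hphi hf1 hf2 hV hvF inBB BV Wpts p.
apply: newton_polygon_expansion; eassumption.
Qed.
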